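(* Let $\alpha\ge 0$ and let $\Omega=\{x\in\mathbb{R}^3 : x_h\in\mathbb{R}^2,\ |x_3|\le(\max(1,r))^\alpha\}$. Let $(v,P)$ be an axially symmetric smooth solution, with $v$ bounded, of $$(v\cdot\nabla)v+\nabla P-\Delta v=0,\qquad \nabla\cdot v=0\quad\text{in }\Omega;\qquad v=0\quad\text{on }\partial\Omega,$$ with finite Dirichlet integral $$\int_{\Omega}|\nabla v(x)|^2\,dx<+\infty .$$ Then: (i) $v\equiv 0$ if $0\le\alpha<1/2$; (ii) $v^\theta\equiv 0$ if $0\le\alpha<3/4$.
   Context: Points are $x=(x_h,x_3)$ with $x_h=(x_1,x_2)$ and $r=|x_h|=\sqrt{x_1^2+x_2^2}$. Here $v:\Omega\to\mathbb{R}^3$ is the velocity and $P:\Omega\to\mathbb{R}$ the pressure. Cylindrical coordinates: $\theta=\arctan(x_2/x_1)$, $e_r=(x_1/r,x_2/r,0)$, $e_\theta=(-x_2/r,x_1/r,0)$, $e_3=(0,0,1)$. Axially symmetric means $v=v^r(r,x_3)e_r+v^\theta(r,x_3)e_\theta+v^3(r,x_3)e_3$ and $P=P(r,x_3)$, i.e. the components $v^r,v^\theta,v^3$ and $P$ do not depend on $\theta$. *)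

(* Defs.v *)
From mathcomp Require Import all_boot all_order all_algebra.
From mathcomp Require Import all_classical all_reals all_analysis.

Set Implicit Arguments.
Unset Strict Implicit.
Unset Printing Implicit Defensive.

Import Order.TTheory GRing.Theory Num.Theory.
Import numFieldNormedType.Exports.

Local Open Scope classical_set_scope.
Local Open Scope ring_scope.

Section defs.
Context {R : realType}.

(* Points and vectors of R^3 are row vectors x with Cartesian coordinates
   x 0 0, x 0 1, x 0 2.  Fields are total functions on R^3, but every predicate
   below depends only on their values on the closed set under consideration. *)
Implicit Types (x : 'rV[R]_3) (K : set 'rV[R]_3).
Implicit Types (f P : 'rV[R]_3 -> R) (v : 'rV[R]_3 -> 'rV[R]_3).

Definition row3 (a b c : R) : 'rV[R]_3 := \row_(i < 3) nth 0 [:: a; b; c] i.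

Definition rho x : R := Num.sqrt (x 0 0 ^+ 2 + x 0 1 ^+ 2).
Definition e_r x : 'rV[R]_3 := row3 (x 0 0 / rho x) (x 0 1 / rho x) 0.
Definition e_theta x : 'rV[R]_3 := row3 (- x 0 1 / rho x) (x 0 0 / rho x) 0.
Definition e_3 : 'rV[R]_3 := row3 0 0 1.

Definition Omega (alpha : R) : set 'rV[R]_3 :=
  [set x : 'rV[R]_3 | `|x 0 2| <= (Num.max 1 (rho x)) `^ alpha].

Definition frontier K : set 'rV[R]_3 := closure K `\` interior K.

Definition component v (i : 'I_3) : 'rV[R]_3 -> R := fun x => v x 0 i.

Definition partial (i : 'I_3) f : 'rV[R]_3 -> R := fun x => 'D_(delta_mx 0 i) f x.

(* partials [:: i; j; ...] f = d_i d_j ... f *)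
Definition partials (s : seq 'I_3) f : 'rV[R]_3 -> R := foldr partial f s.

Definition divergence v x : R := \sum_(i < 3) partial i (component v i) x.
Definition laplacian f x : R := \sum_(j < 3) partial j (partial j f) x.

Definition advection v (i : 'I_3) x : R :=
  \sum_(j < 3) v x 0 j * partial j (component v i) x.

(* f is C^oo up to the boundary of the closed set K: all iterated partial
   derivatives exist in the interior and extend continuously to K, f being its
   own extension. *)
Definition smooth K f : Prop :=
  [/\ {within K, continuous f},
      forall (s : seq 'I_3) (i : 'I_3) x, interior K x ->
        derivable (partials s f) x (delta_mx 0 i) &
      forall s : seq 'I_3, exists g : 'rV[R]_3 -> R,
        {within K, continuous g} /\
        (forall x, interior K x -> g x = partials s f x)].

(* For fields that are smooth on K, the equations on the interior are the
   equations on K, by continuity. *)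
Definition stationary_navier_stokes K v P : Prop :=
  forall x, interior K x ->
    (forall i : 'I_3,
       advection v i x + partial i P x - laplacian (component v i) x = 0) /\
    divergence v x = 0.

Definition axisymmetric K v P (v_r v_theta v_3 p : R -> R -> R) : Prop :=
  (forall x, K x -> 0 < rho x ->
     v x = v_r (rho x) (x 0 2) *: e_r x
           + v_theta (rho x) (x 0 2) *: e_theta x
           + v_3 (rho x) (x 0 2) *: e_3) /\
  (forall x, K x -> P x = p (rho x) (x 0 2)).

Definition grad_sqr v x : R :=
  \sum_(i < 3) \sum_(j < 3) partial j (component v i) x ^+ 2.

(* Integration is on R * R * R, which carries the three-dimensional Lebesgue
   measure, and is restricted to the interior, where the partial derivatives
   are determined; the frontier of Omega alpha is a null set. *)
Definition dirichlet_integral K v : \bar R :=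
  (\int[(lebesgue_measure \x lebesgue_measure) \x lebesgue_measure]_(t in
      [set t : R * R * R | interior K (row3 t.1.1 t.1.2 t.2)])
    (grad_sqr v (row3 t.1.1 t.1.2 t.2))%:E)%E.

End defs.

(* Main.v *)
From HB Require Import structures.
Require Import Defs.
From mathcomp Require Import all_boot all_order all_algebra.
From mathcomp Require Import all_classical all_reals all_analysis.
From mathcomp Require Import measurable_realfun.
From mathcomp Require Import ring lra.

Set Implicit Arguments.
Unset Strict Implicit.
Unset Printing Implicit Defensive.

Import Order.TTheory GRing.Theory Num.Theory.
Import numFieldNormedType.Exports.

Local Open Scope classical_set_scope.
Local Open Scope ring_scope.

(** Axial symmetry reduces everything to the half-plane x_2 = 0, x_1 = r > 0,
    where v^r, v^theta, v^3 and P become functions a, b, c, P of (r, z) on the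
    channel |z| < h r, with h r = max(1, r)^alpha.  The derivatives in x_2 of the
    Cartesian components at x_2 = 0 are algebraic in these functions
    ([azimuthal_partials]), which turns the equations into those of the record
    [flow]; the vertical derivatives alone already give a finite weighted integral
    of a_z^2 + b_z^2 + c_z^2 ([dirichlet_bound]).  As v vanishes on the walls,
    these derivatives control v itself through a Poincare inequality with constant
    of order (h S)^2 on r < S ([poincare]).

    (i) Let psi be the Stokes stream function: r a = - psi_z, r c = psi_r, and psi
    vanishes on the walls.  With the cutoff phi = (1 - r^2/S^2)^3, the field
    phi v + (phi'/r) psi e_3 is divergence free and vanishes on the walls and on
    r = S, so testing the equations with it yields an energy identity without
    pressure ([energy_le_remainder]).  Every remaining term carries a derivative of
    phi, that is a factor 1/S, while Poincare's inequality bounds the integral of v^2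
    by (h S)^2 times that of v_z^2, and the integral of psi^2 by a further factor
    (S h S)^2.  The integral of v_z^2 over r < S/2 is thus O((h S)^2 / S)
    ([energy_bound]), which tends to 0 when alpha < 1/2; then v_z = 0, and v = 0 by
    the wall condition ([flow_still]).

    (ii) The circulation Gamma = r v^theta satisfies the transport-diffusion
    equation v . grad Gamma = Laplacian Gamma - (2/r) Gamma_r, so that the energy
    E(S), the integral of r |grad Gamma|^2 over r < S, equals a flux through the
    slice r = S ([swirl_energy]).  This flux is bounded by
    (A + B d(s)) E'(s), where d(s), the integral of a_z^2 over the slice, is
    integrable against s ds because it is part of the Dirichlet integral
    ([slice_estimate]).  Integrating from R to 2 R gives E(R) <= E(2 R) / 32 for
    large R as soon as h^5 / R^4 tends to 0, which holds for alpha < 4/5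
    ([doubling_step]).  As |v| is bounded, E(R) = O(R^4) ([swirl_growth]), and
    32 > 2^4 forces E = 0 ([flow_swirl_free]).

    The planar statements concern functions that are only controlled inside the
    channel, so differentiation and integration are tied together by the predicates
    [tame], [vanishing] and [wall_vanishing]: integrals of divergences over truncated
    channels reduce to slices ([chan_int_dz], [chan_int_dr]). *)

(** * One-dimensional calculus *)

Lemma itv_integrable {R : realType} (f : R -> R) (a b C : R) :
  (forall y, a < y < b -> {for y, continuous f}) -> (forall y, a < y < b -> `|f y| <= C) ->
  lebesgue_measure.-integrable `]a, b[ (EFin \o f).
Proof.
move=> cf fC; apply: measurable_bounded_integrable => //=.
- by rewrite lebesgue_measure_itv /=; case: ifP => // _; rewrite -EFinB ltry.
- apply: open_continuous_measurable_fun; first exact: interval_open.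
  by move=> y; rewrite inE /= in_itv /=; exact: cf.
- exists C; split; first by rewrite num_real.
  by move=> t Ct y /=; rewrite in_itv /= => yab; rewrite (le_trans _ (ltW Ct))// fC.
Qed.

Lemma cst_itv_integrable {R : realType} (k a b : R) (l r : bool) :
  lebesgue_measure.-integrable [set` Interval (BSide l a) (BSide r b)] (EFin \o cst k).
Proof.
apply: measurable_bounded_integrable => //=.
  by rewrite lebesgue_measure_itv /=; case: ifP => // _; rewrite -EFinB ltry.
exists `|k|; split; first by rewrite num_real.
by move=> t kt y _ /=; exact: ltW.
Qed.

Lemma norm_Rintegral_itv_le {R : realType} (f : R -> R) (a b C : R) (l r : bool) : a < b ->
  lebesgue_measure.-integrable [set` Interval (BSide l a) (BSide r b)] (EFin \o f) ->
  (forall y, y \in Interval (BSide l a) (BSide r b) -> `|f y| <= C) ->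
  `|\int[lebesgue_measure]_(y in [set` Interval (BSide l a) (BSide r b)]) f y| <= C * (b - a).
Proof.
move=> ab fi fC; apply: le_trans (le_normr_Rintegral _ fi) _ => //.
apply: (@le_trans _ _ (\int[lebesgue_measure]_(y in [set` Interval (BSide l a) (BSide r b)])
    (cst C) y)%R).
  by apply: le_Rintegral => //; [exact: integrable_norm fi|exact: cst_itv_integrable].
by rewrite Rintegral_cst//= lebesgue_measure_itv /= lte_fin ab -EFinB.
Qed.

(** The integrand is only bounded near a: the theorem is applied on [x, b] and x
    tends to a, the integral over ]a, x[ being at most C (x - a). *)
Lemma itv_FTC_left {R : realType} (f F : R -> R) (a b C : R) : a < b ->
  (forall x, a < x <= b -> is_derive x 1 F (f x)) ->
  (forall x, a < x <= b -> {for x, continuous f}) ->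
  (forall x, a < x <= b -> `|f x| <= C) ->
  F x @[x --> a^'+] --> 0 ->
  \int[lebesgue_measure]_(x in `]a, b[) f x = F b.
Proof.
move=> ab dF cf fC F0.
set mu := lebesgue_measure.
have intf : mu.-integrable `]a, b[ (EFin \o f).
  by apply: (@itv_integrable _ _ _ _ C) => y /andP[ay yb]; [apply: cf|apply: fC]; rewrite ay ltW.
have key (x : R) : a < x < b ->
    `|\int[mu]_(x in `]a, b[) f x - F b| <= C * (x - a) + `|F x|.
  move=> /andP[ax xb].
  have -> : \int[mu]_(t in `]a, b[) f t =
      \int[mu]_(t in `]a, x[) f t + \int[mu]_(t in `[x, b[) f t.
    rewrite -Rintegral_setU //=.
    - by congr (Rintegral mu _ f); rewrite -itv_bndbnd_setU ?bnd_simp // ltW.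
    - rewrite -itv_bndbnd_setU ?bnd_simp // ?ltW //.
    - apply/disj_setPS => t [/=]; rewrite !in_itv /= => /andP[_ tx] /andP[xt _].
      by move: (lt_le_trans tx xt); rewrite ltxx.
  have -> : \int[mu]_(t in `[x, b[) f t = F b - F x.
    rewrite Rintegral_itv_bndo_bndc; last first.
      apply: (integrableS _ _ _ intf) => //.
      by apply: subset_itvr; rewrite bnd_simp.
    rewrite /Rintegral (@continuous_FTC2 _ _ F)//.
    - apply: continuous_in_subspaceT => t; rewrite inE /= in_itv /= => /andP[xt tb].
      by apply: cf; rewrite tb (lt_le_trans ax).
    - split.
      + move=> t; rewrite in_itv /= => /andP[xt tb].
        have [] // := dF t; first by rewrite (lt_trans ax xt) ltW.
      + apply: cvg_at_right_filter.
        have [+ _] : is_derive x 1 F (f x) by apply: dF; rewrite ax ltW.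
        by move=> /derivable1_diffP/differentiable_continuous.
      + apply: cvg_at_left_filter.
        have [+ _] : is_derive b 1 F (f b) by apply: dF; rewrite ab lexx.
        by move=> /derivable1_diffP/differentiable_continuous.
    - move=> t; rewrite in_itv /= => /andP[xt tb].
      rewrite derive1E; apply: derive_val. apply: dF. by rewrite (lt_trans ax xt) ltW.
  have -> : \int[mu]_(t in `]a, x[) f t + (F b - F x) - F b =
     \int[mu]_(t in `]a, x[) f t - F x by ring.
  rewrite (le_trans (ler_normB _ _))// lerD2r.
  have intf' : mu.-integrable `]a, x[ (EFin \o f).
    apply: (integrableS _ _ _ intf) => //.
    by apply: subset_itvl; rewrite bnd_simp ltW.
  apply: norm_Rintegral_itv_le => // t; rewrite in_itv /= => /andP[at_ tx]; apply: fC.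
  by rewrite at_ ltW// (lt_trans tx).
apply/eqP; rewrite -subr_eq0 -normr_le0.
have Fn : `|F x| @[x --> a^'+] --> (0 : R).
  exact/norm_cvg0P.
have Cx : C * (x - a) @[x --> a^'+] --> (0 : R).
  have : C * (x - a) @[x --> a^'+] --> C * (a - a).
    apply: cvgMr; apply: cvgB; last exact: cvg_cst.
    by apply: cvg_at_right_filter; exact: cvg_id.
  by rewrite subrr mulr0.
have Hc : C * (x - a) + `|F x| @[x --> a^'+] --> (0 : R).
  by rewrite -[X in _ --> X](addr0 (0 : R)); apply: cvgD.
rewrite -(cvg_lim _ Hc)//; apply: limr_ge; first by apply/cvg_ex; exists 0.
near=> x; apply: key; apply/andP; split; near: x => //.
  exact: nbhs_right_gt.
exact: nbhs_right_lt.
Unshelve. all: by end_near. Qed.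

Lemma itv_FTC_both {R : realType} (f F : R -> R) (a b C : R) : a < b ->
  (forall x, a < x < b -> is_derive x 1 F (f x)) ->
  (forall x, a < x < b -> {for x, continuous f}) ->
  (forall x, a < x < b -> `|f x| <= C) ->
  F x @[x --> a^'+] --> 0 -> F x @[x --> b^'-] --> 0 ->
  \int[lebesgue_measure]_(x in `]a, b[) f x = 0.
Proof.
move=> ab dF cf fC F0 Fb.
set mu := lebesgue_measure.
have intf : mu.-integrable `]a, b[ (EFin \o f) by exact: itv_integrable cf fC.
have key (x : R) : a < x < b ->
    `|\int[mu]_(x in `]a, b[) f x| <= C * (b - x) + `|F x|.
  move=> /andP[ax xb].
  have -> : \int[mu]_(t in `]a, b[) f t =
      \int[mu]_(t in `]a, x[) f t + \int[mu]_(t in `[x, b[) f t.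
    rewrite -Rintegral_setU //=.
    - by congr (Rintegral mu _ f); rewrite -itv_bndbnd_setU ?bnd_simp // ltW.
    - rewrite -itv_bndbnd_setU ?bnd_simp // ?ltW //.
    - apply/disj_setPS => t [/=]; rewrite !in_itv /= => /andP[_ tx] /andP[xt _].
      by move: (lt_le_trans tx xt); rewrite ltxx.
  have -> : \int[mu]_(t in `]a, x[) f t = F x.
    by apply: (@itv_FTC_left _ _ _ _ _ C) => // t /andP[at_ tx];
       [apply: dF|apply: cf|apply: fC]; rewrite at_ (le_lt_trans tx).
  rewrite (le_trans (ler_normD _ _))// addrC lerD2r.
  have intf' : mu.-integrable `[x, b[ (EFin \o f).
    apply: (integrableS _ _ _ intf) => //.
    by apply: subset_itvr; rewrite bnd_simp.
  apply: norm_Rintegral_itv_le => // t; rewrite in_itv /= => /andP[xt tb]; apply: fC.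
  by rewrite tb (lt_le_trans ax).
apply/eqP; rewrite -normr_le0.
have Fn : `|F x| @[x --> b^'-] --> (0 : R) by exact/norm_cvg0P.
have Cx : C * (b - x) @[x --> b^'-] --> (0 : R).
  have : C * (b - x) @[x --> b^'-] --> C * (b - b).
    apply: cvgMr; apply: cvgB; first exact: cvg_cst.
    by apply: cvg_at_left_filter; exact: cvg_id.
  by rewrite subrr mulr0.
have Hc : C * (b - x) + `|F x| @[x --> b^'-] --> (0 : R).
  by rewrite -[X in _ --> X](addr0 (0 : R)); apply: cvgD.
rewrite -(cvg_lim _ Hc)//; apply: limr_ge; first by apply/cvg_ex; exists 0.
near=> x; apply: key; apply/andP; split; near: x => //.
  exact: nbhs_left_gt.
exact: nbhs_left_lt.
Unshelve. all: by end_near. Qed.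

(** * Open sets and continuous functions on products *)

(** A countable topological base whose members belong to M: closure of M under
    countable unions then puts every open set in M. *)
Definition countable_base (T : topologicalType) (M : set_system T) :=
  exists B : nat -> set T, (forall n, M (B n)) /\
    forall x A, nbhs x A -> exists n, B n x /\ B n `<=` A.

Lemma open_countable_base (T : topologicalType) (M : set_system T) (A : set T) :
  (forall F : nat -> set T, (forall n, M (F n)) -> M (\bigcup_n F n)) ->
  M set0 -> countable_base M -> open A -> M A.
Proof.
move=> MU M0 [B [MB Bn]] oA.
have -> : A = \bigcup_n (if `[< B n `<=` A >] then B n else set0).
  apply/seteqP; split=> [x Ax|x [n _]]; last first.
    by case: asboolP => // /[apply].
  have [n [Bx BA]] := Bn x A (open_nbhs_nbhs (conj oA Ax)).
  by exists n => //; case: asboolP.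
by apply: MU => n; case: ifP.
Qed.

Lemma countable_baseX (T1 T2 : topologicalType) (M1 : set_system T1)
    (M2 : set_system T2) (M : set_system (T1 * T2)) :
  (forall A B, M1 A -> M2 B -> M (A `*` B)) ->
  countable_base M1 -> countable_base M2 -> countable_base M.
Proof.
move=> MX [B1 [m1 b1]] [B2 [m2 b2]].
pose B n := if unpickle n is Some (i, j) then B1 i `*` B2 j else B1 0 `*` B2 0.
exists B; split.
  by move=> n; rewrite /B; case: unpickle => [[i j]|]; apply: MX.
move=> [x y] A [[/= P Q] [/b1 [i [ix iP]] /b2 [j [jy jQ]]] PQ].
exists (pickle (i, j)); rewrite /B pickleK; split=> // -[u w] /= [iu jw].
by apply: PQ; split; [exact: iP|exact: jQ].
Qed.

Lemma countable_base_real (R : realType) :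
  @countable_base R (@measurable _ (measurableTypeR R)).
Proof.
pose B n : set R := if unpickle n is Some (p, q) then
   `](ratr (p : rat) : R), (ratr (q : rat) : R)[%classic else set0.
exists B; split.
  by move=> n; rewrite /B; case: unpickle => [[i j]|].
move=> x A /nbhs_ballP[e /= e0 xA].
have ex : x - e < x by rewrite ltrBlDr ltrDl.
have [p] := rat_in_itvoo ex.
rewrite in_itv /= => /andP[ep px].
have xe : x < x + e by rewrite ltrDl.
have [q] := rat_in_itvoo xe.
rewrite in_itv /= => /andP[xq qe].
exists (pickle (p, q)); rewrite /B pickleK /= in_itv /= px xq; split => //.
move=> y /=; rewrite in_itv /= => /andP[py yq]; apply: xA.
rewrite /ball /= ltr_distlC (lt_trans ep) //=.
exact: lt_trans qe.
Qed.

Lemma countable_base_plane (R : realType) :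
  @countable_base (R * R)%type
    (@measurable _ (measurableTypeR R * measurableTypeR R)%type).
Proof.
apply: (@countable_baseX R R _ _ _ _ (countable_base_real R) (countable_base_real R)).
by move=> A B mA mB; apply: measurableX.
Qed.

(** The product sigma-algebra is generated by rectangles, and open sets are countable
    unions of rectangles with rational sides. *)
Lemma open_measurable_plane (R : realType) (A : set (R * R)) : open A ->
  @measurable _ (measurableTypeR R * measurableTypeR R)%type A.
Proof.
apply: (@open_countable_base (R * R)%type) => //.
- by move=> F mF; apply: bigcupT_measurable.
- exact: countable_base_plane.
Qed.

Lemma open_measurable_space (R : realType) (A : set (R * R * R)) : open A ->
  @measurable _ (measurableTypeR R * measurableTypeR R * measurableTypeR R)%type A.
Proof.
apply: (@open_countable_base (R * R * R)%type) => //.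
- by move=> F mF; apply: bigcupT_measurable.
- apply: (@countable_baseX (R * R)%type R _ _ _ _ (countable_base_plane R) (countable_base_real R)).
  by move=> B C mB mC; apply: measurableX.
Qed.

Lemma open_preimage_measurable_fun {R : realType} d (T : measurableType d) (A : set T)
    (f : T -> R) : (forall V, open V -> measurable (A `&` f @^-1` V)) ->
  measurable_fun A f.
Proof.
move=> oV; apply: (measurability _ (RGenOpens.measurableE R)) => /=.
by move=> _ [_ [a [b ->] <-]]; apply: oV; exact: interval_open.
Qed.

Lemma open_setI_preimage (T U : topologicalType) (A : set T) (f : T -> U) (V : set U) :
  open A -> (forall x, A x -> {for x, continuous f}) -> open V -> open (A `&` f @^-1` V).
Proof.
move=> oA cf oV; rewrite openE => x [Ax Vx].
apply: filterI; first exact: open_nbhs_nbhs.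
by apply: cf => //; exact: open_nbhs_nbhs.
Qed.

Lemma continuous_plane_measurable {R : realType} (A : set (R * R)) (f : R * R -> R) :
  open A -> (forall p, A p -> {for p, continuous f}) ->
  @measurable_fun _ _ (measurableTypeR R * measurableTypeR R)%type R A f.
Proof.
move=> oA cf; apply: open_preimage_measurable_fun => V oV.
by apply: open_measurable_plane; exact: open_setI_preimage.
Qed.

Lemma continuous_space_measurable {R : realType} (A : set (R * R * R)) (f : R * R * R -> R) :
  open A -> (forall p, A p -> {for p, continuous f}) ->
  @measurable_fun _ _ (measurableTypeR R * measurableTypeR R * measurableTypeR R)%type R A f.
Proof.
move=> oA cf; apply: open_preimage_measurable_fun => V oV.
by apply: open_measurable_space; exact: open_setI_preimage.
Qed.

(** * Integrals over planar domains *)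

Section slices.
Context {R : realType}.
Local Notation mu := (@lebesgue_measure R).
Local Notation mu2 := (mu \x mu)%E.
Local Notation plane := (measurableTypeR R * measurableTypeR R)%type.
Implicit Types (A : set plane) (f : R -> R -> R).

Definition int2 A f : R := \int[mu2]_(p in A) f p.1 p.2.

Lemma box_finite A (a b c d : R) : measurable A ->
  A `<=` `]a, b[ `*` `]c, d[ -> (mu2 A < +oo)%E.
Proof.
move=> mA AB; apply: (@le_lt_trans _ _ (mu2 (`]a, b[ `*` `]c, d[))).
  by apply: le_measure => //; rewrite inE //; exact: measurableX.
rewrite product_measure1E// /= !lebesgue_measure_itv /=.
by do 2 case: ifP => _; rewrite ?mule0 ?mul0e// -!EFinB -EFinM ltry.
Qed.

Lemma bounded_integrable2 A f (a b c d C : R) : measurable A ->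
  A `<=` `]a, b[ `*` `]c, d[ ->
  measurable_fun A (fun p : plane => f p.1 p.2) -> (forall p, A p -> `|f p.1 p.2| <= C) ->
  mu2.-integrable A (EFin \o (fun p : plane => f p.1 p.2)).
Proof.
move=> mA AB mf fC; apply: measurable_bounded_integrable => //.
  exact: box_finite AB.
exists C; split; first by rewrite num_real.
by move=> x Cx y Ay; rewrite /= (le_trans _ (ltW Cx))// fC.
Qed.

Lemma int2_slice A f (a b c d C : R) : measurable A ->
  A `<=` `]a, b[ `*` `]c, d[ ->
  measurable_fun A (fun p : plane => f p.1 p.2) -> (forall p, A p -> `|f p.1 p.2| <= C) ->
  (int2 A f)%:E = (\int[mu]_x (\int[mu]_(y in xsection A x) f x y)%R%:E)%E /\
  (int2 A f)%:E = (\int[mu]_y (\int[mu]_(x in ysection A y) f x y)%R%:E)%E.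
Proof.
move=> mA AB mf fC.
have fi := bounded_integrable2 mA AB mf fC.
have fiT : mu2.-integrable setT ((EFin \o (fun p : plane => f p.1 p.2)) \_ A).
  by apply/integrable_restrict => //; rewrite setTI.
have E : (int2 A f)%:E = (\int[mu2]_p ((EFin \o (fun p : plane => f p.1 p.2)) \_ A) p)%E.
  rewrite -integral_mkcond /int2 /Rintegral fineK//.
  exact: integrable_fin_num.
have sx x : xsection A x `<=` `]c, d[.
  by move=> y; rewrite /xsection /= inE => /AB[].
have sy y : ysection A y `<=` `]a, b[.
  by move=> x; rewrite /ysection /= inE => /AB[].
have finI (i : interval R) (B : set R) : B `<=` [set` i] -> measurable B ->
   (exists u v, i = `]u, v[) -> (mu B < +oo)%E.
  move=> Bi mB [u [v ei]]; subst i; apply: (@le_lt_trans _ _ (mu `]u, v[)).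
    by apply: le_measure => //; rewrite inE.
  by rewrite lebesgue_measure_itv /=; case: ifP => _; rewrite // -EFinB ltry.
split; rewrite E.
- rewrite -integral12_prod_meas1//; apply: eq_integral => x _; rewrite /fubini_F.
  have mx : measurable (xsection A x) by exact: measurable_xsection.
  rewrite /Rintegral fineK.
    rewrite [RHS]integral_mkcond; apply: eq_integral => y _.
    by rewrite !patchE /= mem_xsection.
  apply: integrable_fin_num => //; apply: measurable_bounded_integrable => //.
  + by apply: finI (sx x) _ _ => //; exists c, d.
  + rewrite (_ : f x = (fun p => f p.1 p.2) \o (pair x))//.
    apply: (measurable_comp mA) => //.
      by move=> _ [y + <-]; rewrite /xsection /= inE.
    by apply: measurable_funTS; exact: pair1_measurable.
  + exists C; split; first by rewrite num_real.
    move=> t Ct y; rewrite /xsection /= inE => Ay.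
    by rewrite /= (le_trans _ (ltW Ct))// (fC (x, y)).
- rewrite -integral21_prod_meas1//; apply: eq_integral => y _; rewrite /fubini_G.
  have my : measurable (ysection A y) by exact: measurable_ysection.
  rewrite /Rintegral fineK.
    rewrite [RHS]integral_mkcond; apply: eq_integral => x _.
    by rewrite !patchE /= mem_ysection.
  apply: integrable_fin_num => //; apply: measurable_bounded_integrable => //.
  + by apply: finI (sy y) _ _ => //; exists a, b.
  + rewrite (_ : f^~ y = (fun p => f p.1 p.2) \o (fun x => (x, y)))//.
    apply: (measurable_comp mA) => //.
      by move=> _ [x + <-]; rewrite /ysection /= inE.
    by apply: measurable_funTS; exact: pair2_measurable.
  + exists C; split; first by rewrite num_real.
    move=> t Ct x; rewrite /ysection /= inE => Ay.
    by rewrite /= (le_trans _ (ltW Ct))// (fC (x, y)).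
Qed.

End slices.

(** * Channels in the meridian half-plane *)

Section meridian.
Context {R : realType}.
Local Notation mu := (@lebesgue_measure R).
Local Notation plane := (measurableTypeR R * measurableTypeR R)%type.
Implicit Types (h : R -> R) (f g F G H : R -> R -> R).

(** Half-heights of the channels |z| < h r. *)
Definition profile h :=
  [/\ continuous h, {homo h : x y / x <= y} & forall x, 1 <= h x].

(** The cut z < Z serves the stream function, whose value at height Z is the flux
    through the part of the channel below Z. *)
Definition dom h (S Z : R) : set plane :=
  [set p | [/\ 0 < p.1 < S, `|p.2| < h p.1 & p.2 < Z]].

Lemma continuous_fst2 (g : R -> R) : continuous g ->
  continuous (fun p : R * R => g p.1).
Proof. by move=> cg p; apply: continuous_comp; [exact: cvg_fst|exact: cg]. Qed.

Lemma continuous_snd2 (g : R -> R) : continuous g ->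
  continuous (fun p : R * R => g p.2).
Proof. by move=> cg p; apply: continuous_comp; [exact: cvg_snd|exact: cg]. Qed.

Lemma open_ltr_fun (T : topologicalType) (u w : T -> R) :
  continuous u -> continuous w -> open [set p | u p < w p].
Proof.
move=> cu cw.
rewrite (_ : [set _ | _] = (fun p => w p - u p) @^-1` [set t | 0 < t]).
  by apply: open_comp; [move=> p _; apply: cvgB; [exact: cw|exact: cu]|exact: open_gt].
by apply/seteqP; split=> p /=; rewrite subr_gt0.
Qed.

Lemma dom_open h S Z : profile h -> open (dom h S Z : set (R * R)).
Proof.
move=> [ch _ _].
have -> : dom h S Z = [set p : R * R | 0 < p.1] `&` [set p | p.1 < S] `&`
    [set p | `|p.2| < h p.1] `&` [set p | p.2 < Z].
  apply/seteqP; split=> p; first by move=> [/andP[? ?] ? ?]; do !split.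
  by move=> [[[/= ? ?] ?] ?]; split=> //; apply/andP.
have c1 : continuous (fun p : R * R => p.1) by move=> p; exact: cvg_fst.
have c2 : continuous (fun p : R * R => p.2) by move=> p; exact: cvg_snd.
do 3 ?apply: openI; apply: open_ltr_fun => //; try exact: cst_continuous.
- by apply: continuous_snd2; exact: norm_continuous.
- exact: continuous_fst2.
Qed.

Lemma dom_measurable h S Z : profile h -> measurable (dom h S Z).
Proof. by move=> /dom_open/open_measurable_plane. Qed.

Lemma dom_box h S Z : profile h -> dom h S Z `<=` `]0, S[ `*` `]- h S, h S[.
Proof.
move=> [_ mh _] [r z] [/= /andP[r0 rS] zr _]; rewrite !in_itv /= r0 rS; split=> //.
by rewrite -ltr_norml (lt_le_trans zr)// mh// ltW.
Qed.

Lemma dom_xsection h S Z r : 0 < r < S ->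
  xsection (dom h S Z) r = `]- h r, Num.min (h r) Z[%classic.
Proof.
move=> rS; apply/seteqP; split=> z; rewrite /xsection /= inE in_itv /= lt_min.
  by move=> [_ /=]; rewrite ltr_norml => /andP[-> ->] ->.
by move=> /and3P[? ? ?]; split=> //=; rewrite ltr_norml; apply/andP.
Qed.

Lemma dom_xsection0 h S Z r : ~~ (0 < r < S) -> xsection (dom h S Z) r = set0.
Proof.
move=> rS; apply/seteqP; split=> z //; rewrite /xsection /= inE.
by move=> [/= r1]; rewrite r1 in rS.
Qed.

Lemma dom_ysection0 h S Z z : profile h -> ~~ ((`|z| < h S) && (z < Z)) ->
  ysection (dom h S Z) z = set0.
Proof.
move=> [_ mh _] zS; apply/seteqP; split=> r //; rewrite /ysection /= inE.
move=> [/= /andP[r0 rS] zr zZ]; move: zS; rewrite zZ andbT => /negP; apply.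
by rewrite (lt_le_trans zr)// mh// ltW.
Qed.

(** As h is nondecreasing, a horizontal section is a single interval starting either
    on the axis or on the wall; the equation [r0 * (h r0 - `|z|) = 0] records this
    alternative and makes [vanishing] functions vanish at r0. *)
Lemma dom_ysection h S Z z : profile h -> 0 < S -> `|z| < h S -> z < Z ->
  exists r0 : R, [/\ 0 <= r0 < S, ysection (dom h S Z) z = `]r0, S[%classic,
    r0 * (h r0 - `|z|) = 0 & forall r : R, r0 < r -> `|z| < h r].
Proof.
move=> [ch mh h1] S0 zS zZ.
pose B := [set r | r = 0 \/ [/\ 0 <= r & h r <= `|z|]].
have B0 : B 0 by left.
have ubB : ubound B S.
  move=> r [->|[r0 hr]]; first exact: ltW.
  rewrite leNgt; apply/negP => Sr.
  by have := lt_le_trans zS (le_trans (mh _ _ (ltW Sr)) hr); rewrite ltxx.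
have hsB : has_sup B by split; [exists 0|exists S].
set r0 := sup B.
have r00 : 0 <= r0 by apply: ub_le_sup => //; case: hsB.
have gt r : r0 < r -> `|z| < h r.
  move=> r0r; rewrite ltNge; apply/negP => hr.
  suff : r <= r0 by rewrite leNgt r0r.
  apply: ub_le_sup; first by case: hsB.
  by right; split=> //; rewrite (le_trans r00)// ltW.
have le0 : 0 < r0 -> h r0 <= `|z|.
  move=> r0gt; rewrite leNgt; apply/negP => zr.
  have : \forall r \near r0, `|z| < h r.
    by apply: (@cvgr_gt _ _ (nbhs r0)) zr; exact: ch.
  move=> /nbhs_ballP[e /= e0 He].
  have e'0 : 0 < Num.min e r0 by rewrite lt_min e0.
  have [t Bt] := sup_adherent e'0 hsB; rewrite -/r0 => tr.
  have tr0 : t <= r0 by apply: ub_le_sup => //; case: hsB.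
  have t0 : 0 < t.
    by apply: le_lt_trans tr; rewrite subr_ge0 ge_min lexx orbT.
  case: Bt => [tE|[_ ht]]; first by rewrite tE ltxx in t0.
  suff : `|z| < h t by rewrite ltNge ht.
  apply: He; rewrite /ball /= ger0_norm ?subr_ge0// ltrBlDr addrC -ltrBlDr.
  by apply: le_lt_trans tr; rewrite lerD2l lerN2 ge_min lexx.
have r0S : r0 < S.
  rewrite ltNge; apply/negP => Sr.
  have := le0 (lt_le_trans S0 Sr); rewrite leNgt => /negP; apply.
  by rewrite (lt_le_trans zS)// mh.
have hr0 : 0 < r0 -> h r0 = `|z|.
  move=> r0gt; apply/eqP; rewrite eq_le le0//=.
  have hc : h r @[r --> r0^'+] --> h r0.
    by apply: cvg_at_right_filter; exact: ch.
  rewrite -(cvg_lim _ hc)//; apply: limr_ge; first by apply/cvg_ex; exists (h r0).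
  near=> r; apply/ltW/gt; near: r; exact: nbhs_right_gt.
exists r0; split=> //.
- by rewrite r00.
- apply/seteqP; split=> r; rewrite /ysection /= inE in_itv /=.
    move=> [/= /andP[rgt ->] zr _]; rewrite andbT ltNge; apply/negP => rr0.
    have r0gt := lt_le_trans rgt rr0.
    by move: (lt_le_trans zr (le_trans (mh _ _ rr0) (le0 r0gt))); rewrite ltxx.
  move=> /andP[r0r rS]; split=> //=; first by rewrite rS (le_lt_trans r00).
  exact: gt.
- move: r00; rewrite le_eqVlt => /predU1P[<-|/hr0 ->]; first by rewrite mul0r.
  by rewrite subrr mulr0.
Unshelve. all: by end_near. Qed.

(** Continuity inside the channel and boundedness for bounded r: enough to integrate
    over truncated channels, and stable under products, unlike integrability. *)
Definition tame h f :=
  (forall r z : R, 0 < r -> `|z| < h r ->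
     {for (r, z), continuous (fun p : R * R => f p.1 p.2)}) /\
  (forall S, exists C : R, forall r z : R, 0 < r < S -> `|z| < h r -> `|f r z| <= C).

Lemma continuous_pair_r (r z : R) : {for r, continuous (fun t : R => (t, z))}.
Proof.
have H := @cvg_pair _ _ _ (nbhs r) (nbhs r) (nbhs z) _ _ _ (fun t => t) (fun=> z).
by apply: H; [exact: cvg_id|exact: cvg_cst].
Qed.

Lemma continuous_pair_z (r z : R) : {for z, continuous (fun t : R => (r, t))}.
Proof.
have H := @cvg_pair _ _ _ (nbhs z) (nbhs r) (nbhs z) _ _ _ (fun=> r) (fun t => t).
by apply: H; [exact: cvg_cst|exact: cvg_id].
Qed.

Lemma tame_continuous_r h f r z : tame h f -> 0 < r -> `|z| < h r ->
  {for r, continuous (f ^~ z)}.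
Proof.
move=> [cf _] r0 zr.
apply: (@continuous_comp _ _ _ (fun t => (t, z)) (fun p : R * R => f p.1 p.2)).
  exact: continuous_pair_r.
exact: cf.
Qed.

Lemma tame_continuous_z h f r z : tame h f -> 0 < r -> `|z| < h r ->
  {for z, continuous (f r)}.
Proof.
move=> [cf _] r0 zr.
apply: (@continuous_comp _ _ _ (fun t => (r, t)) (fun p : R * R => f p.1 p.2)).
  exact: continuous_pair_z.
exact: cf.
Qed.

Lemma tameD h f g : tame h f -> tame h g -> tame h (fun r z => f r z + g r z).
Proof.
move=> [cf bf] [cg bg]; split.
  by move=> r z r0 zr; apply: cvgD; [exact: cf|exact: cg].
move=> S; have [C fC] := bf S; have [D gD] := bg S.
exists (C + D) => r z rS zr; rewrite (le_trans (ler_normD _ _))// lerD//.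
  exact: fC.
exact: gD.
Qed.

Lemma tameN h f : tame h f -> tame h (fun r z => - f r z).
Proof.
move=> [cf bf]; split; first by move=> r z r0 zr; apply: cvgN; exact: cf.
by move=> S; have [C fC] := bf S; exists C => r z ? ?; rewrite normrN fC.
Qed.

Lemma tameM h f g : tame h f -> tame h g -> tame h (fun r z => f r z * g r z).
Proof.
move=> [cf bf] [cg bg]; split.
  by move=> r z r0 zr; apply: cvgM; [exact: cf|exact: cg].
move=> S; have [C fC] := bf S; have [D gD] := bg S.
exists (C * D) => r z rS zr; rewrite normrM ler_pM//.
  exact: fC.
exact: gD.
Qed.

Lemma tameX h f n : tame h f -> tame h (fun r z => f r z ^+ n).
Proof.
move=> tf; elim: n => [|n IH].
  rewrite (_ : (fun r z => f r z ^+ 0) = fun _ _ => 1)//.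
  by split=> [r z _ _|S]; [exact: cvg_cst|exists 1 => r z _ _; rewrite normr1].
rewrite (_ : (fun r z => f r z ^+ n.+1) = fun r z => f r z * f r z ^+ n).
  exact: tameM.
by do 2 apply/funext => ?; rewrite exprS.
Qed.

Lemma tame_cst h (k : R) : tame h (fun _ _ => k).
Proof. by split=> [r z _ _|S]; [exact: cvg_cst|exists `|k|]. Qed.

Lemma tame_r h : tame h (fun r _ => r).
Proof.
split=> [r z _ _|S]; first exact: cvg_fst.
by exists S => r z /andP[r0 rS] _; rewrite gtr0_norm// ltW.
Qed.

Lemma tame_z h : profile h -> tame h (fun _ z => z).
Proof.
move=> [_ mh _]; split=> [r z _ _|S]; first exact: cvg_snd.
exists (h S) => r z /andP[r0 rS] zr; rewrite ltW// (lt_le_trans zr)// mh//.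
exact: ltW.
Qed.

(** At Z = h S the cut of [dom] is inactive, since |z| < h r <= h S. *)
Definition chan_int h S f : R := int2 (dom h S (h S)) f.

Lemma tame_dom_measurable h S Z f : profile h -> tame h f ->
  measurable_fun (dom h S Z) (fun p : plane => f p.1 p.2).
Proof.
move=> ph [cf _]; apply: (continuous_plane_measurable (dom_open ph)).
by move=> [r z] [/= /andP[r0 _] zr _]; exact: cf.
Qed.

Lemma tame_dom_integrable h S Z f : profile h -> tame h f ->
  (mu \x mu)%E.-integrable (dom h S Z) (EFin \o (fun p : plane => f p.1 p.2)).
Proof.
move=> ph tf; have [C fC] := tf.2 S.
apply: (@bounded_integrable2 R (dom h S Z) f _ _ _ _ C (dom_measurable _ _ ph) (dom_box ph)).
  exact: tame_dom_measurable.
by move=> [r z] [/= rS zr _]; exact: fC.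
Qed.

Lemma chan_int_le h S f g : profile h -> tame h f -> tame h g ->
  (forall r z : R, 0 < r < S -> `|z| < h r -> f r z <= g r z) -> chan_int h S f <= chan_int h S g.
Proof.
move=> ph tf tg fg; apply: le_Rintegral.
- exact: dom_measurable.
- exact: tame_dom_integrable.
- exact: tame_dom_integrable.
- by move=> [r z] [/= rS zr _]; exact: fg.
Qed.

Lemma chan_intD h S f g : profile h -> tame h f -> tame h g ->
  chan_int h S (fun r z => f r z + g r z) = chan_int h S f + chan_int h S g.
Proof.
move=> ph tf tg; rewrite /chan_int /int2.
apply: (@RintegralD _ _ _ _ _ (fun p : plane => f p.1 p.2) (fun p : plane => g p.1 p.2)).
- exact: dom_measurable.
- exact: tame_dom_integrable.
- exact: tame_dom_integrable.
Qed.

Lemma chan_intZ h S k f : profile h -> tame h f ->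
  chan_int h S (fun r z => k * f r z) = k * chan_int h S f.
Proof.
move=> ph tf; rewrite /chan_int /int2.
apply: (@RintegralZl _ _ _ _ _ (fun p : plane => f p.1 p.2)).
- exact: dom_measurable.
- exact: tame_dom_integrable.
Qed.

Lemma chan_int_ge0 h S f : (forall r z : R, 0 < r < S -> `|z| < h r -> 0 <= f r z) ->
  0 <= chan_int h S f.
Proof. by move=> f0; apply: Rintegral_ge0 => -[r z] [/= rS zr _]; exact: f0. Qed.

Lemma chan_int_subset h S T f : profile h -> tame h f -> S <= T ->
  (forall r z : R, 0 < r < T -> `|z| < h r -> 0 <= f r z) -> chan_int h S f <= chan_int h T f.
Proof.
move=> ph tf ST f0; rewrite /chan_int /int2 /Rintegral.
have ST' : dom h S (h S) `<=` dom h T (h T).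
  move=> [r z] [/= /andP[r0 rS] zr _].
  have rT := lt_le_trans rS ST.
  split=> //=; first by rewrite r0.
  by case: ph => _ mh _; rewrite (le_lt_trans (ler_norm _))// (lt_le_trans zr)// mh// ltW.
apply: fine_le.
- by apply: integrable_fin_num; [exact: dom_measurable|exact: tame_dom_integrable].
- by apply: integrable_fin_num; [exact: dom_measurable|exact: tame_dom_integrable].
apply: ge0_subset_integral => //.
- exact: dom_measurable.
- exact: dom_measurable.
- by apply/measurable_EFinP; exact: tame_dom_measurable.
- by move=> [r z] [/= rT zr _]; rewrite lee_fin f0.
Qed.

Lemma dom_bound h S Z f (C : R) :
  (forall r z : R, 0 < r < S -> `|z| < h r -> `|f r z| <= C) ->
  forall p : plane, dom h S Z p -> `|f p.1 p.2| <= C.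
Proof. by move=> fC [r z] [/= rS zr _]; exact: fC. Qed.

Lemma chan_int_fubini h S f : profile h -> tame h f ->
  (chan_int h S f)%:E = (\int[mu]_(r in `]0%R, S[) (\int[mu]_(z in `]- h r, h r[) f r z)%R%:E)%E.
Proof.
move=> ph tf; have [C /dom_bound fC] := tf.2 S.
have [-> _] := int2_slice (dom_measurable _ _ ph) (dom_box (Z := h S) ph)
  (tame_dom_measurable ph tf) (fC (h S)).
rewrite [RHS]integral_mkcond; apply: eq_integral => r _.
rewrite patchE mem_setE in_itv /=; case: ifPn => [rS|/dom_xsection0 ->].
  rewrite dom_xsection// (min_idPl _)//.
  by case: ph => _ mh _; move: rS => /andP[_ /ltW/mh].
by rewrite Rintegral_set0.
Qed.

(** * Derivatives and fluxes *)

Definition der_r h f g :=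
  forall r z : R, 0 < r -> `|z| < h r -> is_derive r 1 (f ^~ z) (g r z).
Definition der_z h f g :=
  forall r z : R, 0 < r -> `|z| < h r -> is_derive z 1 (f r) (g r z).

(** Vanishing to first order on the wall and on the axis: a radial flux with this
    property can only leave a truncated channel through its slice r = S. *)
Definition vanishing h G := forall S : R, exists K : R, forall r z : R,
  0 < r < S -> `|z| < h r -> `|G r z| <= K * (r * (h r - `|z|)).
(** The analogue for vertical fluxes, for which only the wall matters. *)
Definition wall_vanishing h H := forall S : R, exists K : R, forall r z : R,
  0 < r < S -> `|z| < h r -> `|H r z| <= K * (h r - `|z|).

Lemma is_derive_continuous (f : R -> R) (x l : R) : is_derive x 1 f l ->
  {for x, continuous f}.
Proof. by move=> [+ _] => /derivable1_diffP/differentiable_continuous. Qed.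

Lemma cvg0_squeeze (T : Type) (F : set_system T) (FF : Filter F) (f w : T -> R) :
  (\forall x \near F, `|f x| <= w x) -> w x @[x --> F] --> 0 -> f x @[x --> F] --> 0.
Proof.
move=> fw /cvgr0Pnorm_le w0; apply/cvgr0Pnorm_le => e e0.
near=> x; have fwx : `|f x| <= w x by near: x.
rewrite (le_trans fwx)// (le_trans (ler_norm _))//.
by near: x; exact: w0.
Unshelve. all: by end_near. Qed.

(** The minimum allows for a cut at z inside the channel; when the cut is beyond the
    wall, both ends contribute zero. *)
Lemma der_z_slice h H g r z : profile h -> der_z h H g -> tame h g ->
  wall_vanishing h H -> 0 < r ->
  \int[mu]_(t in `]- h r, Num.min (h r) z[) g r t =
  if `|z| < h r then H r z else 0.
Proof.
move=> [_ mh h1] dH tg vH r0.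
have hr0 : 0 < h r by rewrite (lt_le_trans ltr01).
have rS : 0 < r < r + 1 by rewrite r0 ltrDl ltr01.
have [K HK] := vH (r + 1); have [C gC] := tg.2 (r + 1).
have cw : continuous (fun t : R => K * (h r - `|t|)).
  by move=> t; apply: cvgMr; apply: cvgB; [exact: cvg_cst|exact: norm_continuous].
have lt0 : H r t @[t --> (- h r)^'+] --> 0.
  apply: (@cvg0_squeeze _ _ _ _ (fun t : R => K * (h r - `|t|))).
    near=> t; apply: HK => //; rewrite ltr_norml; apply/andP; split; near: t.
      exact: nbhs_right_gt.
    by apply: nbhs_right_lt; rewrite gtrN.
  have := cw (- h r); rewrite /continuous_at normrN gtr0_norm// subrr mulr0.
  exact: cvg_at_right_filter.
have rt0 : H r t @[t --> (h r)^'-] --> 0.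
  apply: (@cvg0_squeeze _ _ _ _ (fun t : R => K * (h r - `|t|))).
    near=> t; apply: HK => //; rewrite ltr_norml; apply/andP; split; near: t.
      by apply: nbhs_left_gt; rewrite gtrN.
    exact: nbhs_left_lt.
  have := cw (h r); rewrite /continuous_at gtr0_norm// subrr mulr0.
  exact: cvg_at_left_filter.
case: (leP (h r) z) => [hz|zh].
  rewrite ifF; last by apply: negbTE; rewrite -leNgt (le_trans hz)// ler_norm.
  apply: (@itv_FTC_both _ _ (H r) _ _ C) => //.
  - by rewrite gtrN.
  - by move=> t tr; apply: dH => //; rewrite ltr_norml.
  - by move=> t tr; apply: tame_continuous_z tg _ _ => //; rewrite ltr_norml.
  - by move=> t tr; apply: gC => //; rewrite ltr_norml.
case: (ltP (- h r) z) => [hz|zh'].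
  rewrite ifT; last by rewrite ltr_norml hz.
  apply: (@itv_FTC_left _ _ (H r) _ _ C) => // t /andP[t1 t2].
  - by apply: dH => //; rewrite ltr_norml t1 (le_lt_trans t2).
  - by apply: tame_continuous_z tg _ _ => //; rewrite ltr_norml t1 (le_lt_trans t2).
  - by apply: gC => //; rewrite ltr_norml t1 (le_lt_trans t2).
rewrite ifF; last by apply: negbTE; rewrite ltr_norml ltNge zh'.
by rewrite set_itv_ge ?Rintegral_set0// bnd_simp -leNgt.
Unshelve. all: by end_near. Qed.

Lemma der_r_slice h G g (r0 S z : R) : profile h -> der_r h G g -> tame h g ->
  vanishing h G -> 0 <= r0 < S -> r0 * (h r0 - `|z|) = 0 ->
  (forall r : R, r0 < r -> `|z| < h r) ->
  \int[mu]_(t in `]r0, S[) g t z = G S z.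
Proof.
move=> [ch mh h1] dG tg vG /andP[r00 r0S] r0z zr.
have [K GK] := vG S; have [C gC] := tg.2 (S + 1).
apply: (@itv_FTC_left _ _ (G^~ z) _ _ C) => //.
- move=> r /andP[rr0 rS]; apply: dG; last exact: zr.
  exact: le_lt_trans rr0.
- move=> r /andP[rr0 rS]; apply: tame_continuous_r tg _ _; last exact: zr.
  exact: le_lt_trans rr0.
- move=> r /andP[rr0 rS]; apply: gC; last exact: zr.
  by rewrite (le_lt_trans r00)// (le_lt_trans rS)// ltrDl.
- apply: (@cvg0_squeeze _ _ _ _ (fun t : R => K * (t * (h t - `|z|)))).
    near=> t; have r0t : r0 < t by near: t; exact: nbhs_right_gt.
    apply: GK; last exact: zr.
    rewrite (le_lt_trans r00)//=; near: t; exact: nbhs_right_lt.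
  rewrite -(mulr0 K) -r0z; apply: cvg_at_right_filter.
  apply: cvgMr; apply: cvgM; first exact: cvg_id.
  by apply: cvgB; [exact: ch|exact: cvg_cst].
Unshelve. all: by end_near. Qed.

Lemma int2_dz h H g (S Z : R) : profile h -> der_z h H g -> tame h g ->
  wall_vanishing h H ->
  (int2 (dom h S Z) g)%:E =
  (\int[mu]_(r in `]0%R, S[) (if `|Z| < h r then H r Z else 0)%R%:E)%E.
Proof.
move=> ph dH tg vH; have [C /dom_bound gC] := tg.2 S.
have [-> _] := int2_slice (dom_measurable _ _ ph) (dom_box (Z := Z) ph)
  (tame_dom_measurable ph tg) (gC Z).
rewrite [RHS]integral_mkcond; apply: eq_integral => r _.
rewrite patchE mem_setE in_itv /=; case: ifPn => [rS|/dom_xsection0 ->].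
  rewrite dom_xsection// (der_z_slice Z ph dH tg vH)//.
  by move: rS => /andP[].
by rewrite Rintegral_set0.
Qed.

Lemma int2_dr h G g (S Z : R) : profile h -> 0 < S -> der_r h G g -> tame h g ->
  vanishing h G ->
  (int2 (dom h S Z) g)%:E =
  (\int[mu]_(z in `](- h S)%R, (Num.min (h S) Z)%R[) (G S z)%:E)%E.
Proof.
move=> ph S0 dG tg vG; have [C /dom_bound gC] := tg.2 S.
have [_ ->] := int2_slice (dom_measurable _ _ ph) (dom_box (Z := Z) ph)
  (tame_dom_measurable ph tg) (gC Z).
rewrite [RHS]integral_mkcond; apply: eq_integral => z _.
rewrite patchE mem_setE in_itv /= lt_min andbA -ltr_norml.
case: ifPn => [/andP[zS zZ]|zS].
  have [r0 [r0S -> r0z zr]] := dom_ysection ph S0 zS zZ.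
  by rewrite (der_r_slice ph dG tg vG).
by rewrite dom_ysection0// Rintegral_set0.
Qed.

Lemma chan_int_dz h H g (S : R) : profile h -> der_z h H g -> tame h g ->
  wall_vanishing h H -> chan_int h S g = 0.
Proof.
move=> ph dH tg vH; apply: EFin_inj; rewrite (int2_dz _ _ ph dH tg vH).
rewrite integral0_eq// => r; rewrite /= in_itv /= => /andP[r0 rS].
rewrite ifF//; apply: negbTE; rewrite -leNgt (le_trans _ (ler_norm _))//.
by case: ph => _ mh _; rewrite mh// ltW.
Qed.

Lemma chan_int_dr h G g (S : R) : profile h -> 0 < S -> der_r h G g -> tame h g ->
  vanishing h G -> chan_int h S g = \int[mu]_(z in `]- h S, h S[) G S z.
Proof.
move=> ph S0 dG tg vG.
by rewrite /chan_int -[LHS]/(fine (_)%:E) (int2_dr _ ph S0 dG tg vG) minxx.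
Qed.

Lemma wall_vanishingD h F G : wall_vanishing h F -> wall_vanishing h G ->
  wall_vanishing h (fun r z => F r z + G r z).
Proof.
move=> vF vG S; have [K FK] := vF S; have [L GL] := vG S.
exists (K + L) => r z rS zr; rewrite (le_trans (ler_normD _ _))// mulrDl lerD//.
  exact: FK.
exact: GL.
Qed.

Lemma vanishingD h F G : vanishing h F -> vanishing h G ->
  vanishing h (fun r z => F r z + G r z).
Proof.
move=> vF vG S; have [K FK] := vF S; have [L GL] := vG S.
exists (K + L) => r z rS zr; rewrite (le_trans (ler_normD _ _))// mulrDl lerD//.
  exact: FK.
exact: GL.
Qed.

Lemma wall_vanishingMl h f F : tame h f -> wall_vanishing h F ->
  wall_vanishing h (fun r z => f r z * F r z).
Proof.
move=> tf vF S; have [C fC] := tf.2 S; have [K FK] := vF S; exists (C * K) => r z rS zr.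
by rewrite normrM -mulrA ler_pM// ?fC ?FK.
Qed.

Lemma vanishingMl h f F : tame h f -> vanishing h F ->
  vanishing h (fun r z => f r z * F r z).
Proof.
move=> tf vF S; have [C fC] := tf.2 S; have [K FK] := vF S; exists (C * K) => r z rS zr.
by rewrite normrM -mulrA ler_pM// ?fC ?FK.
Qed.

Lemma vanishing_r h F : wall_vanishing h F -> vanishing h (fun r z => r * F r z).
Proof.
move=> vF S; have [K FK] := vF S; exists K => r z rS zr.
have /andP[r0 _] := rS.
by rewrite normrM gtr0_norm// mulrCA ler_pM2l// FK.
Qed.

Lemma vanishing_wall h F : vanishing h F -> wall_vanishing h F.
Proof.
move=> vF S; have [K FK] := vF S; exists (`|K| * S) => r z rS zr.
have /andP[r0 rS'] := rS.
rewrite (le_trans (FK _ _ rS zr))// mulrA ler_wpM2r ?subr_ge0 ?(ltW zr)//.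
by rewrite (le_trans (ler_wpM2r (ltW r0) (ler_norm K)))// ler_wpM2l// ltW.
Qed.

(** * Derivatives of products and primitives *)

Lemma near_is_derive (f g : R -> R) (x l : R) :
  (\forall y \near x, f y = g y) -> is_derive x 1 g l -> is_derive x 1 f l.
Proof.
move=> fg; apply: near_eq_is_derive.
by apply: filterS fg => y ->.
Qed.

Lemma itv_FTC1 (f : R -> R) (a b x C : R) : a < x < b ->
  (forall y, a < y < b -> {for y, continuous f}) ->
  (forall y, a < y < b -> `|f y| <= C) ->
  is_derive x 1 (fun y => \int[mu]_(t in `]a, y[) f t) (f x).
Proof.
move=> /andP[ax xb] cf fC.
pose u := (x + b) / 2.
have xu : x < u by rewrite /u; lra.
have ub : u < b by rewrite /u; lra.
have au : `]a, u] `<=` `]a, b[ by apply: subset_itvl; rewrite bnd_simp.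
have intf : mu.-integrable `]a, u] (EFin \o f).
  by apply: (integrableS _ _ _ (itv_integrable cf fC)).
have [dF eF] := @continuous_FTC1 R f (BRight a) x u xu intf ax (cf x (introT andP (conj ax xb))).
apply: (@near_is_derive _ (fun y => \int[mu]_(t in `]a, y]) f t)).
  near=> y; rewrite Rintegral_itv_bndo_bndc//.
  apply: integrableS intf => //; apply: subset_itvl; rewrite bnd_simp.
  by near: y; apply: (cvgr_le x cvg_id).
split; first exact: dF.
by rewrite -derive1E; exact: eF.
Unshelve. all: by end_near. Qed.

Lemma mvt_bound (f df : R -> R) (u w C : R) : u <= w ->
  (forall x, u <= x <= w -> is_derive x 1 f (df x)) ->
  (forall x, u <= x <= w -> `|df x| <= C) -> `|f w - f u| <= C * (w - u).
Proof.
move=> uw fd der1C.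
have [x|x|x xuw ->] := @MVT_segment R f df u w uw.
- by rewrite in_itv /= => /andP[ux xw]; apply: fd; rewrite !ltW.
- apply: derivable_within_continuous => t; rewrite in_itv /= => tuw.
  by have [] := fd t tuw.
- rewrite normrM (ger0_norm (_ : 0 <= w - u)) ?subr_ge0// ler_wpM2r ?subr_ge0//.
  by apply: der1C; move: xuw; rewrite in_itv.
Qed.

(** A bounded vertical derivative makes f Lipschitz in z uniformly in r, which upgrades
    continuity in r alone. *)
Lemma joint_continuous h f g (r0 z0 : R) : profile h -> der_z h f g ->
  (forall S : R, exists C : R, forall r z : R, 0 < r < S -> `|z| < h r -> `|g r z| <= C) ->
  0 < r0 -> `|z0| < h r0 -> {for r0, continuous (f ^~ z0)} ->
  {for (r0, z0), continuous (fun p : R * R => f p.1 p.2)}.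
Proof.
move=> [ch mh h1] df bg r00 zr0 cf.
have [C gC] := bg (r0 + 1).
pose e := (h r0 - `|z0|) / 2.
have e0 : 0 < e by rewrite divr_gt0// subr_gt0.
have nr : \forall p \near (r0, z0), [/\ 0 < p.1 < r0 + 1, `|z0| + e < h p.1 & `|p.2 - z0| < e].
  near=> p; split.
  - apply/andP; split; near: p.
      by apply: (cvgr_gt r0 (cvg_fst : _ --> r0)).
    by apply: (cvgr_lt r0 (cvg_fst : _ --> r0)); rewrite ltrDl.
  - near: p; apply: (cvgr_gt (h r0)); last by rewrite /e; lra.
    by apply: continuous_comp; [exact: cvg_fst|exact: ch].
  - near: p; have : (fun p : R * R => p.2) @ (r0, z0) --> z0 by exact: cvg_snd.
    by move=> /cvgr_distC_lt; apply.
rewrite /prop_for /continuous_at /=; apply/cvgrPdist_le => /= eps eps0.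
have c1 : {for (r0, z0), continuous (fun p : R * R => f p.1 z0)}.
  by apply: (@continuous_comp _ _ _ fst (f ^~ z0)); [exact: cvg_fst|exact: cf].
have c2 : {for (r0, z0), continuous (fun p : R * R => p.2)} by exact: cvg_snd.
have cC : (fun p : R * R => `|f r0 z0 - f p.1 z0| + C * `|p.2 - z0|) @ (r0, z0) --> (0 : R).
  have -> : 0 = `|f r0 z0 - f r0 z0| + C * `|z0 - z0| :> R by rewrite !subrr normr0 mulr0 addr0.
  apply: cvgD.
    by apply: cvg_norm; apply: cvgB; [exact: cvg_cst|exact: c1].
  by apply: cvgMr; apply: cvg_norm; apply: cvgB; [exact: c2|exact: cvg_cst].
have Hc := (cvgr0Pnorm_le _).1 cC _ eps0.
apply: filterS2 nr (Hc _) => p [r1 hz zz] Hp.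
rewrite (le_trans _ (le_trans (ler_norm _) Hp))//.
have -> : f r0 z0 - f p.1 p.2 = (f r0 z0 - f p.1 z0) + (f p.1 z0 - f p.1 p.2) by ring.
rewrite (le_trans (ler_normD _ _))// lerD2l distrC.
have inside t : `|t - z0| <= `|p.2 - z0| -> `|t| < h p.1.
  move=> tz; have -> : t = z0 + (t - z0) by ring.
  rewrite (le_lt_trans (ler_normD _ _))// (lt_trans _ hz)// ltrD2l.
  exact: le_lt_trans zz.
have r1' : 0 < p.1 by case/andP: r1.
have MV (u w : R) : u <= w -> (forall t, u <= t <= w -> `|t - z0| <= `|p.2 - z0|) ->
    `|f p.1 w - f p.1 u| <= C * (w - u).
  move=> uw tz.
  apply: (@mvt_bound _ (g p.1)) => // t tuw.
    by apply: df => //; apply: inside; exact: tz.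
  by apply: gC => //; apply: inside; exact: tz.
case: (leP z0 p.2) => z0p.
  rewrite (ger0_norm (_ : 0 <= p.2 - z0)) ?subr_ge0//.
  apply: MV => // t /andP[t1 t2].
  by rewrite !ger0_norm ?subr_ge0// lerD2r.
rewrite distrC [`|p.2 - z0|]distrC (ger0_norm (_ : 0 <= z0 - p.2)) ?subr_ge0 ?(ltW z0p)//.
apply: MV => [|t /andP[t1 t2]]; first exact: ltW.
rewrite distrC [X in _ <= X]distrC !ger0_norm ?subr_ge0// ?(ltW z0p)//.
by rewrite lerD2l lerN2.
Unshelve. all: by end_near. Qed.

Lemma der_r_eq h f g g' : der_r h f g ->
  (forall r z : R, 0 < r -> `|z| < h r -> g r z = g' r z) -> der_r h f g'.
Proof. by move=> df gg r z r0 zr; rewrite -gg//; exact: df. Qed.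

Lemma der_rD h f f' g g' : der_r h f f' -> der_r h g g' ->
  der_r h (fun r z => f r z + g r z) (fun r z => f' r z + g' r z).
Proof.
by move=> df dg r z r0 zr; apply: is_deriveD; [exact: df|exact: dg].
Qed.

Lemma der_rN h f f' : der_r h f f' -> der_r h (fun r z => - f r z) (fun r z => - f' r z).
Proof. by move=> df r z r0 zr; apply: is_deriveN; exact: df. Qed.

Lemma der_rM h f f' g g' : der_r h f f' -> der_r h g g' ->
  der_r h (fun r z => f r z * g r z) (fun r z => f' r z * g r z + f r z * g' r z).
Proof.
move=> df dg r z r0 zr.
have H := is_deriveM (df r z r0 zr) (dg r z r0 zr).
apply: is_derive_eq H _; rewrite /GRing.scale /=; ring.
Qed.

Lemma der_r_cst h k : der_r h (fun _ _ => k) (fun _ _ => 0).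
Proof. by move=> r z _ _; exact: is_derive_cst. Qed.

Lemma der_r_r h : der_r h (fun r _ => r) (fun _ _ => 1).
Proof. by move=> r z _ _; exact: is_derive_id. Qed.

Lemma der_z_eq h f g g' : der_z h f g ->
  (forall r z : R, 0 < r -> `|z| < h r -> g r z = g' r z) -> der_z h f g'.
Proof. by move=> df gg r z r0 zr; rewrite -gg//; exact: df. Qed.

Lemma der_zD h f f' g g' : der_z h f f' -> der_z h g g' ->
  der_z h (fun r z => f r z + g r z) (fun r z => f' r z + g' r z).
Proof.
by move=> df dg r z r0 zr; apply: is_deriveD; [exact: df|exact: dg].
Qed.

Lemma der_zN h f f' : der_z h f f' -> der_z h (fun r z => - f r z) (fun r z => - f' r z).
Proof. by move=> df r z r0 zr; apply: is_deriveN; exact: df. Qed.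

Lemma der_zM h f f' g g' : der_z h f f' -> der_z h g g' ->
  der_z h (fun r z => f r z * g r z) (fun r z => f' r z * g r z + f r z * g' r z).
Proof.
move=> df dg r z r0 zr.
have H := is_deriveM (df r z r0 zr) (dg r z r0 zr).
apply: is_derive_eq H _; rewrite /GRing.scale /=; ring.
Qed.

Lemma der_z_cst h k : der_z h (fun _ _ => k) (fun _ _ => 0).
Proof. by move=> r z _ _; exact: is_derive_cst. Qed.

Lemma der_z_z h : der_z h (fun _ z => z) (fun _ _ => 1).
Proof. by move=> r z _ _; exact: is_derive_id. Qed.

Lemma der_z_r h : der_z h (fun r _ => r) (fun _ _ => 0).
Proof. by move=> r z _ _; exact: is_derive_cst. Qed.

Lemma int2_domZ h S Z k f : profile h -> tame h f ->
  int2 (dom h S Z) (fun r z => k * f r z) = k * int2 (dom h S Z) f.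
Proof.
move=> ph tf; rewrite /int2.
apply: (@RintegralZl _ _ _ _ _ (fun p : plane => f p.1 p.2)).
- exact: dom_measurable.
- exact: tame_dom_integrable.
Qed.

Lemma eq_int2_dom h S Z f g :
  (forall r z : R, 0 < r -> `|z| < h r -> f r z = g r z) ->
  int2 (dom h S Z) f = int2 (dom h S Z) g.
Proof.
move=> fg; apply: eq_Rintegral => -[r z]; rewrite inE => -[/= /andP[r0 _] zr _].
exact: fg.
Qed.

(** * The stream function *)

Section stream.
Variables (h : R -> R) (a c ar cz : R -> R -> R).
Hypotheses (ph : profile h) (ta : tame h a) (tc : tame h c) (tar : tame h ar)
  (tcz : tame h cz) (dar : der_r h a ar) (dcz : der_z h c cz)
  (wa : wall_vanishing h a) (wc : wall_vanishing h c)
  (divac : forall r z : R, 0 < r -> `|z| < h r -> ar r z + a r z / r + cz r z = 0).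

(** The Stokes stream function psi of the meridian flow (a, c), that is
    r a = - d psi/dz and r c = d psi/dr. *)
Definition stream S Z : R :=
  \int[mu]_(r in `]0, S[) (if `|Z| < h r then r * c r Z else 0).

(** Incompressibility on the part of {r < S} below Z: what crosses the height Z has
    entered through the slice r = S, nothing passing through the no-slip wall. *)
Lemma stream_flux (S Z : R) : 0 < S ->
  stream S Z = - \int[mu]_(z in `]- h S, Num.min (h S) Z[) (S * a S z).
Proof.
move=> S0.
have tgz : tame h (fun r z => r * cz r z) by apply: tameM; [exact: tame_r|exact: tcz].
have tgr : tame h (fun r z => a r z + r * ar r z).
  by apply: tameD; [exact: ta|apply: tameM; [exact: tame_r|exact: tar]].
have dG : der_r h (fun r z => r * a r z) (fun r z => a r z + r * ar r z).
  by apply: der_r_eq (der_rM (@der_r_r h) dar) _ => r z _ _; rewrite mul1r.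
have dH : der_z h (fun r z => r * c r z) (fun r z => r * cz r z).
  by apply: der_z_eq (der_zM (@der_z_r h) dcz) _ => r z _ _; rewrite mul0r add0r.
have Ez : int2 (dom h S Z) (fun r z => r * cz r z) = stream S Z.
  by rewrite -[LHS]/(fine _%:E) (int2_dz _ _ ph dH tgz _)//; apply: wall_vanishingMl; [exact: tame_r|exact: wc].
have Er : int2 (dom h S Z) (fun r z => a r z + r * ar r z) =
    \int[mu]_(z in `]- h S, Num.min (h S) Z[) (S * a S z).
  by rewrite -[LHS]/(fine _%:E) (int2_dr _ ph S0 dG tgr)//; exact: vanishing_r.
rewrite -Ez -Er -mulN1r -int2_domZ//; apply: eq_int2_dom => r z r0 zr.
have := divac r0 zr => /(congr1 ( *%R r)); rewrite mulr0 !mulrDr => E.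
have rE : r * (a r z / r) = a r z by rewrite mulrC divfK// gt_eqF.
by move: E; rewrite rE; move: (a r z) (r * ar r z) (r * cz r z) => x y w; lra.
Qed.

Lemma stream_dz : der_z h stream (fun r z => - (r * a r z)).
Proof.
move=> S Z S0 ZS.
have ZS' : - h S < Z < h S by rewrite -ltr_norml.
have cf (y : R) : - h S < y < h S -> {for y, continuous (fun z : R => S * a S z)}.
  rewrite -ltr_norml => yS; apply: cvgMr.
  exact: tame_continuous_z ta S0 yS.
have [C aC] := ta.2 (S + 1).
have bf (y : R) : - h S < y < h S -> `|S * a S y| <= S * C.
  rewrite -ltr_norml => yS; rewrite normrM gtr0_norm// ler_pM2l// aC//.
  by rewrite S0 ltrDl ltr01.
have D := itv_FTC1 ZS' cf bf.
apply: near_is_derive (is_deriveN D).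
have : \forall y \near Z, y < h S.
  by case/andP: ZS' => _ ?; exact: (cvgr_lt Z cvg_id).
apply: filterS => y yS.
by rewrite stream_flux// (min_idPr (ltW yS)).
Qed.

Lemma stream_dr : der_r h stream (fun r z => r * c r z).
Proof.
move=> S Z S0 ZS.
have S10 : 0 < S + 1 by rewrite ltr_wpDr.
have SS : S < S + 1 by rewrite ltrDl ltr01.
have ZS1 : `|Z| < h (S + 1).
  by case: ph => _ mh _; rewrite (lt_le_trans ZS)// mh// ltW.
have [r0 [/andP[r00 r01] yE _ zr]] := dom_ysection ph S10 ZS1 (ltr_pwDr ltr01 (lexx Z)).
have mem (r : R) : (0 < r < S + 1) && (`|Z| < h r) = (r0 < r < S + 1).
  apply/idP/idP => [/andP[rS rZ]|rS].
    have : ysection (dom h (S + 1) (Z + 1)) Z r.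
      by rewrite /ysection /= inE; split=> //=; rewrite ltrDl ltr01.
    by rewrite yE /= in_itv.
  by case/andP: rS => r0r ->; rewrite (le_lt_trans r00)//= zr.
have r0S : r0 < S < S + 1 by rewrite -mem S0 SS.
have cf (y : R) : r0 < y < S + 1 -> {for y, continuous (fun r : R => r * c r Z)}.
  rewrite -mem => /andP[/andP[y0 _] yZ]; apply: cvgM; first exact: cvg_id.
  exact: tame_continuous_r tc y0 yZ.
have [C cC] := tc.2 (S + 1).
have bf (y : R) : r0 < y < S + 1 -> `|y * c y Z| <= (S + 1) * C.
  rewrite -mem => /andP[yS yZ]; rewrite normrM; apply: ler_pM => //.
    by case/andP: yS => y0 yS; rewrite gtr0_norm// ltW.
  exact: cC.
have D := itv_FTC1 r0S cf bf.
apply: near_is_derive D.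
have : \forall y \near S, y < S + 1 by exact: (cvgr_lt S cvg_id).
apply: filterS => y yS.
rewrite /stream Rintegral_mkcond [RHS]Rintegral_mkcond.
congr (Rintegral mu _ _); apply/funext => r; rewrite !patchE !mem_setE !in_itv /=.
case: (ltP r y) => ry; rewrite ?andbF// !andbT.
have := mem r; rewrite (lt_trans ry yS) !andbT => <-.
by case: (0 < r); case: (`|Z| < h r).
Qed.

Lemma itv_Rintegral_lipschitz (f : R -> R) (u w x y C : R) : u <= x -> x <= y -> y <= w ->
  (forall t, u < t < w -> {for t, continuous f}) ->
  (forall t, u < t < w -> `|f t| <= C) ->
  `|\int[mu]_(t in `]u, y[) f t - \int[mu]_(t in `]u, x[) f t| <= C * (y - x).
Proof.
move=> ux; rewrite le_eqVlt => /predU1P[-> _ _ _|xy yw cf fC].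
  by rewrite !subrr normr0 mulr0.
have uw : u < w by rewrite (le_lt_trans ux)// (lt_le_trans xy).
have intf : mu.-integrable `]u, w[ (EFin \o f) by exact: itv_integrable cf fC.
have intA (A : set (measurableTypeR R)) : measurable A -> A `<=` `]u, w[ -> mu.-integrable A (EFin \o f).
  by move=> mA AB; apply: (integrableS _ mA AB intf).
have sub : `]x, y[ `<=` `]u, w[ by apply: subset_itv; rewrite bnd_simp.
have -> : \int[mu]_(t in `]u, y[) f t =
    \int[mu]_(t in `]u, x]) f t + \int[mu]_(t in `]x, y[) f t.
  rewrite -Rintegral_setU //=.
  - by congr (Rintegral mu _ f); rewrite -itv_bndbnd_setU ?bnd_simp.
  - rewrite -itv_bndbnd_setU ?bnd_simp//; apply: intA => //.
    by apply: subset_itvl; rewrite bnd_simp.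
  - apply/disj_setPS => t [/=]; rewrite !in_itv /= => /andP[_ tx] /andP[xt _].
    by move: (le_lt_trans tx xt); rewrite ltxx.
rewrite -(@Rintegral_itv_bndo_bndc _ (BRight u) x); last first.
  by apply: intA => //; apply: subset_itvl; rewrite bnd_simp ltW// (lt_le_trans xy).
rewrite addrAC subrr add0r.
have intf' := intA _ (measurable_itv _) sub.
by apply: norm_Rintegral_itv_le => // t /sub /=; rewrite in_itv /=; exact: fC.
Qed.

(** On the wall psi is the flux through a full slice, which is zero because the wall is
    impermeable; near the wall the bound on r a = - d psi/dz takes over. *)
Lemma stream_vanishing : vanishing h stream.
Proof.
move=> T; have [C aC] := ta.2 T; exists C => S Z ST ZS.
have /andP[S0 _] := ST.
have hS : 0 < h S by case: ph => _ _ /(_ S); exact: lt_le_trans.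
have cf (y : R) : - h S < y < h S -> {for y, continuous (fun z : R => S * a S z)}.
  rewrite -ltr_norml => yS; apply: cvgMr.
  exact: tame_continuous_z ta S0 yS.
have bf (y : R) : - h S < y < h S -> `|S * a S y| <= C * S.
  by rewrite -ltr_norml => yS; rewrite mulrC normrM (gtr0_norm S0) ler_pM2r// aC.
have /andP[Z1 Z2] : - h S < Z < h S by rewrite -ltr_norml.
have E := stream_flux Z S0; rewrite (min_idPr (ltW Z2)) in E.
have E0 : \int[mu]_(z in `]- h S, h S[) (S * a S z) = 0.
  have := stream_flux (h S) S0; rewrite minxx => /eqP; rewrite eq_sym eqr_oppLR => /eqP ->.
  rewrite /stream /Rintegral integral0_eq ?oppr0// => r; rewrite /= in_itv /= => /andP[r0 rS].
  rewrite ifF//; apply: negbTE; rewrite -leNgt (le_trans _ (ler_norm _))//.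
  by case: ph => _ mh _; rewrite mh// ltW.
case: (leP 0 Z) => Z0.
  rewrite (ger0_norm Z0) E -(add0r (- _)) -E0 mulrA.
  by apply: (@itv_Rintegral_lipschitz _ _ (h S)) => //; exact: ltW.
rewrite (ltr0_norm Z0) E normrN opprK mulrA.
have := @itv_Rintegral_lipschitz _ (- h S) (h S) (- h S) Z _ (lexx _) (ltW Z1) (ltW Z2) cf bf.
have -> : `]- h S, - h S[%classic = set0 :> set R by rewrite set_itv_ge// bnd_simp ltxx.
by rewrite Rintegral_set0 subr0 opprK [Z + _]addrC.
Qed.

Lemma stream_tame : tame h stream.
Proof.
split.
  move=> r z r0 zr; apply: (joint_continuous ph stream_dz _ r0 zr).
    move=> S; have [C aC] := ta.2 S; exists (S * C) => r' z' rS zr'.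
    rewrite normrN normrM ler_pM// ?aC//.
    by case/andP: rS => r'0 r'S; rewrite gtr0_norm// ltW.
  exact: is_derive_continuous (stream_dr r0 zr).
move=> S; have [K sK] := stream_vanishing S; exists (`|K| * (S * h S)) => r z rS zr.
have /andP[r0 rS'] := rS.
have hr : h r <= h S by case: ph => _ mh _; rewrite mh// ltW.
rewrite (le_trans (sK _ _ rS zr))// (le_trans (ler_wpM2r _ (ler_norm K)))//.
  by rewrite mulr_ge0 ?subr_ge0 ?ltW.
rewrite ler_wpM2l// ler_pM ?subr_ge0 ?(ltW r0) ?(ltW rS') ?(ltW zr)//.
by rewrite (le_trans _ hr)// lerBlDr lerDl.
Qed.

End stream.

(** A positive value would persist on a small rectangle by continuity. *)
Lemma chan_int_eq0 h S f : profile h -> tame h f ->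
  (forall r z : R, 0 < r < S -> `|z| < h r -> 0 <= f r z) -> chan_int h S f <= 0 ->
  forall r z : R, 0 < r < S -> `|z| < h r -> f r z = 0.
Proof.
move=> ph tf f0 If r z /andP[r0 rS] zr; apply/eqP; rewrite eq_le f0 ?r0// andbT leNgt.
apply/negP => frz.
have zS : z < h S.
  by case: ph => _ mh _; rewrite (le_lt_trans (ler_norm _))// (lt_le_trans zr)// mh// ltW.
have rzd : dom h S (h S) (r, z) by split=> //=; rewrite r0.
have n1 : nbhs (r, z) (dom h S (h S) : set (R * R)).
  by apply: open_nbhs_nbhs; split=> //; exact: dom_open.
have n2 : \forall p \near (r, z), f r z / 2 < f p.1 p.2.
  by apply: (cvgr_gt (f r z) (tf.1 r z r0 zr)); rewrite ltr_pdivrMr// ltr_pMr// ltr1n.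
have [e /= e0 He] := (nbhs_ballP _ _).1 (filterI n1 n2).
pose B : set plane := `]r - e, r + e[%classic `*` `]z - e, z + e[%classic.
have BE p : B p -> dom h S (h S) p /\ f r z / 2 < f p.1 p.2.
  move=> [] /=; rewrite !in_itv /= => p1 p2; apply: He; split; rewrite /ball /=.
    by rewrite ltr_distlC.
  by rewrite ltr_distlC.
have mB : measurable B by apply: measurableX.
have muB : (mu \x mu)%E B = ((2 * e) * (2 * e))%:E.
  rewrite product_measure1E// /= !lebesgue_measure_itv /= !lte_fin.
  by rewrite !ltrD2l !gtrN// -!EFinB -EFinM; congr (_ %:E); ring.
have muBy : ((mu \x mu)%E B < +oo)%E by rewrite muB ltry.
have : int2 B (fun _ _ => f r z / 2) <= chan_int h S f.
  rewrite /chan_int /int2 /Rintegral.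
  have BS : B `<=` dom h S (h S) by move=> p /BE[].
  have intf := tame_dom_integrable S (h S) ph tf.
  have intB := integrableS (dom_measurable S (h S) ph) mB BS intf.
  have intc : (mu \x mu)%E.-integrable B (EFin \o (fun _ : plane => f r z / 2)).
    apply: measurable_bounded_integrable => //.
    exists `|f r z / 2|; split; first by rewrite num_real.
    by move=> t Ct p _ /=; exact: ltW.
  apply: fine_le.
  - exact: integrable_fin_num.
  - by apply: integrable_fin_num => //; exact: dom_measurable.
  apply: (@le_trans _ _ (\int[mu \x mu]_(p in B) (f p.1 p.2)%:E)%E).
    apply: le_integral => // p; rewrite inE => /BE[_ fp] /=.
    by rewrite lee_fin ltW.
  apply: ge0_subset_integral => //.
  - exact: dom_measurable.
  - by apply/measurable_EFinP; exact: tame_dom_measurable.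
  - by move=> [u w] [/= rT zr' _]; rewrite lee_fin f0.
have -> : int2 B (fun _ _ => f r z / 2) = f r z / 2 * fine ((mu \x mu)%E B).
  exact: Rintegral_cst.
rewrite muB /= leNgt => /negP; apply.
rewrite (le_lt_trans If)// !mulr_gt0//.
Qed.

(** * Flows in the meridian half-plane *)

(** A meridian function with its derivatives as separate components, so that the
    equations of motion become polynomial relations between plain functions. *)
Record jet := Jet { val0 : R -> R -> R; d_r : R -> R -> R; d_z : R -> R -> R;
  d_rr : R -> R -> R; d_zz : R -> R -> R }.

Record jet_on h (u : jet) : Prop := JetOn {
  tame0 : tame h (val0 u); tame_dr : tame h (d_r u); tame_dz : tame h (d_z u);
  tame_drr : tame h (d_rr u); tame_dzz : tame h (d_zz u);
  has_dr : der_r h (val0 u) (d_r u); has_dz : der_z h (val0 u) (d_z u);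
  has_drr : der_r h (d_r u) (d_rr u); has_dzz : der_z h (d_z u) (d_zz u) }.

(** Axially symmetric solutions seen in the meridian half-plane: a, b, c are the radial,
    azimuthal and vertical velocities, P the pressure.  Only the vertical derivatives
    enter [dirichlet], because they are what Poincare's inequality uses. *)
Record flow h (M D : R) (a b c P : jet) : Prop := Flow {
  flow_profile : profile h;
  flow_a : jet_on h a; flow_b : jet_on h b; flow_c : jet_on h c; flow_P : jet_on h P;
  noslip_a : wall_vanishing h (val0 a);
  noslip_b : wall_vanishing h (val0 b);
  noslip_c : wall_vanishing h (val0 c);
  speed_a : forall r z : R, 0 < r -> `|z| < h r -> `|val0 a r z| <= M;
  speed_b : forall r z : R, 0 < r -> `|z| < h r -> `|val0 b r z| <= M;
  divfree : forall r z : R, 0 < r -> `|z| < h r ->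
    d_r a r z + val0 a r z / r + d_z c r z = 0;
  momentum_r : forall r z : R, 0 < r -> `|z| < h r ->
    val0 a r z * d_r a r z + val0 c r z * d_z a r z - val0 b r z ^+ 2 / r + d_r P r z =
    d_rr a r z + d_zz a r z + d_r a r z / r - val0 a r z / r ^+ 2;
  momentum_th : forall r z : R, 0 < r -> `|z| < h r ->
    val0 a r z * d_r b r z + val0 a r z * val0 b r z / r + val0 c r z * d_z b r z =
    d_rr b r z + d_zz b r z + d_r b r z / r - val0 b r z / r ^+ 2;
  momentum_z : forall r z : R, 0 < r -> `|z| < h r ->
    val0 a r z * d_r c r z + val0 c r z * d_z c r z + d_z P r z =
    d_rr c r z + d_zz c r z + d_r c r z / r;
  dirichlet : forall S : R, chan_int h S (fun r z => r * (d_z a r z * d_z a r z)) +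
    chan_int h S (fun r z => r * (d_z b r z * d_z b r z)) +
    chan_int h S (fun r z => r * (d_z c r z * d_z c r z)) <= D }.

End meridian.

Ltac tame_tac :=
  lazymatch goal with
  | |- tame ?h (fun r z => @GRing.add _ (@?f r z) (@?g r z)) =>
      refine (@tameD _ h f g _ _); cbv beta; tame_tac
  | |- tame ?h (fun r z => @GRing.mul _ (@?f r z) (@?g r z)) =>
      refine (@tameM _ h f g _ _); cbv beta; tame_tac
  | |- tame ?h (fun r z => @GRing.opp _ (@?f r z)) =>
      refine (@tameN _ h f _); cbv beta; tame_tac
  | |- tame ?h (fun r _ => r) => exact (@tame_r _ h)
  | |- tame ?h (fun _ _ => ?k) => exact (@tame_cst _ h k)
  | |- tame ?h (fun r z => ?g r z) => let H := multimatch goal with H : tame h g |- _ => H end in exact H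
  | |- tame ?h ?g => let H := multimatch goal with H : tame h g |- _ => H end in exact H
  end.

Ltac der_r_tac :=
  lazymatch goal with
  | |- der_r ?h (fun r z => @GRing.add _ (@?f r z) (@?g r z)) _ =>
      refine (@der_rD _ h f _ g _ _ _); cbv beta; der_r_tac
  | |- der_r ?h (fun r z => @GRing.mul _ (@?f r z) (@?g r z)) _ =>
      refine (@der_rM _ h f _ g _ _ _); cbv beta; der_r_tac
  | |- der_r ?h (fun r z => @GRing.opp _ (@?f r z)) _ =>
      refine (@der_rN _ h f _ _); cbv beta; der_r_tac
  | |- der_r ?h (fun r _ => r) _ => exact (@der_r_r _ h)
  | |- der_r ?h (fun _ _ => ?k) _ => exact (@der_r_cst _ h k)
  | |- der_r ?h (fun r z => ?g r z) _ =>
      let H := multimatch goal with H : der_r h g _ |- _ => H end in exact H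
  | |- der_r ?h ?g _ =>
      let H := multimatch goal with H : der_r h g _ |- _ => H end in exact H
  end.

Ltac der_z_tac :=
  lazymatch goal with
  | |- der_z ?h (fun r z => @GRing.add _ (@?f r z) (@?g r z)) _ =>
      refine (@der_zD _ h f _ g _ _ _); cbv beta; der_z_tac
  | |- der_z ?h (fun r z => @GRing.mul _ (@?f r z) (@?g r z)) _ =>
      refine (@der_zM _ h f _ g _ _ _); cbv beta; der_z_tac
  | |- der_z ?h (fun r z => @GRing.opp _ (@?f r z)) _ =>
      refine (@der_zN _ h f _ _); cbv beta; der_z_tac
  | |- der_z ?h (fun r _ => r) _ => exact (@der_z_r _ h)
  | |- der_z ?h (fun _ z => z) _ => exact (@der_z_z _ h)
  | |- der_z ?h (fun _ _ => ?k) _ => exact (@der_z_cst _ h k)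
  | |- der_z ?h (fun r z => ?g r z) _ =>
      let H := multimatch goal with H : der_z h g _ |- _ => H end in exact H
  | |- der_z ?h ?g _ =>
      let H := multimatch goal with H : der_z h g _ |- _ => H end in exact H
  end.

(** Fluxes are sums of products of a tame factor and of a vanishing factor, written in
    this order. *)
Ltac vanish_tac :=
  first [ match goal with
          | H : vanishing ?h ?k |- vanishing ?h ?k => exact H
          | H : wall_vanishing ?h ?k |- wall_vanishing ?h ?k => exact H
          end
        | lazymatch goal with
  | |- vanishing ?h (fun r z => @GRing.add _ (@?f r z) (@?g r z)) =>
      refine (@vanishingD _ h f g _ _); cbv beta; vanish_tac
  | |- vanishing ?h (fun r z => @GRing.mul _ (@?f r z) (@?g r z)) =>
      refine (@vanishingMl _ h f g _ _); cbv beta; [tame_tac|vanish_tac]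
  | |- vanishing ?h (fun r z => ?g r z) => change (vanishing h g); vanish_tac
  | |- wall_vanishing ?h (fun r z => @GRing.add _ (@?f r z) (@?g r z)) =>
      refine (@wall_vanishingD _ h f g _ _); cbv beta; vanish_tac
  | |- wall_vanishing ?h (fun r z => @GRing.mul _ (@?f r z) (@?g r z)) =>
      refine (@wall_vanishingMl _ h f g _ _); cbv beta; [tame_tac|vanish_tac]
  | |- wall_vanishing ?h (fun r z => ?g r z) => change (wall_vanishing h g); vanish_tac
  end ].

(** * Integrals over slices and Poincare's inequality *)

Section slice_integrals.
Context {R : realType}.
Local Notation mu := (@lebesgue_measure R).
Variable h : R -> R.
Hypothesis ph : profile h.

Definition slice_int r (f : R -> R -> R) : R := \int[mu]_(z in `]- h r, h r[) f r z.

Lemma slice_integrable r f (x y : R) : tame h f -> 0 < r -> - h r <= x -> y <= h r ->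
  mu.-integrable `]x, y[ (EFin \o f r).
Proof.
move=> tf r0 hx hy.
have [C fC] := tf.2 (r + 1).
apply: (@itv_integrable _ _ _ _ C) => z /andP[xz zy].
  by apply: tame_continuous_z tf r0 _; rewrite ltr_norml (le_lt_trans hx)// (lt_le_trans zy).
by apply: fC; rewrite ?r0 ?ltrDl ?ltr01// ltr_norml (le_lt_trans hx)// (lt_le_trans zy).
Qed.

Lemma slice_int_integrable r f : tame h f -> 0 < r ->
  mu.-integrable `]- h r, h r[ (EFin \o f r).
Proof. by move=> tf r0; exact: slice_integrable. Qed.

Lemma slice_int_le r f g : tame h f -> tame h g -> 0 < r ->
  (forall z : R, `|z| < h r -> f r z <= g r z) -> slice_int r f <= slice_int r g.
Proof.
move=> tf tg r0 fg; apply: le_Rintegral => //; try exact: slice_int_integrable.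
by move=> z; rewrite /= in_itv /= -ltr_norml => /fg.
Qed.

Lemma slice_intD r f g : tame h f -> tame h g -> 0 < r ->
  slice_int r (fun r z => f r z + g r z) = slice_int r f + slice_int r g.
Proof. by move=> tf tg r0; apply: RintegralD => //; exact: slice_int_integrable. Qed.

Lemma slice_intZ r k f : tame h f -> 0 < r -> slice_int r (fun r z => k * f r z) = k * slice_int r f.
Proof. by move=> tf r0; apply: RintegralZl => //; exact: slice_int_integrable. Qed.

Lemma slice_int_cst r (k : R) : 0 < r -> slice_int r (fun _ _ => k) = k * (2 * h r).
Proof.
move=> r0; have hr : 0 < h r by case: ph => _ _ /(_ r); exact: lt_le_trans.
rewrite /slice_int Rintegral_cst//= lebesgue_measure_itv /= lte_fin gtrN// -EFinB /=.
by congr (_ * _); ring.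
Qed.

Lemma slice_int_ge0 r f : (forall z : R, `|z| < h r -> 0 <= f r z) -> 0 <= slice_int r f.
Proof. by move=> f0; apply: Rintegral_ge0 => z; rewrite /= in_itv /= -ltr_norml => /f0. Qed.

Lemma slice_int_dz r H g : der_z h H g -> tame h g -> wall_vanishing h H -> 0 < r -> slice_int r g = 0.
Proof.
move=> dH tg vH r0; have := der_z_slice (h r) ph dH tg vH r0.
rewrite minxx ifF//; apply: negbTE; rewrite -leNgt ger0_norm//.
by case: ph => _ _ /(_ r); exact: le_trans.
Qed.

Lemma chan_int_slices S f : tame h f ->
  mu.-integrable `]0, S[ (fun r => (slice_int r f)%:E) /\ chan_int h S f = \int[mu]_(r in `]0, S[) slice_int r f.
Proof.
move=> tf; split; last by rewrite -[LHS]/(fine (_)%:E) (chan_int_fubini S ph tf).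
have fiT : (mu \x mu)%E.-integrable setT
    ((EFin \o (fun p : measurableTypeR R * measurableTypeR R => f p.1 p.2)) \_ (dom h S (h S))).
  apply/integrable_restrict => //; first exact: dom_measurable.
  by rewrite setTI; exact: tame_dom_integrable.
have fi := integrable_fubini_F fiT.
pose F := (EFin \o (fun p : measurableTypeR R * measurableTypeR R => f p.1 p.2)) \_ (dom h S (h S)).
have E : (fun r : measurableTypeR R => (\int[mu]_z F (r, z))%E) =
    (fun r : measurableTypeR R => (slice_int r f)%:E) \_ `]0, S[.
  apply/funext => r; rewrite /F patchE mem_setE in_itv /=.
  case: ifPn => rS.
    have r0 : 0 < r by case/andP: rS.
    rewrite /slice_int /Rintegral fineK; last first.
      by apply: integrable_fin_num => //; exact: slice_int_integrable.
    rewrite [RHS]integral_mkcond; apply: eq_integral => z _.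
    rewrite !patchE /=; congr (if _ then _ else _).
    rewrite -mem_xsection dom_xsection// (min_idPl _)//.
    by case: ph => _ mh _; move: rS => /andP[_ /ltW/mh].
  rewrite integral0_eq// => z _; rewrite patchE.
  by rewrite -mem_xsection dom_xsection0// in_set0.
have fi' : mu.-integrable setT ((fun r : measurableTypeR R => (slice_int r f)%:E) \_ `]0, S[).
  by rewrite -E; exact: fi.
by rewrite -(setTI `]0, S[%classic); apply/integrable_restrict.
Qed.

End slice_integrals.

(** The derivative in z of z f^2 integrates to zero, so f^2 and - 2 z f f_z have the same
    integral; completing the square (f + 2 z f_z)^2 gives the constant 4 h^2. *)
Lemma slice_poincare {R : realType} (h : R -> R) (s : R) (f fz : R -> R -> R) : profile h ->
  tame h f -> tame h fz -> der_z h f fz ->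
  wall_vanishing h f -> 0 < s ->
  slice_int h s (fun r z => f r z * f r z) <= 4 * (h s * h s) * slice_int h s (fun r z => fz r z * fz r z).
Proof.
move=> ph tf tfz df wf s0.
have tz : tame h (fun _ z : R => z) by exact: tame_z.
pose g r z := f r z * f r z + z * (fz r z * f r z + f r z * fz r z).
have tff : tame h (fun r z => f r z * f r z) by tame_tac.
have tfzfz : tame h (fun r z => fz r z * fz r z) by tame_tac.
have tg : tame h g.
  exact: (tameD (tameM tf tf) (tameM tz (tameD (tameM tfz tf) (tameM tf tfz)))).
have I0 : slice_int h s g = 0.
  have dH : der_z h (fun r z => z * (f r z * f r z)) g.
    apply: der_z_eq (der_zM (@der_z_z _ h) (der_zM df df)) _.
    by move=> r z _ _; rewrite /g; ring.
  apply: (slice_int_dz ph dH tg) => //.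
  have := wall_vanishingMl (tameM tz tf) wf; congr wall_vanishing.
  by apply/funext => r; apply/funext => z; ring.
rewrite -(slice_intZ _ tfzfz s0) -[X in _ <= X]add0r -[X in _ <= X + _](mulr0 2) -I0.
rewrite -(slice_intZ _ tg s0) -(slice_intD (tameM (tame_cst h 2) tg) (tameM (tame_cst h (4 * (h s * h s))) tfzfz) s0).
apply: (slice_int_le tff (tameD (tameM (tame_cst h 2) tg) (tameM (tame_cst h (4 * (h s * h s))) tfzfz)) s0).
move=> z zr; rewrite /g.
have hs : 0 <= h s by have [_ _ h1] := ph; exact: le_trans ler01 (h1 s).
have zh : z ^+ 2 <= h s ^+ 2.
  by rewrite -(real_normK (num_real z)) lerXn2r ?nnegrE// ltW.
move: (f s z) (fz s z) => x y.
have h2 : 0 <= (h s ^+ 2 - z ^+ 2) * y ^+ 2 by rewrite mulr_ge0 ?sqr_ge0// subr_ge0.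
have h3 : 0 <= (x + 2 * z * y) ^+ 2 by exact: sqr_ge0.
rewrite -subr_ge0.
have -> : 2 * (x * x + z * (y * x + x * y)) + 4 * (h s * h s) * (y * y) - x * x =
  (x + 2 * z * y) ^+ 2 + 4 * ((h s ^+ 2 - z ^+ 2) * y ^+ 2) by ring.
by rewrite addr_ge0// mulr_ge0.
Qed.

Lemma poincare {R : realType} (h : R -> R) (S : R) (f fz : R -> R -> R) : profile h ->
  tame h f -> tame h fz -> der_z h f fz -> wall_vanishing h f ->
  chan_int h S (fun r z => r * (f r z * f r z)) <=
  4 * (h S * h S) * chan_int h S (fun r z => r * (fz r z * fz r z)).
Proof.
move=> ph tf tfz df wf.
have t1 : tame h (fun r z => f r z * f r z) by tame_tac.
have t2 : tame h (fun r z => fz r z * fz r z) by tame_tac.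
have t3 : tame h (fun r z => r * (f r z * f r z)) by tame_tac.
have t4 : tame h (fun r z => r * (fz r z * fz r z)) by tame_tac.
have t5 : tame h (fun r z => 4 * (h S * h S) * (r * (fz r z * fz r z))) by tame_tac.
rewrite -(chan_intZ _ _ ph t4).
have [i3 ->] := chan_int_slices ph S t3; have [i5 ->] := chan_int_slices ph S t5.
apply: le_Rintegral => // r; rewrite /= in_itv /= => /andP[r0 rS].
rewrite [leLHS](slice_intZ r t1 r0) (slice_intZ _ t4 r0) [X in _ <= _ * X](slice_intZ r t2 r0) mulrCA ler_pM2l//.
apply: le_trans (slice_poincare ph tf tfz df wf r0) _.
have [_ mh h1] := ph; have hr0 : 0 <= h r := le_trans ler01 (h1 r).
rewrite ler_wpM2r//; first by apply: slice_int_ge0 => z _; rewrite -expr2 sqr_ge0.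
by rewrite ler_pM2l// ler_pM// mh// ltW.
Qed.

(** * The localized energy identity *)

(** In the dimensionless variables s r <= 1 and s^2 psi, with s = 1/S, every term is s r
    times a bounded coefficient (possibly a factor a, bounded by M) times a product of two
    of a, b, c, az, s^2 psi; Young's inequality does the rest. *)
Lemma remainder_scalar_le (F : realFieldType) (s r t q q1 sq a b c az psi M : F) :
  0 < s -> s <= 1 -> 0 < r -> s * r <= 1 -> t = 1 - s * s * (r * r) -> `|a| <= M ->
  q = 6 * (s * s) * (t * t) -> q1 = - (24 * (s * s * (s * s))) * (r * t) ->
  sq = a * a + b * b + c * c ->
  - (2^-1 * ((2 * (r * q) + r * (r * q1)) * sq))
  - 2^-1 * (r * (r * (q * (a * sq))))
  - 2^-1 * ((2 * (r * q) + r * (r * q1)) * (c * c))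
  + (24 * (s * s * (s * s))) * (r * (t + t - 2 * (s * s) * (r * r))) * (c * psi)
  - q1 * (r * (r * (c * c)))
  + q * (r * (r * (az * c)))
  - q1 * (r * (a * (c * psi))) <=
  100 * (1 + M) * s * (r * (a * a) + r * (b * b) + r * (c * c) + r * (az * az)
    + s * s * (s * s) * (r * (psi * psi))).
Proof.
move=> s0 s1 r0 sr1 tE aM qE q1E sqE.
have /andP[aM1 aM2] : - M <= a <= M by rewrite -ler_norml.
have M0 : 0 <= M by lra.
have [w wE] : {x : F | x = s * r} by eexists.
have [y yE] : {x : F | x = s * s * psi} by eexists.
have w0 : 0 <= w by rewrite wE mulr_ge0 ?ltW.
have w1 : w <= 1 by rewrite wE.
have tw : t = 1 - w * w by rewrite tE wE; ring.
have ww1 : w * w <= 1 by rewrite mulr_ile1.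
have ww0 : 0 <= w * w by rewrite mulr_ge0.
have t0 : 0 <= t by rewrite tw; lra.
have t1 : t <= 1 by rewrite tw; lra.
have tt1 : t * t <= 1 by rewrite mulr_ile1.
have tt0 : 0 <= t * t by rewrite mulr_ge0.
have wt1 : w * t <= 1 by rewrite mulr_ile1.
have wt0 : 0 <= w * t by rewrite mulr_ge0.
have [A AE] : {x : F | x = s * (12 * (t * t) - 24 * (w * w * t))} by eexists.
have [B BE] : {x : F | x = 6 * (w * (t * t))} by eexists.
have [C CE] : {x : F | x = 48 * (s * (t - w * w))} by eexists.
have [E EE] : {x : F | x = 24 * (s * (t * (w * w)))} by eexists.
have [K KE] : {x : F | x = 24 * (w * t)} by eexists.
have wwt1 : w * w * t <= 1 by rewrite mulr_ile1.
have wwt0 : 0 <= w * w * t by rewrite mulr_ge0.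
have A1 : - 36 <= A.
  have := mulr_ge0 (ltW s0) tt0; have := mulr_ge0 (ltW s0) wwt0.
  have : s * (w * w * t) <= 1 by rewrite mulr_ile1// ltW.
  by rewrite AE; lra.
have B0 : 0 <= B by rewrite BE !mulr_ge0//.
have wtt1 : w * (t * t) <= 1 by rewrite mulr_ile1.
have B1 : B <= 6 by rewrite BE; lra.
have st1 : s * t <= 1 by rewrite mulr_ile1// ltW.
have st0 : 0 <= s * t by rewrite mulr_ge0// ltW.
have sw1 : s * (w * w) <= 1 by rewrite mulr_ile1// ltW.
have sw0 : 0 <= s * (w * w) by rewrite mulr_ge0// ltW.
have C1 : - 48 <= C by rewrite CE; lra.
have C2 : C <= 48 by rewrite CE; lra.
have stw : s * (t * (w * w)) <= 1 by rewrite mulr_ile1 ?mulr_ile1// ?mulr_ge0// ltW.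
have E1 : E <= 24 by rewrite EE; lra.
have K0 : 0 <= K by rewrite KE; lra.
have K1 : K <= 24 by rewrite KE; lra.
have sq0 : 0 <= sq by rewrite sqE !addr_ge0// -expr2 sqr_ge0.
rewrite [leLHS](_ : _ = s * r * (- (2^-1 * (A * sq)) - 2^-1 * (B * (a * sq))
  - 2^-1 * (A * (c * c)) + C * (c * y) + E * (c * c) + B * (az * c) + K * (a * (c * y)))).
  rewrite [leRHS](_ : _ = s * r * (100 * (1 + M) * (a * a + b * b + c * c + az * az + y * y)));
    last by rewrite yE; ring.
  rewrite ler_pM2l ?mulr_gt0//.
  have cc0 : 0 <= c * c by rewrite -expr2 sqr_ge0.
  have H1 : - (2^-1 * (A * sq)) <= 18 * sq.
    have : 0 <= (A + 36) * sq by rewrite mulr_ge0//; lra.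
    by move: (A) (sq) => u v; lra.
  have H2 : - (2^-1 * (B * (a * sq))) <= 3 * (M * sq).
    have h1 : 0 <= B * ((a + M) * sq) by rewrite !mulr_ge0//; lra.
    have h2 : 0 <= (6 - B) * (M * sq) by rewrite !mulr_ge0//; lra.
    by move: h1 h2; move: (B) (sq) => u v; lra.
  have H3 : - (2^-1 * (A * (c * c))) <= 18 * (c * c).
    have : 0 <= (A + 36) * (c * c) by rewrite mulr_ge0//; lra.
    by move: (A) => u; lra.
  have H4 : C * (c * y) <= 24 * (c * c + y * y).
    have h1 : 0 <= (48 + C) * ((c - y) * (c - y)) by rewrite mulr_ge0 -?expr2 ?sqr_ge0//; lra.
    have h2 : 0 <= (48 - C) * ((c + y) * (c + y)) by rewrite mulr_ge0 -?expr2 ?sqr_ge0//; lra.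
    by move: h1 h2; move: (C) => u; lra.
  have H5 : E * (c * c) <= 24 * (c * c) by rewrite ler_wpM2r.
  have H6 : B * (az * c) <= 3 * (az * az + c * c).
    have h1 : 0 <= B * ((az - c) * (az - c)) by rewrite mulr_ge0// -expr2 sqr_ge0.
    have h2 : 0 <= (6 - B) * (az * az + c * c).
      by rewrite mulr_ge0// ?subr_ge0// addr_ge0// -expr2 sqr_ge0.
    by move: h1 h2; move: (B) => u; lra.
  have H7 : K * (a * (c * y)) <= 12 * (M * (c * c + y * y)).
    have h1 : 0 <= K * ((M + a) * ((c - y) * (c - y))).
      by rewrite mulr_ge0// mulr_ge0 -?expr2 ?sqr_ge0//; lra.
    have h2 : 0 <= K * ((M - a) * ((c + y) * (c + y))).
      by rewrite mulr_ge0// mulr_ge0 -?expr2 ?sqr_ge0//; lra.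
    have h3 : 0 <= (24 - K) * (M * (c * c + y * y)).
      by rewrite !mulr_ge0// ?subr_ge0// addr_ge0// -expr2 sqr_ge0.
    by move: h1 h2 h3; move: (K) => u; lra.
  have a0 : 0 <= a * a by rewrite -expr2 sqr_ge0.
  have b0 : 0 <= b * b by rewrite -expr2 sqr_ge0.
  have z0 : 0 <= az * az by rewrite -expr2 sqr_ge0.
  have y0 : 0 <= y * y by rewrite -expr2 sqr_ge0.
  have Ma := mulr_ge0 M0 a0. have Mb := mulr_ge0 M0 b0. have Mc := mulr_ge0 M0 cc0.
  have Mz := mulr_ge0 M0 z0. have My := mulr_ge0 M0 y0.
  move: H1 H2 H3 H4 H5 H6 H7; rewrite sqE.
  move: (A) (B) (C) (E) (K) => A' B' C' E' K'.
  lra.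
rewrite AE BE CE EE KE qE q1E sqE yE tE wE; ring.
Qed.

(** Here k stands for (h S)^2 and [za], [zb], [zc] for the integrals of the squared
    vertical derivatives: Poincare's inequality is used once for each velocity component and
    twice for psi, whose vertical derivative is - r a. *)
Lemma energy_scalar_le {F : realFieldType} (s S k D za zb zc ia ib ic ip ira : F) :
  0 < s -> 0 < S -> s * S = 1 -> 0 < k -> 0 <= za -> 0 <= zb -> 0 <= zc ->
  ia <= 4 * k * za -> ib <= 4 * k * zb -> ic <= 4 * k * zc -> ip <= 4 * k * ira ->
  ira <= S ^+ 2 * ia -> za + zb + zc <= D ->
  ia + ib + ic + za + s * s * (s * s) * ip <= (1 + 4 * k + 16 * (k * s) ^+ 2) * D.
Proof.
move=> s0 S0 ss k0 za0 zb0 zc0 Pa Pb Pc Pp Pr dS.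
have S20 : 0 < S ^+ 2 by rewrite exprn_gt0.
have k40 : 0 < 4 * k by rewrite mulr_gt0.
have e1 : ip <= 16 * k ^+ 2 * S ^+ 2 * za.
  rewrite (le_trans Pp)// (@le_trans _ _ (4 * k * (S ^+ 2 * (4 * k * za))))//.
    by rewrite ler_pM2l// (le_trans Pr)// ler_pM2l.
  by rewrite le_eqVlt; apply/orP; left; apply/eqP; ring.
have s40 : 0 <= s * s * (s * s) by rewrite !mulr_ge0// ltW.
have e2 : s * s * (s * s) * ip <= 16 * (k * s) ^+ 2 * za.
  rewrite (le_trans (ler_wpM2l s40 e1))//.
  rewrite (_ : s * s * (s * s) * (16 * k ^+ 2 * S ^+ 2 * za) =
    (s * S) ^+ 2 * (16 * (k * s) ^+ 2 * za)); last by ring.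
  by rewrite ss expr1n mul1r.
have zaD : za <= D by lra.
have c0 : 0 <= 16 * (k * s) ^+ 2 by rewrite mulr_ge0 ?sqr_ge0.
have e3 := ler_wpM2l c0 zaD.
have e4 := ler_wpM2l (ltW k40) dS.
rewrite (_ : (1 + 4 * k + 16 * (k * s) ^+ 2) * D = D + 4 * k * D + 16 * (k * s) ^+ 2 * D); last by ring.
move: e2 e3; move: (16 * (k * s) ^+ 2 * za) (16 * (k * s) ^+ 2 * D) (s * s * (s * s) * ip) => x y w e2 e3.
lra.
Qed.

Section energy.
Context {R : realType}.
Variables (h : R -> R) (M D : R) (a b c P : @jet R).
Hypothesis fl : flow h M D a b c P.
Variable S : R.
Hypothesis S1 : 1 <= S.

Let psi := stream h (val0 c).
Let s := S^-1.
Let t := fun r _ : R => 1 - s * s * (r * r).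
Let q := fun r z : R => 6 * (s * s) * (t r z * t r z).
Let q1 := fun r z : R => - (24 * (s * s * (s * s))) * (r * t r z).
(** The cutoff (1 - r^2/S^2)^3; then q = - phi'/r and q1 = q'.  The third power makes q
    vanish at r = S too. *)
Let phi := fun r z : R => t r z * (t r z * t r z).
Let sq := fun r z : R => val0 a r z * val0 a r z + val0 b r z * val0 b r z + val0 c r z * val0 c r z.

(** Radial and vertical components G and H of the energy flux obtained by testing the
    equations with phi v - q psi e_3.  This field is divergence free because
    phi' a = - r q a and d psi/dz = - r a, so the pressure only appears in the flux. *)
Let G := fun r z : R =>
  (phi r z * d_r a r z + 2^-1 * (r * (q r z * val0 a r z)) - 2^-1 * (phi r z * sq r z)
    - phi r z * val0 P r z) * (r * val0 a r z)
  + (phi r z * d_r b r z + 2^-1 * (r * (q r z * val0 b r z))) * (r * val0 b r z)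
  + (phi r z * d_r c r z + r * (q r z * val0 c r z)) * (r * val0 c r z)
  + (- (q r z * (r * d_r c r z)) + q1 r z * (r * val0 c r z)
     + q r z * (r * (val0 a r z * val0 c r z))) * psi r z.

Let H := fun r z : R =>
  (phi r z * (r * d_z a r z) - q r z * (r * (r * val0 c r z))) * val0 a r z
  + (phi r z * (r * d_z b r z)) * val0 b r z
  + (phi r z * (r * d_z c r z) - 2^-1 * (phi r z * (r * sq r z))
     - phi r z * (r * val0 P r z)) * val0 c r z
  + (r * (q r z * val0 P r z) - q r z * (r * d_z c r z)
     + q r z * (r * (val0 c r z * val0 c r z))) * psi r z.

Let N := fun r z : R => phi r z * (r * (d_z a r z * d_z a r z + d_z b r z * d_z b r z + d_z c r z * d_z c r z)).

(** What the derivatives of the cutoff leave behind: the terms in q and q1. *)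
Let remainder := fun r z : R =>
  - (2^-1 * ((2 * (r * q r z) + r * (r * q1 r z)) * sq r z))
  - 2^-1 * (r * (r * (q r z * (val0 a r z * sq r z))))
  - 2^-1 * ((2 * (r * q r z) + r * (r * q1 r z)) * (val0 c r z * val0 c r z))
  + (24 * (s * s * (s * s))) * (r * (t r z + t r z - 2 * (s * s) * (r * r))) * (val0 c r z * psi r z)
  - q1 r z * (r * (r * (val0 c r z * val0 c r z)))
  + q r z * (r * (r * (d_z a r z * val0 c r z)))
  - q1 r z * (r * (val0 a r z * (val0 c r z * psi r z))).

(** The flux (G, H) has zero total: it vanishes on the wall by the no-slip condition and
    at r = S by the cutoff.  Its divergence is N - remainder plus squares, by the
    equations of motion. *)
Lemma energy_le_remainder : [/\ tame h N, tame h remainder & chan_int h S N <= chan_int h S remainder].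
Proof.
have S0 : 0 < S by rewrite (lt_le_trans ltr01).
case: fl => ph [ta tar taz tarr tazz dar daz darr dazz]
  [tb tbr tbz tbrr tbzz dbr dbz dbrr dbzz]
  [tc tcr tcz tcrr tczz dcr dcz dcrr dczz]
  [tP tPr tPz tPrr tPzz dPr dPz dPrr dPzz] wa wb wc sa sb dv mr mt mz dd.
have tpsi : tame h psi := stream_tame ph ta tc tar tcz dar dcz wa wc dv.
have dpsir : der_r h psi _ := stream_dr ph tc.
have dpsiz : der_z h psi _ := stream_dz ph ta tar tcz dar dcz wa wc dv.
have vpsi : vanishing h psi := stream_vanishing ph ta tar tcz dar dcz wa wc dv.
have wpsi := vanishing_wall vpsi.
have va := vanishing_r wa. have vb := vanishing_r wb. have vc := vanishing_r wc.
evar (Gr : R -> R -> R).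
have dG : der_r h G Gr by rewrite /G /phi /q /q1 /sq /t /Gr; der_r_tac.
evar (Hz : R -> R -> R).
have dH : der_z h H Hz by rewrite /H /phi /q /q1 /sq /t /Hz; der_z_tac.
have vG : vanishing h G by rewrite /G /phi /q /q1 /sq /t; vanish_tac.
have vH : wall_vanishing h H by rewrite /H /phi /q /q1 /sq /t; vanish_tac.
have tG : tame h Gr by rewrite /Gr; tame_tac.
have tH : tame h Hz by rewrite /Hz; tame_tac.
have tN : tame h N by rewrite /N /phi /t; tame_tac.
have tR : tame h remainder by rewrite /remainder /phi /q /q1 /sq /t; tame_tac.
split; [exact: tN|exact: tR|].
have -> : chan_int h S remainder = chan_int h S Gr + chan_int h S Hz + chan_int h S remainder.
  rewrite (chan_int_dz S ph dH tH vH) (chan_int_dr ph S0 dG tG vG) addr0.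
  suff -> : \int[lebesgue_measure]_(z in `]- h S, h S[) G S z = 0 by rewrite add0r.
  have t0 z : t S z = 0.
    by rewrite /t /s mulrACA mulVf ?gt_eqF// mulr1 subrr.
  rewrite /Rintegral integral0_eq// => z _; congr (_%:E).
  by rewrite /G /phi /q /q1 t0; ring.
rewrite -(chan_intD _ ph tG tH) -(chan_intD _ ph (tameD tG tH) tR).
apply: (chan_int_le ph tN (tameD (tameD tG tH) tR)) => r z /andP[r0 rS] zr.
have t0 : 0 <= t r z.
  have : s * r <= 1 by rewrite /s mulrC ler_pdivrMr// mul1r ltW.
  have : 0 <= s * r by rewrite mulr_ge0 ?invr_ge0 ?ltW.
  rewrite /t mulrACA; move: (s * r) => w w0 w1.
  by rewrite subr_ge0 mulr_ile1.
have r00 : r != 0 by rewrite gt_eqF.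
have {mr}Er := mr r z r0 zr. have {mt}Et := mt r z r0 zr. have {mz}Ez := mz r z r0 zr. have {dv}Ed := dv r z r0 zr.
rewrite -subr_ge0.
have -> : Gr r z + Hz r z + remainder r z - N r z =
  phi r z * (r * (d_r a r z ^+ 2 + d_r b r z ^+ 2 + d_r c r z ^+ 2)) +
  phi r z * ((val0 a r z ^+ 2 + val0 b r z ^+ 2) / r).
  rewrite /Gr /Hz /remainder /N /phi /q /q1 /sq /t. cbv beta.
  move: Er Et Ez Ed.
  move: (psi r z) (val0 a r z) (d_r a r z) (d_z a r z) (d_rr a r z) (d_zz a r z)
    (val0 b r z) (d_r b r z) (d_z b r z) (d_rr b r z) (d_zz b r z)
    (val0 c r z) (d_r c r z) (d_z c r z) (d_rr c r z) (d_zz c r z)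
    (val0 P r z) (d_r P r z) (d_z P r z).
  move=> psi_ a_ ar az arr azz b_ br bz brr bzz c_ cr cz crr czz p_ pr pz Er Et Ez Ed.
  have -> : arr = a_ * ar + c_ * az - b_ ^+ 2 / r + pr - azz - ar / r + a_ / r ^+ 2.
    by rewrite Er; ring.
  have -> : brr = a_ * br + a_ * b_ / r + c_ * bz - bzz - br / r + b_ / r ^+ 2.
    by rewrite Et; ring.
  have -> : crr = a_ * cr + c_ * cz + pz - czz - cr / r.
    by rewrite Ez; ring.
  have -> : cz = - ar - a_ / r.
    by move: Ed => /eqP; rewrite addrC addr_eq0 opprD => /eqP.
  field.
  exact: r00.
have p0 : 0 <= phi r z by rewrite /phi !mulr_ge0.
apply: addr_ge0; apply: mulr_ge0 => //.
  by rewrite mulr_ge0 ?(ltW r0)// !addr_ge0// sqr_ge0.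
by rewrite divr_ge0 ?(ltW r0)// addr_ge0// sqr_ge0.
Qed.

(** [remainder_scalar_le] gives the factor s = 1/S, and [energy_scalar_le] expresses the
    quadratic integrals by the Dirichlet integral. *)
Lemma energy_bound :
  chan_int h S N <= 100 * (1 + M) * s * ((1 + 4 * (h S * h S) + 16 * (h S * h S * s) ^+ 2) * D).
Proof.
have S0 : 0 < S by rewrite (lt_le_trans ltr01).
have s0 : 0 < s by rewrite invr_gt0.
have s1 : s <= 1 by rewrite invf_le1.
have [tN tR NR] := energy_le_remainder.
rewrite (le_trans NR)//.
case: fl => ph [ta tar taz tarr tazz dar daz darr dazz]
  [tb tbr tbz tbrr tbzz dbr dbz dbrr dbzz]
  [tc tcr tcz tcrr tczz dcr dcz dcrr dczz] _ wa wb wc sa sb dv mr mt mz dd.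
have tpsi : tame h psi := stream_tame ph ta tc tar tcz dar dcz wa wc dv.
have dpsiz : der_z h psi _ := stream_dz ph ta tar tcz dar dcz wa wc dv.
have vpsi : vanishing h psi := stream_vanishing ph ta tar tcz dar dcz wa wc dv.
have wpsi := vanishing_wall vpsi.
have h1 : 1 <= h S by case: ph.
have M0 : 0 <= M.
  by rewrite (le_trans _ (sa S 0 S0 _)) ?normr0 ?(lt_le_trans ltr01).
pose Q (f : R -> R -> R) := fun r z : R => r * (f r z * f r z).
have tQ (f : R -> R -> R) : tame h f -> tame h (Q f) by move=> tf; rewrite /Q; tame_tac.
have Q0 f (r z : R) : 0 < r -> 0 <= Q f r z.
  by move=> r0; rewrite /Q mulr_ge0 ?(ltW r0)// -expr2 sqr_ge0.
have DQ0 f : 0 <= chan_int h S (Q f) by apply: chan_int_ge0 => r z /andP[r0 _] _; exact: Q0.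
have Poi f fz : tame h f -> tame h fz -> der_z h f fz -> wall_vanishing h f ->
    chan_int h S (Q f) <= 4 * (h S * h S) * chan_int h S (Q fz).
  by move=> tf tfz df wf; exact: (poincare S ph tf tfz df wf).
have Pa := Poi _ _ ta taz daz wa; have Pb := Poi _ _ tb tbz dbz wb.
have Pc := Poi _ _ tc tcz dcz wc.
have tra : tame h (fun r z => - (r * val0 a r z)) by tame_tac.
have Ppsi := Poi _ _ tpsi tra dpsiz wpsi.
have Pra : chan_int h S (Q (fun r z => - (r * val0 a r z))) <= S ^+ 2 * chan_int h S (Q (val0 a)).
  rewrite -(chan_intZ _ _ ph (tQ _ ta)).
  apply: (chan_int_le ph (tQ _ tra) (tameM (tame_cst h (S ^+ 2)) (tQ _ ta))).
  move=> r z /andP[r0 rS] _; rewrite /Q.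
  rewrite (_ : r * (- (r * val0 a r z) * - (r * val0 a r z)) =
    r ^+ 2 * (r * (val0 a r z * val0 a r z))); last by ring.
  rewrite ler_wpM2r//; first exact: Q0.
  by rewrite lerXn2r ?nnegrE ?ltW.
have dS := dd S.
have HR : chan_int h S remainder <= 100 * (1 + M) * s * (chan_int h S (Q (val0 a)) + chan_int h S (Q (val0 b)) +
    chan_int h S (Q (val0 c)) + chan_int h S (Q (d_z a)) + s * s * (s * s) * chan_int h S (Q psi)).
  have tk k f : tame h f -> tame h (fun r z => k * f r z) by move=> tf; tame_tac.
  have tsum : tame h (fun r z => Q (val0 a) r z + Q (val0 b) r z + Q (val0 c) r z + Q (d_z a) r z + s * s * (s * s) * Q psi r z).
    by rewrite /Q; tame_tac.
  rewrite -(chan_intD _ ph (tQ _ ta) (tQ _ tb)).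
  rewrite -(chan_intD _ ph (tameD (tQ _ ta) (tQ _ tb)) (tQ _ tc)).
  rewrite -(chan_intD _ ph (tameD (tameD (tQ _ ta) (tQ _ tb)) (tQ _ tc)) (tQ _ taz)).
  rewrite -(chan_intZ _ _ ph (tQ _ tpsi)).
  rewrite -(chan_intD _ ph (tameD (tameD (tameD (tQ _ ta) (tQ _ tb)) (tQ _ tc)) (tQ _ taz)) (tk _ _ (tQ _ tpsi))).
  rewrite -(chan_intZ _ _ ph tsum).
  apply: (chan_int_le ph tR (tk _ _ tsum)) => r z /andP[r0 rS] zr.
  apply: (@remainder_scalar_le _ s r (t r z) (q r z) (q1 r z) (sq r z)) => //.
    by rewrite /s mulrC ler_pdivrMr// mul1r ltW.
  exact: sa.
apply: (le_trans HR); rewrite ler_pM2l; last by rewrite !mulr_gt0//; lra.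
have ss : s * S = 1 by rewrite mulVf// gt_eqF.
rewrite -/(Q (d_z a)) -/(Q (d_z b)) -/(Q (d_z c)) in dS.
move: (DQ0 (d_z a)) (DQ0 (d_z b)) (DQ0 (d_z c)) (DQ0 (val0 a)) Pa Pb Pc Ppsi Pra dS.
move: (chan_int h S (Q (d_z a))) (chan_int h S (Q (d_z b))) (chan_int h S (Q (d_z c))) (chan_int h S (Q (val0 a)))
  (chan_int h S (Q (val0 b))) (chan_int h S (Q (val0 c))) (chan_int h S (Q psi))
  (chan_int h S (Q (fun r z => - (r * val0 a r z)))).
move=> za zb zc ia ib ic ip ira.
have hh : 0 < h S * h S by rewrite mulr_gt0 ?(lt_le_trans ltr01).
move=> za0 zb0 zc0 _ Pa' Pb' Pc' Pp Pr dS'.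
exact: (energy_scalar_le s0 S0 ss hh za0 zb0 zc0 Pa' Pb' Pc' Pp Pr dS').
Qed.

(** For r <= S/2 the cutoff is at least (3/4)^3 >= 1/4. *)
Lemma inner_energy S0 : 0 < S0 -> 2 * S0 <= S ->
  chan_int h S0 (fun r z => r * (d_z a r z * d_z a r z + d_z b r z * d_z b r z + d_z c r z * d_z c r z))
  <= 4 * chan_int h S N.
Proof.
move=> S00 S0S.
have Sp : 0 < S by rewrite (lt_le_trans ltr01).
have [tN _ _] := energy_le_remainder.
case: fl => ph [_ _ taz _ _ _ _ _ _] [_ _ tbz _ _ _ _ _ _] [_ _ tcz _ _ _ _ _ _] _ _ _ _ _ _ _ _ _ _ _.
set f := (fun r z : R => _ : R).
have tf : tame h f by rewrite /f; tame_tac.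
have f0 (r z : R) : 0 < r -> 0 <= f r z.
  by move=> r0; rewrite /f mulr_ge0 ?(ltW r0)// !addr_ge0// -expr2 sqr_ge0.
have tb (r : R) : 0 < r < S -> 0 <= s * r <= 1.
  move=> /andP[r0 rS]; rewrite mulr_ge0 ?invr_ge0 ?(ltW r0) ?(ltW Sp)//=.
  by rewrite /s mulrC ler_pdivrMr// mul1r ltW.
have NE (r z : R) : N r z = phi r z * f r z by [].
have t0 (r z : R) : 0 < r < S -> 0 <= t r z.
  move=> /tb /andP[w0 w1]; rewrite /t mulrACA; move: (s * r) w0 w1 => w w0 w1.
  by rewrite subr_ge0 mulr_ile1.
have N0 (r z : R) : 0 < r < S -> `|z| < h r -> 0 <= N r z.
  move=> rS _; rewrite NE /phi; have := t0 r z rS; have /andP[r0 _] := rS.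
  by move=> tt; apply: mulr_ge0; [apply: mulr_ge0 => //; exact: mulr_ge0|exact: f0].
apply: (@le_trans _ _ (4 * chan_int h S0 N)); last first.
  by rewrite ler_pM2l//; apply: chan_int_subset => //; lra.
rewrite -(chan_intZ _ _ ph tN); apply: (chan_int_le ph tf (tameM (tame_cst h 4) tN)).
move=> r z /andP[r0 rS] zr; rewrite NE.
have w0 : 0 <= s * r by rewrite mulr_ge0 ?invr_ge0 ?(ltW r0) ?(ltW Sp).
have w1 : s * r <= 2^-1.
  rewrite /s mulrC ler_pdivrMr//; lra.
have tt : 3 / 4 <= t r z.
  rewrite /t mulrACA; move: (s * r) w0 w1 => w w0 w1.
  have := ler_pM w0 w0 w1 w1; lra.
have pp : 1 <= 4 * phi r z.
  rewrite /phi; move: (t r z) tt => x x1.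
  have h2 : 3 / 4 * (3 / 4) <= x * x by apply: ler_pM => //; lra.
  have h3 : 3 / 4 * (3 / 4 * (3 / 4)) <= x * (x * x) by apply: ler_pM => //; lra.
  lra.
by rewrite mulrA ler_peMl// f0.
Qed.

End energy.

(** When (h S)^2 / S tends to 0 the bound of [energy_bound] tends to 0 while the domain
    of [inner_energy] is fixed: the vertical derivatives vanish, hence the velocity by
    Poincare's inequality. *)
Theorem flow_still {R : realType} (h : R -> R) (M D : R) (a b c P : @jet R) :
  flow h M D a b c P ->
  (forall e : R, 0 < e -> exists S0 : R, forall S, S0 <= S -> h S * h S <= e * S) ->
  forall r z : R, 0 < r -> `|z| < h r ->
    [/\ val0 a r z = 0, val0 b r z = 0 & val0 c r z = 0].
Proof.
move=> fl hS r z r0 zr.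
have ph : profile h by case: fl.
have M0 : 0 <= M.
  by case: fl => _ _ _ _ _ _ _ _ sa _ _ _ _ _ _; rewrite (le_trans _ (sa r z r0 zr)).
pose T := r + 1.
have T0 : 0 < T by rewrite addr_gt0.
pose f (r z : R) := r * (d_z a r z * d_z a r z + d_z b r z * d_z b r z + d_z c r z * d_z c r z).
case: (fl) => _ [ta tar taz tarr tazz dar daz darr dazz]
  [tb tbr tbz tbrr tbzz dbr dbz dbrr dbzz]
  [tc tcr tcz tcrr tczz dcr dcz dcrr dczz] _ wa wb wc sa sb dv mr mt mz dd.
have tf : tame h f by rewrite /f; tame_tac.
have D0 : 0 <= D.
  rewrite (le_trans _ (dd 1))// !addr_ge0//; apply: chan_int_ge0 => r' z' /andP[r'0 _] _;
    by rewrite mulr_ge0 ?(ltW r'0)// -expr2 sqr_ge0.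
have f0 (r' z' : R) : 0 < r' -> 0 <= f r' z'.
  by move=> r'0; rewrite /f mulr_ge0 ?(ltW r'0)// !addr_ge0// -expr2 sqr_ge0.
have If : chan_int h T f <= 0.
  apply/ler_addgt0Pr => e e0; rewrite add0r.
  pose K := 400 * (1 + M) * (D + 1).
  have K0 : 0 < K by apply: mulr_gt0; [apply: mulr_gt0|]; lra.
  (* 21 = 1 + 4 + 16 collects the constants of [energy_bound] when (h S)^2 / S <= 1 *)
pose e' := Num.min 1 (e / (21 * K)).
  have e'0 : 0 < e' by rewrite lt_min ltr01 divr_gt0// mulr_gt0.
  have [S0 HS] := hS _ e'0.
  pose S := Num.max (Num.max 1 S0) (Num.max (2 * T) (e'^-1)).
  have S1 : 1 <= S by rewrite !le_max lexx.
  have SS0 : S0 <= S by rewrite !le_max lexx orbT.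
  have ST : 2 * T <= S by rewrite !le_max lexx !orbT.
  have Se : e'^-1 <= S by rewrite !le_max lexx !orbT.
  have Sp : 0 < S by rewrite (lt_le_trans ltr01).
  have s0 : 0 < S^-1 by rewrite invr_gt0.
  have se : S^-1 <= e' by rewrite -[e']invrK lef_pV2// posrE ?invr_gt0.
  have hhe : h S * h S * S^-1 <= e' by rewrite ler_pdivrMr// HS.
  rewrite (le_trans (inner_energy fl S1 T0 ST))//.
  have := energy_bound fl S1; set I := chan_int h S _ => EI.
  have e'1 : e' <= 1 by rewrite ge_min lexx.
  have hh0 : 0 <= h S * h S * S^-1 by rewrite !mulr_ge0 ?(ltW s0)// (le_trans ler01)//; case: ph.
  have hh2 : (h S * h S * S^-1) ^+ 2 <= 1.
    by rewrite expr_le1// (le_trans hhe).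
  have ee : 21 * K * e' <= e.
    have : e' <= e / (21 * K) by rewrite /e' ge_min lexx orbT.
    have K21 : 0 < 21 * K by rewrite mulr_gt0.
    by rewrite (ler_pdivlMr _ _ K21) mulrC.
  have B : S^-1 * (1 + 4 * (h S * h S) + 16 * (h S * h S * S^-1) ^+ 2) <= 21 * e'.
    have -> : S^-1 * (1 + 4 * (h S * h S) + 16 * (h S * h S * S^-1) ^+ 2) =
       S^-1 + 4 * (h S * h S * S^-1) + 16 * ((h S * h S * S^-1) ^+ 2 * S^-1) by ring.
    have : (h S * h S * S^-1) ^+ 2 * S^-1 <= S^-1 by rewrite ler_piMl// ltW.
    move: se hhe; move: (_ ^+ 2 * S^-1) => x; lra.
  apply: (le_trans _ ee).
  rewrite (@le_trans _ _ (4 * (100 * (1 + M) * D * (21 * e'))))//.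
    rewrite ler_pM2l// (le_trans EI)//.
    rewrite (_ : 100 * (1 + M) * S^-1 * _ = 100 * (1 + M) * D *
       (S^-1 * (1 + 4 * (h S * h S) + 16 * (h S * h S * S^-1) ^+ 2))); last by ring.
    by apply: ler_wpM2l => //; apply: mulr_ge0; [apply: mulr_ge0|]; lra.
  rewrite (_ : 4 * _ = 400 * (1 + M) * D * (21 * e')); last by ring.
  rewrite (_ : 21 * K * e' = K * (21 * e')); last by ring.
  rewrite ler_wpM2r//; first by rewrite mulr_ge0// ltW.
  by apply: ler_wpM2l; [apply: mulr_ge0|]; lra.
have rT : 0 < r < T by rewrite r0 /T ltrDl ltr01.
have zero (u uz : R -> R -> R) : tame h u -> tame h uz -> der_z h u uz -> wall_vanishing h u ->
    (forall r' z' : R, 0 < r' -> r' * (uz r' z' * uz r' z') <= f r' z') -> u r z = 0.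
  move=> tu tuz du wu uf.
  have t1 : tame h (fun r z => r * (u r z * u r z)) by tame_tac.
  have t2 : tame h (fun r z => r * (uz r z * uz r z)) by tame_tac.
  have I2 : chan_int h T (fun r z => r * (uz r z * uz r z)) <= 0.
    rewrite (le_trans _ If)//; apply: (chan_int_le ph t2 tf) => r' z' /andP[r'0 _] _.
    exact: uf.
  have I1 : chan_int h T (fun r z => r * (u r z * u r z)) <= 0.
    rewrite (le_trans (poincare T ph tu tuz du wu))// mulr_ge0_le0// !mulr_ge0//.
      by case: ph => _ _ /(_ T); exact: le_trans.
    by case: ph => _ _ /(_ T); exact: le_trans.
  have := chan_int_eq0 ph t1 _ I1 rT zr.
  have pos (r' z' : R) : 0 < r' < T -> `|z'| < h r' -> 0 <= r' * (u r' z' * u r' z').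
    by move=> /andP[r'0 _] _; rewrite mulr_ge0 ?(ltW r'0)// -expr2 sqr_ge0.
  move=> /(_ pos) /eqP; rewrite mulf_eq0 gt_eqF//= -expr2 sqrf_eq0.
  by move=> /eqP.
have sq0 (x : R) : 0 <= x * x by rewrite -expr2 sqr_ge0.
split; [apply: (zero _ _ ta taz daz wa)|apply: (zero _ _ tb tbz dbz wb)|apply: (zero _ _ tc tcz dcz wc)];
  move=> r' z' r'0; rewrite /f ler_pM2l//.
- by have := sq0 (d_z b r' z'); have := sq0 (d_z c r' z'); lra.
- by have := sq0 (d_z a r' z'); have := sq0 (d_z c r' z'); lra.
- by have := sq0 (d_z b r' z'); have := sq0 (d_z a r' z'); lra.
Qed.

(** * The energy of the circulation *)

Section swirl.
Context {R : realType}.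
Local Notation mu := (@lebesgue_measure R).
Variables (h : R -> R) (M D : R) (a b c P : @jet R).
Hypothesis fl : flow h M D a b c P.

Let ph : profile h. Proof. by case: fl. Qed.

Let h1 (S : R) : 1 <= h S. Proof. by case: ph. Qed.

Let h0 (S : R) : 0 < h S. Proof. exact: lt_le_trans (h1 S). Qed.

(** The circulation r v^theta.  It satisfies v . grad Gamma = Laplacian Gamma -
    (2/r) d Gamma/dr, without zeroth order term, and is independent of the pressure. *)
Definition Gamma := fun r z : R => r * val0 b r z.
Definition Gamma_r := fun r z : R => val0 b r z + r * d_r b r z.
Definition Gamma_z := fun r z : R => r * d_z b r z.
Let Gamma_rr := fun r z : R => 2 * d_r b r z + r * d_rr b r z.
Let Gamma_zz := fun r z : R => r * d_zz b r z.
(** The density r |grad Gamma|^2 of the energy dissipated by Gamma. *)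
Definition grad_energy := fun r z : R => r * (Gamma_r r z * Gamma_r r z + Gamma_z r z * Gamma_z r z).
(** Radial and vertical components of the flux whose divergence is [grad_energy]. *)
Let flux := fun r z : R => (r * Gamma_r r z - 2^-1 * (r * (val0 a r z * Gamma r z)) - Gamma r z) * Gamma r z.
Let fluxz := fun r z : R => (r * Gamma_z r z - 2^-1 * (r * (val0 c r z * Gamma r z))) * Gamma r z.
Let fluxr' := fun r z : R => Gamma_r r z * Gamma r z + r * (Gamma_rr r z * Gamma r z + Gamma_r r z * Gamma_r r z)
  - 2^-1 * ((val0 a r z + r * d_r a r z) * (Gamma r z * Gamma r z) + 2 * (r * (val0 a r z * (Gamma r z * Gamma_r r z))))
  - 2 * (Gamma r z * Gamma_r r z).
Let fluxz' := fun r z : R => r * (Gamma_zz r z * Gamma r z + Gamma_z r z * Gamma_z r z)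
  - 2^-1 * (r * d_z c r z * (Gamma r z * Gamma r z) + 2 * (r * (val0 c r z * (Gamma r z * Gamma_z r z)))).

(** Collected once, because each of the estimates below needs its own selection of these
    facts. *)
Record swirl_facts : Prop := SwirlFacts {
  sw_ta : tame h (val0 a); sw_taz : tame h (d_z a); sw_tc : tame h (val0 c);
  sw_tG : tame h Gamma; sw_tGr : tame h Gamma_r; sw_tGz : tame h Gamma_z;
  sw_tg : tame h grad_energy; sw_tf : tame h flux; sw_tfz : tame h fluxz;
  sw_tfr' : tame h fluxr'; sw_tfz' : tame h fluxz';
  sw_dGr : der_r h Gamma Gamma_r; sw_dGz : der_z h Gamma Gamma_z;
  sw_dfr : der_r h flux fluxr'; sw_dfz : der_z h fluxz fluxz';
  sw_vG : vanishing h Gamma; sw_vf : vanishing h flux; sw_vfz : vanishing h fluxz;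
  sw_eq : forall r z : R, 0 < r -> `|z| < h r -> grad_energy r z = fluxr' r z + fluxz' r z
}.

Lemma swirl_identities : swirl_facts.
Proof.
case: fl => _ [ta tar taz tarr tazz dar daz darr dazz]
  [tb tbr tbz tbrr tbzz dbr dbz dbrr dbzz]
  [tc tcr tcz tcrr tczz dcr dcz dcrr dczz] _ wa wb wc sa sb dv mr mt mz dd.
have tG : tame h Gamma by rewrite /Gamma; tame_tac.
have tGr : tame h Gamma_r by rewrite /Gamma_r; tame_tac.
have tGz : tame h Gamma_z by rewrite /Gamma_z; tame_tac.
have tGrr : tame h Gamma_rr by rewrite /Gamma_rr; tame_tac.
have tGzz : tame h Gamma_zz by rewrite /Gamma_zz; tame_tac.
have dG : der_r h Gamma Gamma_r.
  apply: der_r_eq (_ : der_r h Gamma _) _; first by rewrite /Gamma; der_r_tac.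
  by move=> r z _ _; rewrite /Gamma_r /=; ring.
have dGz : der_z h Gamma Gamma_z.
  apply: der_z_eq (_ : der_z h Gamma _) _; first by rewrite /Gamma; der_z_tac.
  by move=> r z _ _; rewrite /Gamma_z /=; ring.
have dGr : der_r h Gamma_r Gamma_rr.
  apply: der_r_eq (_ : der_r h Gamma_r _) _; first by rewrite /Gamma_r; der_r_tac.
  by move=> r z _ _; rewrite /Gamma_rr /=; ring.
have dGzz : der_z h Gamma_z Gamma_zz.
  apply: der_z_eq (_ : der_z h Gamma_z _) _; first by rewrite /Gamma_z; der_z_tac.
  by move=> r z _ _; rewrite /Gamma_zz /=; ring.
have vG : vanishing h Gamma by exact: vanishing_r.
split.
- exact: ta.
- exact: taz.
- exact: tc.
- exact: tG.
- exact: tGr.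
- exact: tGz.
- by rewrite /grad_energy; tame_tac.
- by rewrite /flux; tame_tac.
- by rewrite /fluxz; tame_tac.
- by rewrite /fluxr'; tame_tac.
- by rewrite /fluxz'; tame_tac.
- exact: dG.
- exact: dGz.
- apply: der_r_eq (_ : der_r h flux _) _; first by rewrite /flux; der_r_tac.
  by move=> r z _ _; rewrite /fluxr' /=; field.
- apply: der_z_eq (_ : der_z h fluxz _) _; first by rewrite /fluxz; der_z_tac.
  by move=> r z _ _; rewrite /fluxz' /=; field.
- exact: vG.
- by rewrite /flux; vanish_tac.
- by rewrite /fluxz; vanish_tac.
move=> r z r0 zr.
have := mt r z r0 zr; have := dv r z r0 zr.
have r00 : r != 0 by rewrite gt_eqF.
rewrite /grad_energy /fluxr' /fluxz' /Gamma_rr /Gamma_zz /Gamma_r /Gamma_z /Gamma.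
move: (val0 a r z) (d_r a r z) (val0 b r z) (d_r b r z) (d_z b r z) (d_rr b r z) (d_zz b r z) (val0 c r z) (d_z c r z).
move=> a_ ar b_ br bz brr bzz c_ cz Ed Et.
have -> : brr = a_ * br + a_ * b_ / r + c_ * bz - bzz - br / r + b_ / r ^+ 2.
  by rewrite Et; ring.
have -> : cz = - ar - a_ / r.
  by move: Ed => /eqP; rewrite addrC addr_eq0 opprD => /eqP.
by field.
Qed.

(** All the energy dissipated in r < S enters through the slice r = S. *)
Lemma swirl_energy (S : R) : 0 < S -> chan_int h S grad_energy = slice_int h S flux.
Proof.
move=> S0; case: swirl_identities => _ _ _ _ _ _ tg _ _ tfr tfz _ _ dfr dfz _ vf vfz e.
rewrite (_ : chan_int h S grad_energy = chan_int h S (fun r z => fluxr' r z + fluxz' r z)).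
  by rewrite (chan_intD S ph tfr tfz) (chan_int_dz S ph dfz tfz (vanishing_wall vfz)) addr0 (chan_int_dr ph S0 dfr tfr vf).
exact: eq_int2_dom.
Qed.

Let dz_density s := slice_int h s (fun r z => d_z a r z * d_z a r z).

(** The radial velocity starts from 0 at the wall, so it is at most the integral of
    |a_z| over the slice; Young's inequality with a free parameter m replaces |a_z| by a_z^2. *)
Lemma radial_sup (s z m : R) : 0 < s -> `|z| < h s -> 0 < m ->
  `|val0 a s z| <= m / 2 + h s / m * dz_density s.
Proof.
move=> s0 zs m0.
case: (fl) => _ [ta _ taz _ _ _ daz _ _] _ _ _ wa _ _ _ _ _ _ _ _ _.
have zz : - h s < z < h s by rewrite -ltr_norml.
have /andP[z1 z2] := zz.
have hs := h0 s.
have aE : val0 a s z = \int[mu]_(t in `]- h s, z[) d_z a s t.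
  by have := der_z_slice z ph daz taz wa s0; rewrite zs (min_idPr (ltW z2)).
pose g r z' := m / (4 * h s) + h s / m * (d_z a r z' * d_z a r z').
have taz2 : tame h (fun r z => d_z a r z * d_z a r z) by tame_tac.
have tg : tame h g by exact: (tameD (tame_cst h _) (tameM (tame_cst h _) taz2)).
have tNaz : tame h (fun r z => -1 * d_z a r z) by exact: (tameM (tame_cst h _) taz).
have gE : slice_int h s g = m / 2 + h s / m * dz_density s.
  rewrite /g (slice_intD (tame_cst h _) (tameM (tame_cst h _) taz2) s0) (slice_intZ _ taz2 s0) slice_int_cst//.
  by congr (_ + _); field; rewrite gt_eqF.
have gpt t : `|d_z a s t| <= g s t.
  rewrite /g; move: (d_z a s t) => x.
  have p0 : 0 < h s / m by rewrite divr_gt0.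
  have : 0 <= h s / m * (`|x| - m / (2 * h s)) ^+ 2 by rewrite mulr_ge0 ?sqr_ge0// ltW.
  rewrite (_ : h s / m * (`|x| - m / (2 * h s)) ^+ 2 =
     m / (4 * h s) + h s / m * (`|x| ^+ 2) - `|x|); last by field; rewrite !gt_eqF.
  by rewrite subr_ge0 real_normK ?num_real// expr2.
have g0 t : 0 <= g s t by exact: le_trans (gpt t).
have gle : \int[mu]_(t in `]- h s, z[) g s t <= slice_int h s g.
  rewrite /slice_int /Rintegral.
  have i1 := slice_integrable tg s0 (lexx _) (ltW z2).
  have i2 := slice_int_integrable tg s0.
  apply: fine_le; [exact: integrable_fin_num i1|exact: integrable_fin_num i2|].
  apply: ge0_subset_integral => //.
  - by case/integrableP : i2.
  - by move=> t _; rewrite lee_fin.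
  - by apply: subset_itvl; rewrite bnd_simp ltW.
rewrite -gE (le_trans _ gle)// aE ler_norml.
have i1 := slice_integrable tg s0 (lexx _) (ltW z2).
have i2 := slice_integrable taz s0 (lexx _) (ltW z2).
apply/andP; split.
  rewrite lerNl -mulN1r -RintegralZl//.
  apply: le_Rintegral => //.
    exact: (slice_integrable tNaz s0 (lexx _) (ltW z2)).
  by move=> t _; rewrite mulN1r (le_trans _ (gpt t))// -normrN ler_norm.
by apply: le_Rintegral => // t _; rewrite (le_trans _ (gpt t))// ler_norm.
Qed.

Lemma slice_scalar (F : realFieldType) (s k X ir iz : F) : 0 < s -> 0 < k -> 0 <= X -> 0 <= ir ->
  (s / (4 * k) + 2^-1 * (s * X)) * (4 * (k * k) * iz) + s * k * ir <=
  (k + 2 * k ^+ 2 * X) * (s * (ir + iz)).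
Proof.
move=> s0 k0 X0 ir0; rewrite -subr_ge0.
rewrite (_ : _ - _ = 2 * k ^+ 2 * X * (s * ir)); last by field; rewrite gt_eqF.
by rewrite !mulr_ge0 ?(ltW s0) ?(ltW k0).
Qed.

(** Since [slice_int h s grad_energy] is the derivative of the left-hand side E(s), this is
    a differential inequality E <= (A + B d) E', with d = [dz_density] the only
    uncontrolled coefficient. *)
Lemma slice_estimate (s m : R) : 0 < s -> 0 < m ->
  chan_int h s grad_energy <= (h s + h s ^+ 2 * m + 2 * h s ^+ 3 / m * dz_density s) * slice_int h s grad_energy.
Proof.
move=> s0 m0; rewrite (swirl_energy s0).
case: swirl_identities => ta taz tc tG tGr tGz tg tf _ _ _ _ dGz _ _ vG _ _ _.
have hs := h0 s.
pose X := m / 2 + h s / m * dz_density s.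
have X0 : 0 <= X.
  by rewrite (le_trans _ (radial_sup s0 (_ : `|0| < h s) m0))// normr0.
have tGG : tame h (fun r z => Gamma r z * Gamma r z) by tame_tac.
have tRR : tame h (fun r z => Gamma_r r z * Gamma_r r z) by tame_tac.
have tZZ : tame h (fun r z => Gamma_z r z * Gamma_z r z) by tame_tac.
have GP := slice_poincare ph tG tGz dGz (vanishing_wall vG) s0.
have gE : slice_int h s grad_energy = s * (slice_int h s (fun r z => Gamma_r r z * Gamma_r r z) + slice_int h s (fun r z => Gamma_z r z * Gamma_z r z)).
  by rewrite -(slice_intD tRR tZZ s0) -(slice_intZ _ (tameD tRR tZZ) s0).
have fle : slice_int h s flux <= (s / (4 * h s) + 2^-1 * (s * X)) * slice_int h s (fun r z => Gamma r z * Gamma r z)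
    + s * h s * slice_int h s (fun r z => Gamma_r r z * Gamma_r r z).
  rewrite -!slice_intZ//.
  have t1 k f : tame h f -> tame h (fun r z => k * f r z) by move=> tf'; tame_tac.
  rewrite -(slice_intD (t1 _ _ tGG) (t1 _ _ tRR) s0).
  apply: (slice_int_le tf (tameD (t1 _ _ tGG) (t1 _ _ tRR)) s0) => z zs.
  rewrite /flux; have := radial_sup s0 zs m0; rewrite -/X ler_norml.
  move: (val0 a s z) (Gamma s z) (Gamma_r s z) => x g gr /andP[x1 _].
  have e1 : 0 <= s * h s * (gr - g / (2 * h s)) ^+ 2 by rewrite mulr_ge0 ?sqr_ge0// mulr_ge0 ?ltW.
  have e2 : 0 <= 2^-1 * s * (X + x) * g ^+ 2.
    by rewrite mulr_ge0 ?sqr_ge0// mulr_ge0 ?mulr_ge0 ?(ltW s0)//; lra.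
  have e3 : 0 <= g ^+ 2 by exact: sqr_ge0.
  rewrite -subr_ge0 (_ : _ - _ = s * h s * (gr - g / (2 * h s)) ^+ 2 + 2^-1 * s * (X + x) * g ^+ 2 + g ^+ 2).
    by rewrite !addr_ge0.
  by field; rewrite gt_eqF.
rewrite (le_trans fle)// gE.
set ir := slice_int h s (fun r z => Gamma_r r z * Gamma_r r z).
set iz := slice_int h s (fun r z => Gamma_z r z * Gamma_z r z).
set ig := slice_int h s (fun r z => Gamma r z * Gamma r z).
have ir0 : 0 <= ir by apply: slice_int_ge0 => z _; rewrite -expr2 sqr_ge0.
have iz0 : 0 <= iz by apply: slice_int_ge0 => z _; rewrite -expr2 sqr_ge0.
have k0 : 0 <= s / (4 * h s) + 2^-1 * (s * X).
  by rewrite addr_ge0 ?divr_ge0 ?mulr_ge0 ?(ltW s0) ?(ltW hs)//.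
rewrite (le_trans (lerD (ler_wpM2l k0 GP) (lexx _)))//.
have -> : h s + h s ^+ 2 * m + 2 * h s ^+ 3 / m * dz_density s = h s + 2 * h s ^+ 2 * X.
  by rewrite /X; field; rewrite gt_eqF.
exact: slice_scalar.
Qed.

Lemma chan_int_ge_slices (F : R -> R -> R) (r1 r2 k : R) : tame h F ->
  (forall r z : R, 0 < r -> `|z| < h r -> 0 <= F r z) -> 0 <= r1 < r2 ->
  (forall s : R, r1 < s < r2 -> k <= slice_int h s F) -> k * (r2 - r1) <= chan_int h r2 F.
Proof.
move=> tF F0 /andP[r10 r12] kS.
have [iF ->] := chan_int_slices ph r2 tF.
have sub : `]r1, r2[ `<=` `]0, r2[ by apply: subset_itvr; rewrite bnd_simp.
have iF' : mu.-integrable `]r1, r2[ (fun s => (slice_int h s F)%:E).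
  by apply: (integrableS _ _ _ iF).
have S0 s : 0 < s -> 0 <= slice_int h s F by move=> s0; apply: slice_int_ge0 => z zs; exact: F0.
apply: (@le_trans _ _ (\int[mu]_(s in `]r1, r2[) slice_int h s F)); last first.
  rewrite /Rintegral; apply: fine_le; [exact: integrable_fin_num iF'|exact: integrable_fin_num iF|].
  apply: ge0_subset_integral => //.
  - by case/integrableP : iF.
  - by move=> s; rewrite /= in_itv /= => /andP[s0 _]; rewrite lee_fin S0.
have -> : k * (r2 - r1) = \int[mu]_(s in `]r1, r2[) (cst k s).
  by rewrite Rintegral_cst//= lebesgue_measure_itv /= lte_fin r12 -EFinB.
by apply: le_Rintegral => //; exact: cst_itv_integrable.
Qed.

(** 1/k lies above its tangent line at l, which is affine in k: after integration in s
    only the integral of the coefficient k is needed. *)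
Lemma tangent_bound (F : realFieldType) (x e k l : F) : 0 <= x -> 0 <= e -> 0 < k -> 0 < l ->
  x <= k * e -> x * (2 / l - k / l ^+ 2) <= e.
Proof.
move=> x0 e0 k0 l0 xke.
have xk : x / k <= e by rewrite ler_pdivrMr// mulrC.
apply: le_trans xk; rewrite -subr_ge0.
rewrite (_ : _ - _ = x / k * (1 - k / l) ^+ 2); last by field; rewrite !gt_eqF.
by rewrite mulr_ge0 ?sqr_ge0// divr_ge0// ltW.
Qed.

Let grad_energy_ge0 (r z : R) : 0 < r -> 0 <= grad_energy r z.
Proof. by move=> r0; rewrite /grad_energy mulr_ge0 ?(ltW r0)// addr_ge0// -expr2 sqr_ge0. Qed.

(** [slice_estimate] is integrated over R0 < s < 2 R0 through [tangent_bound] with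
    l = v R0; the coefficient [dz_density] integrates against s to at most D.  The two
    hypotheses on h make the error terms at most half of the main term 2/v. *)
Lemma doubling_step (R0 v : R) : 0 < R0 -> 0 < v -> h (2 * R0) <= v * R0 / 4 ->
  16 * (D + 1) * h (2 * R0) ^+ 5 <= v ^+ 2 * R0 ^+ 4 ->
  chan_int h R0 grad_energy <= v * chan_int h (2 * R0) grad_energy.
Proof.
move=> R00 v0 HR H5.
have [ta taz _ _ _ _ tg _ _ _ _ _ _ _ _ _ _ _ _] := swirl_identities.
set E := chan_int h R0 grad_energy; set E2 := chan_int h (2 * R0) grad_energy.
pose H := h (2 * R0); have H0 : 0 < H by exact: h0.
have E0 : 0 <= E by apply: chan_int_ge0 => r z /andP[r0 _] _; exact: grad_energy_ge0.
(* this m makes H^2 m = v R0 / 4, comparable with the other error H *)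
pose m := R0 * v / (4 * H ^+ 2).
have m0 : 0 < m by rewrite /m divr_gt0 ?mulr_gt0// exprn_gt0.
(* at this l the main term 2/l, times the length R0, is 2/v *)
pose l := v * R0; have l0 : 0 < l by rewrite mulr_gt0.
pose A := H + H ^+ 2 * m; pose B := 2 * H ^+ 3 / m.
have B0 : 0 < B by rewrite /B divr_gt0// mulr_gt0// exprn_gt0.
have A0 : 0 < A by rewrite /A addr_gt0// mulr_gt0// exprn_gt0.
pose kap := E * B / (l ^+ 2 * R0).
have kap0 : 0 <= kap by exact: divr_ge0 (mulr_ge0 E0 (ltW B0)) (mulr_ge0 (sqr_ge0 l) (ltW R00)).
have tz2 : tame h (fun r z => r * (d_z a r z * d_z a r z)) by tame_tac.
have tz1 : tame h (fun r z => d_z a r z * d_z a r z) by tame_tac.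
have tF : tame h (fun r z => grad_energy r z + kap * (r * (d_z a r z * d_z a r z))).
  exact: (tameD tg (tameM (tame_cst h kap) tz2)).
have key : E * (2 / l - A / l ^+ 2) * (2 * R0 - R0) <= E2 + kap * D.
  apply: (@le_trans _ _ (chan_int h (2 * R0) (fun r z => grad_energy r z + kap * (r * (d_z a r z * d_z a r z))))).
    apply: chan_int_ge_slices => //.
    - move=> r z r0 _; rewrite addr_ge0 ?grad_energy_ge0// mulr_ge0// mulr_ge0 ?(ltW r0)//.
      by rewrite -expr2 sqr_ge0.
    - by rewrite (ltW R00)/=; lra.
    move=> s /andP[s1 s2]; have s0 : 0 < s by exact: lt_trans s1.
    rewrite (slice_intD tg (tameM (tame_cst h kap) tz2) s0) (slice_intZ _ tz2 s0).
    have -> : slice_int h s (fun r z => r * (d_z a r z * d_z a r z)) = s * dz_density s.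
      by rewrite /dz_density -(slice_intZ _ tz1 s0).
    have d0 : 0 <= dz_density s by apply: slice_int_ge0 => z _; rewrite -expr2 sqr_ge0.
    have e0 : 0 <= slice_int h s grad_energy by apply: slice_int_ge0 => z _; exact: grad_energy_ge0.
    have hsH : h s <= H by case: ph => _ mh _; apply: mh; exact: ltW.
    have hs := h0 s.
    have h2 : h s ^+ 2 <= H ^+ 2 by rewrite lerXn2r ?nnegrE ?(ltW hs) ?(ltW H0).
    have h3 : h s ^+ 3 <= H ^+ 3 by rewrite lerXn2r ?nnegrE ?(ltW hs) ?(ltW H0).
    have Ee : E <= (A + B * dz_density s) * slice_int h s grad_energy.
      rewrite (@le_trans _ _ (chan_int h s grad_energy))//.
        apply: (chan_int_subset ph tg (ltW s1)) => r z /andP[r0 _] _; exact: grad_energy_ge0.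
      rewrite (le_trans (slice_estimate s0 m0))// ler_wpM2r// /A /B.
      rewrite !lerD// ?ler_wpM2r// ?(ltW m0)// ?invr_ge0 ?(ltW m0)//.
      by rewrite ler_pM2l.
    have Ak : 0 < A + B * dz_density s by rewrite ltr_pwDl// mulr_ge0// ltW.
    have T := tangent_bound E0 e0 Ak l0 Ee.
    have Bd : E * (B * dz_density s / l ^+ 2) <= kap * (s * dz_density s).
      rewrite /kap (_ : E * (B * dz_density s / l ^+ 2) = E * B / (l ^+ 2 * R0) * (R0 * dz_density s)); last first.
        by field; rewrite !gt_eqF.
      by rewrite ler_wpM2l// ler_wpM2r// ltW.
    move: T Bd; rewrite mulrBr (mulrBr E) mulrDl mulrDr; lra.
  rewrite (chan_intD _ ph tg (tameM (tame_cst h kap) tz2)) (chan_intZ _ _ ph tz2) lerD2l ler_wpM2l//.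
  case: (fl) => _ _ _ _ _ _ _ _ _ _ _ _ _ _ /(_ (2 * R0)) dd.
  apply: le_trans dd; rewrite -addrA lerDl addr_ge0//;
    by apply: chan_int_ge0 => r z /andP[r0 _] _; rewrite mulr_ge0 ?(ltW r0)// -expr2 sqr_ge0.
have D0 : 0 <= D.
  case: (fl) => _ _ _ _ _ _ _ _ _ _ _ _ _ _ /(_ 1) dd.
  by apply: le_trans dd; rewrite !addr_ge0//; apply: chan_int_ge0 => r z /andP[r0 _] _;
    rewrite mulr_ge0 ?(ltW r0)// -expr2 sqr_ge0.
have AE : A = H + R0 * v / 4 by rewrite /A /m; field; rewrite gt_eqF.
have kE : kap = E * (8 * H ^+ 5 / (v ^+ 3 * R0 ^+ 4)).
  by rewrite /kap /B /m /l; field; rewrite !gt_eqF.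
have K1 : kap * D <= E * (1 / (2 * v)).
  rewrite kE -mulrA ler_wpM2l//.
  rewrite (_ : _ * D = 16 * D * H ^+ 5 / (v ^+ 2 * R0 ^+ 4) * (1 / (2 * v))); last first.
    by field; rewrite !gt_eqF.
  rewrite ler_piMl//; first by rewrite divr_ge0// mulr_ge0// ltW.
  rewrite ler_pdivrMr ?mul1r ?mulr_gt0 ?exprn_gt0//.
  apply: le_trans H5; rewrite ler_wpM2r ?exprn_ge0 ?(ltW H0)//.
  lra.
have K2 : E * (3 / (2 * v)) <= E * (2 / l - A / l ^+ 2) * (2 * R0 - R0).
  rewrite -mulrA ler_wpM2l// AE /l.
  rewrite [leRHS](_ : _ = 7 / (4 * v) - H / (v ^+ 2 * R0)); last by field; rewrite !gt_eqF.
  have : H / (v ^+ 2 * R0) <= 1 / (4 * v).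
    rewrite ler_pdivrMr ?mulr_gt0 ?exprn_gt0//.
    by rewrite [leRHS](_ : _ = v * R0 / 4)//; field; rewrite gt_eqF.
  rewrite (_ : 3 / (2 * v) = 7 / (4 * v) - 1 / (4 * v)); last by field; rewrite gt_eqF.
  by lra.
have K3 : E / v <= E2.
  have -> : E / v = E * (3 / (2 * v)) - E * (1 / (2 * v)) by field; rewrite gt_eqF.
  move: key K1 K2; set x := E * _ * _; set y := kap * D; lra.
by rewrite mulrC -ler_pdivrMr.
Qed.

Lemma chan_int_cst_le (S k : R) : 0 < S -> 0 <= k -> chan_int h S (fun _ _ => k) <= k * (2 * h S) * S.
Proof.
move=> S0 k0; have [iF ->] := chan_int_slices ph S (tame_cst h k).
have -> : k * (2 * h S) * S = \int[mu]_(s in `]0, S[) (cst (k * (2 * h S)) s).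
  by rewrite Rintegral_cst//= lebesgue_measure_itv /= lte_fin S0 -EFinB /= subr0.
apply: le_Rintegral => //; first exact: cst_itv_integrable.
move=> s; rewrite /= in_itv /= => /andP[s0 sS]; rewrite slice_int_cst// ler_wpM2l// ler_pM2l//.
by case: ph => _ mh _; apply: mh; exact: ltW.
Qed.

(** Caccioppoli's inequality with the cutoff (2 S - r)^2 and |Gamma| <= M r. *)
Lemma swirl_growth (S : R) : 0 < S ->
  S ^+ 2 * chan_int h S grad_energy <= (8 * S ^+ 3 * M ^+ 2 + 16 * S ^+ 4 * M ^+ 3) * (2 * h (2 * S)) * (2 * S).
Proof.
move=> S0; have S20 : 0 < 2 * S by rewrite mulr_gt0.
case: swirl_identities => ta _ tc tG tGr tGz tg tf tfz tfr' tfz' dGr dGz dfr dfz vG vf vfz eq.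
have wfz := vanishing_wall vfz.
have M0 : 0 <= M.
  by case: (fl) => _ _ _ _ _ _ _ _ sa _ _ _ _ _ _; rewrite (le_trans _ (sa S 0 S0 _)) ?normr0.
pose K := 8 * S ^+ 3 * M ^+ 2 + 16 * S ^+ 4 * M ^+ 3.
have K0 : 0 <= K.
  by rewrite /K addr_ge0// !mulr_ge0 ?exprn_ge0// ltW.
(* y^2 is the cutoff: it vanishes at r = 2 S and is at least S^2 for r < S *)
pose y := fun r _ : R => 2 * S - r.
pose GG := fun r z : R => (y r z * y r z) * flux r z + (y r z * (r * Gamma r z)) * Gamma r z.
pose HH := fun r z : R => (y r z * y r z) * fluxz r z.
pose gg := fun r z : R => y r z * y r z * fluxr' r z + y r z * (r * (val0 a r z * (Gamma r z * Gamma r z)))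
  + (2 * y r z + (y r z - r)) * (Gamma r z * Gamma r z).
pose hh := fun r z : R => y r z * y r z * fluxz' r z.
have ty : tame h y by rewrite /y; tame_tac.
have dy : der_r h y (fun _ _ => -1).
  apply: der_r_eq (_ : der_r h y _) _; first by rewrite /y; der_r_tac.
  by move=> r z _ _ /=; ring.
have dyz : der_z h y (fun _ _ => 0).
  apply: der_z_eq (_ : der_z h y _) _; first by rewrite /y; der_z_tac.
  by move=> r z _ _ /=; ring.
have dGG : der_r h GG gg.
  apply: der_r_eq (_ : der_r h GG _) _; first by rewrite /GG; der_r_tac.
  by move=> r z _ _ /=; rewrite /gg /flux; field.
have dHH : der_z h HH hh.
  apply: der_z_eq (_ : der_z h HH _) _; first by rewrite /HH; der_z_tac.
  by move=> r z _ _ /=; rewrite /hh; ring.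
have vGG : vanishing h GG by rewrite /GG; vanish_tac.
have wHH : wall_vanishing h HH by rewrite /HH; vanish_tac.
have tgg : tame h gg by rewrite /gg; tame_tac.
have thh : tame h hh by rewrite /hh; tame_tac.
have twg : tame h (fun r z => y r z * y r z * grad_energy r z) by tame_tac.
have tK : tame h (fun _ _ => K) by exact: tame_cst.
apply: (@le_trans _ _ (chan_int h (2 * S) (fun r z => y r z * y r z * grad_energy r z))).
  apply: (@le_trans _ _ (chan_int h S (fun r z => y r z * y r z * grad_energy r z))); last first.
    apply: (chan_int_subset ph twg) => [|r z /andP[r0 _] _]; first lra.
    by rewrite mulr_ge0 ?grad_energy_ge0// -expr2 sqr_ge0.
  rewrite -(chan_intZ _ _ ph tg); apply: (chan_int_le ph (tameM (tame_cst h (S ^+ 2)) tg) twg).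
  move=> r z /andP[r0 rS] _; rewrite ler_wpM2r ?grad_energy_ge0// expr2.
  by apply: ler_pM; rewrite ?(ltW S0)// /y; lra.
apply: (@le_trans _ _ (chan_int h (2 * S) (fun _ _ => K))); last exact: chan_int_cst_le.
have I0 : chan_int h (2 * S) gg + chan_int h (2 * S) hh = 0.
  rewrite (chan_int_dz _ ph dHH thh wHH) addr0 (chan_int_dr ph S20 dGG tgg vGG).
  rewrite /Rintegral integral0_eq// => z _; congr (_%:E).
  by rewrite /GG /y subrr !mul0r addr0.
rewrite -[leRHS]add0r -I0 -(chan_intD _ ph tgg thh) -(chan_intD _ ph (tameD tgg thh) tK).
apply: (chan_int_le ph twg (tameD (tameD tgg thh) tK)) => r z /andP[r0 rS] zr.
rewrite eq// /gg /hh.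
have bM : `|val0 b r z| <= M by case: (fl) => _ _ _ _ _ _ _ _ _ sb _ _ _ _ _; exact: sb.
have aM : `|val0 a r z| <= M by case: (fl) => _ _ _ _ _ _ _ _ sa _ _ _ _ _ _; exact: sa.
have y0 : 0 <= y r z by rewrite /y subr_ge0 ltW.
have yS : y r z <= 2 * S by rewrite /y gerBl ltW.
have GM : Gamma r z * Gamma r z <= (2 * S) ^+ 2 * M ^+ 2.
  rewrite /Gamma mulrACA -!expr2 ler_pM ?sqr_ge0//.
    by rewrite lerXn2r ?nnegrE ?(ltW r0) ?(ltW S20) ?(ltW rS).
  by rewrite -(real_normK (num_real _)) lerXn2r ?nnegrE.
have G0 : 0 <= Gamma r z * Gamma r z by rewrite -expr2 sqr_ge0.
move: aM GM G0 yS y0; move: (y r z) (Gamma r z * Gamma r z) (val0 a r z) (fluxr' r z) (fluxz' r z).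
move=> yy g x f1 f2; rewrite ler_norml => /andP[x1 x2] GM G0 yS y0.
have e1 : r * g <= 2 * S * ((2 * S) ^+ 2 * M ^+ 2) by apply: ler_pM => //; exact: ltW.
have e2 : yy * r * (M * g) <= 2 * S * (2 * S) * (M * ((2 * S) ^+ 2 * M ^+ 2)).
  apply: ler_pM; rewrite ?mulr_ge0 ?(ltW r0)//.
    by apply: ler_pM => //; exact: ltW.
  by rewrite ler_wpM2l.
have e3 : 0 <= yy * r * ((x + M) * g).
  by rewrite !mulr_ge0 ?(ltW r0)//; lra.
have e4 : 0 <= yy * g by rewrite mulr_ge0.
rewrite -subr_ge0.
rewrite (_ : _ - _ = yy * r * ((x + M) * g) + 3 * (yy * g) + (2 * S * ((2 * S) ^+ 2 * M ^+ 2) - r * g)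
   + (2 * S * (2 * S) * (M * ((2 * S) ^+ 2 * M ^+ 2)) - yy * r * (M * g))); last by rewrite /K; ring.
have e5 : 0 <= 3 * (yy * g) by rewrite mulr_ge0.
do 2 (apply: addr_ge0; last by rewrite subr_ge0).
exact: addr_ge0.
Qed.

Lemma quartic_over_quintic (F : fieldType) (C r t : F) : t != 0 ->
  t ^- 5 * (C * (t ^+ 4 * r ^+ 4)) = C * r ^+ 4 / t.
Proof. by move=> t0; field. Qed.

Lemma iterated_doubling (E : R -> R) (R1 : R) : 0 < R1 ->
  (forall r, R1 <= r -> E r <= 32^-1 * E (2 * r)) ->
  forall n r, R1 <= r -> E r <= 32^-1 ^+ n * E (2 ^+ n * r).
Proof.
move=> R10 HE; elim=> [|n IH] r rR; first by rewrite !expr0 !mul1r.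
apply: (le_trans (IH r rR)).
rewrite exprSr -mulrA ler_wpM2l ?exprn_ge0 ?invr_ge0//.
rewrite exprS -mulrA HE//.
have : 1 <= 2 ^+ n :> R by rewrite exprn_ege1// ler1n.
by move=> n1; rewrite (le_trans rR)// ler_peMl// (le_trans (ltW R10)).
Qed.

(** Doubling multiplies the energy by at least 32, whereas the growth S^4 allows at most
    16; so the energy is zero for large radii, hence everywhere. *)
Theorem flow_swirl_free :
  (forall e : R, 0 < e -> exists S0 : R, forall S, S0 <= S -> h S ^+ 5 <= e * S ^+ 4) ->
  forall r z : R, 0 < r -> `|z| < h r -> val0 b r z = 0.
Proof.
move=> hS.
have M0 : 0 <= M.
  by case: (fl) => _ _ _ _ _ _ _ _ sa _ _ _ _ _ _; rewrite (le_trans _ (sa 1 0 ltr01 _)) ?normr0.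
have D0 : 0 <= D.
  case: (fl) => _ _ _ _ _ _ _ _ _ _ _ _ _ _ /(_ 1) dd.
  by apply: le_trans dd; rewrite !addr_ge0//; apply: chan_int_ge0 => r z /andP[r0 _] _;
    rewrite mulr_ge0 ?(ltW r0)// -expr2 sqr_ge0.
pose v : R := 32^-1.
have v0 : 0 < v by rewrite invr_gt0.
have lin (k : R) : 0 < k -> exists S0 : R, forall S, S0 <= S -> h S <= k * S.
  move=> k0; have k50 : 0 < k ^+ 5 by rewrite exprn_gt0.
  have [S0 HS] := hS _ k50; exists (Num.max 1 S0) => S; rewrite ge_max => /andP[S1 SS].
  have Sp : 0 < S by rewrite (lt_le_trans ltr01).
  rewrite -(@ler_pXn2r _ 5)// ?nnegrE ?(ltW (h0 S)) ?mulr_ge0 ?(ltW k0) ?(ltW Sp)//.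
  rewrite (le_trans (HS _ SS))// exprMn ler_pM2l//.
  by rewrite (exprS _ 4) ler_peMl// exprn_ge0// ltW.
have e10 : 0 < v ^+ 2 / (16 * (D + 1) * 16).
  rewrite divr_gt0 ?exprn_gt0// !mulr_gt0//; lra.
have [S1 H1] := hS _ e10.
have [S2 H2] := lin (v / 8) (divr_gt0 v0 (ltr0n _ 8)).
have [S3 H3] := lin 1 ltr01.
pose R1 := Num.max 1 (Num.max S1 (Num.max S2 S3)).
have R1p : 0 < R1 by rewrite lt_max ltr01.
have R1i (S : R) : R1 <= S -> [/\ 1 <= S, S1 <= S, S2 <= S & S3 <= S].
  by rewrite /R1 !ge_max => /andP[? /andP[? /andP[? ?]]].
have dbl (r : R) : R1 <= r -> chan_int h r grad_energy <= v * chan_int h (2 * r) grad_energy.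
  move=> rR; have r0 : 0 < r := lt_le_trans R1p rR.
  have [r1 r2 r3 r4] := R1i (2 * r) (le_trans rR (ler_peMl (ltW r0) (ler1n _ 2))).
  apply: doubling_step => //.
    by rewrite (le_trans (H2 _ r3))// (_ : v / 8 * (2 * r) = v * r / 4)//; field.
  have k0 : 0 < 16 * (D + 1) by rewrite mulr_gt0//; lra.
  rewrite mulrC -ler_pdivlMr// (le_trans (H1 _ r2))// (_ : _ * _ = v ^+ 2 * r ^+ 4 / (16 * (D + 1)))//.
  by field; rewrite gt_eqF//; lra.
pose C := 8 * (8 * M ^+ 2 + 16 * M ^+ 3).
have C0 : 0 <= C by rewrite /C mulr_ge0// addr_ge0// mulr_ge0// exprn_ge0.
have gro (r : R) : R1 <= r -> chan_int h r grad_energy <= C * r ^+ 4.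
  move=> rR; have r0 : 0 < r := lt_le_trans R1p rR.
  have [r1 _ _ _] := R1i _ rR.
  have [_ _ _ r4] := R1i (2 * r) (le_trans rR (ler_peMl (ltW r0) (ler1n _ 2))).
  have := swirl_growth r0; rewrite mulrC -ler_pdivlMr ?exprn_gt0// => /le_trans; apply.
  rewrite ler_pdivrMr ?exprn_gt0//.
  have h2r := H3 _ r4; rewrite mul1r in h2r.
  have M2 : 0 <= M ^+ 2 by rewrite exprn_ge0.
  have M3 : 0 <= M ^+ 3 by rewrite exprn_ge0.
  apply: (@le_trans _ _ ((8 * r ^+ 4 * M ^+ 2 + 16 * r ^+ 4 * M ^+ 3) * (2 * (2 * r)) * (2 * r))).
    rewrite ler_wpM2r ?mulr_ge0 ?(ltW r0)//.
    apply: ler_pM.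
    - by rewrite addr_ge0// !mulr_ge0 ?exprn_ge0 ?(ltW r0).
    - by rewrite mulr_ge0// ltW.
    - rewrite lerD2r ler_wpM2r// ler_pM2l//.
      by rewrite (exprS _ 3) ler_peMl// exprn_ge0// ltW.
    - by rewrite ler_pM2l.
  by rewrite le_eqVlt /C; apply/orP; left; apply/eqP; ring.
have E0 (r : R) : R1 <= r -> chan_int h r grad_energy <= 0.
  move=> rR; have r0 : 0 < r := lt_le_trans R1p rR.
  have b2 n : chan_int h r grad_energy <= C * r ^+ 4 / 2 ^+ n.
    rewrite (le_trans (iterated_doubling R1p dbl n rR))//.
    have n1 : 1 <= 2 ^+ n :> R by rewrite exprn_ege1// ler1n.
    have rr : R1 <= 2 ^+ n * r by rewrite (le_trans rR)// ler_peMl// ltW.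
    rewrite (le_trans (ler_wpM2l _ (gro _ rr)))// ?exprn_ge0 ?invr_ge0//.
    rewrite le_eqVlt; apply/orP; left; apply/eqP.
    have e32 : 32 ^+ n = (2 ^+ n) ^+ 5 :> R by rewrite -(exprM 2 n 5) mulnC (exprM 2 5 n); congr (_ ^+ n); ring.
    have n0 : 2 ^+ n != 0 :> R by rewrite expf_neq0// pnatr_eq0.
    by rewrite exprMn exprVn e32; apply: quartic_over_quintic.
  rewrite leNgt; apply/negP => Ep.
  pose k := C * r ^+ 4 / chan_int h r grad_energy.
  have k0 : 0 <= k := divr_ge0 (mulr_ge0 C0 (exprn_ge0 4 (ltW r0))) (ltW Ep).
  have := archi_boundP k0; set n := Num.bound k => kn.
  have := b2 n; rewrite leNgt => /negP; apply.
  have n20 : 0 < 2 ^+ n :> R by rewrite exprn_gt0.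
  rewrite ltr_pdivrMr// -ltr_pdivrMl// mulrC (lt_le_trans kn)//.
  by rewrite -natrX ler_nat ltnW// ltn_expl.
move=> r z r0 zr.
pose T := Num.max R1 (r + 1).
have TR : R1 <= T by rewrite le_max lexx.
have rT : 0 < r < T by rewrite r0 lt_max ltrDl ltr01 orbT.
case: swirl_identities => _ _ _ tG tGr tGz tg _ _ _ _ _ dGz _ _ vG _ _ _.
have t1 : tame h (fun r z => r * (Gamma r z * Gamma r z)) by tame_tac.
have t2 : tame h (fun r z => r * (Gamma_z r z * Gamma_z r z)) by tame_tac.
have I2 : chan_int h T (fun r z => r * (Gamma_z r z * Gamma_z r z)) <= 0.
  rewrite (le_trans _ (E0 _ TR))//; apply: (chan_int_le ph t2 tg) => r' z' /andP[r'0 _] _.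
  by rewrite /grad_energy ler_pM2l// lerDr -expr2 sqr_ge0.
have I1 : chan_int h T (fun r z => r * (Gamma r z * Gamma r z)) <= 0.
  rewrite (le_trans (poincare T ph tG tGz dGz (vanishing_wall vG)))// mulr_ge0_le0//.
  by rewrite !mulr_ge0// ltW.
have pos (r' z' : R) : 0 < r' < T -> `|z'| < h r' -> 0 <= r' * (Gamma r' z' * Gamma r' z').
  by move=> /andP[r'0 _] _; rewrite mulr_ge0 ?(ltW r'0)// -expr2 sqr_ge0.
have := chan_int_eq0 ph t1 pos I1 rT zr.
move=> /eqP; rewrite mulf_eq0 gt_eqF//= -expr2 sqrf_eq0 /Gamma mulf_eq0 gt_eqF//=.
by move=> /eqP.
Qed.

End swirl.

(** * The profile max(1, r)^alpha *)

Section channel_profile.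
Context {R : realType}.

Definition channel (alpha : R) (r : R) : R := (Num.max 1 r) `^ alpha.

Lemma channel_profile (alpha : R) : 0 <= alpha -> profile (channel alpha).
Proof.
move=> a0; split.
- move=> r.
  have m0 (s : R) : 0 < Num.max 1 s by rewrite lt_max ltr01.
  have -> : channel alpha = (fun s => expR (alpha * ln (Num.max 1 s))).
    by apply/funext => s; rewrite /channel /powR gt_eqF.
  have cm : {for r, continuous (fun s : R => Num.max 1 s)}.
    exact: (@continuous_max R R (fun=> 1) id r (@cvg_cst _ _ _ _ _) (@cvg_id _ _)).
  have cl : ln (Num.max 1 s) @[s --> (r : R)] --> ln (Num.max 1 r).
    exact: (cvg_comp _ _ cm (continuous_ln (m0 r))).
  exact: (cvg_comp _ _ (@cvgMl_tmp _ _ _ _ _ alpha _ cl) (@continuous_expR R _)).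
- move=> x y xy.
  have mm : Num.max 1 x <= Num.max 1 y by rewrite ge_max !le_max lexx xy orbT.
  by rewrite /channel ge0_ler_powR// ?nnegrE le_max ler01.
- move=> x; have m1 : 1 <= Num.max 1 x by rewrite le_max lexx.
  have := @ge0_ler_powR R alpha a0 1 (Num.max 1 x); rewrite !nnegrE powR1; apply=> //.
  exact: le_trans ler01 m1.
Qed.

Lemma powR_le_eventually (p q : R) : p < q -> forall e : R, 0 < e ->
  exists S0 : R, forall S, S0 <= S -> S `^ p <= e * S `^ q.
Proof.
move=> pq e e0; exists (Num.max 1 (e^-1 `^ (q - p)^-1)) => S; rewrite ge_max => /andP[S1 SS].
have S0 : 0 < S by rewrite (lt_le_trans ltr01).
have qp : 0 < q - p by rewrite subr_gt0.
have -> : S `^ q = S `^ (q - p) * S `^ p by rewrite -powRD ?subrK// (gt_eqF S0) implybT.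
rewrite mulrA ler_peMl ?powR_ge0// -ler_pdivrMl// mulr1.
have := ge0_ler_powR (ltW qp) _ _ SS; rewrite !nnegrE powR_ge0 (ltW S0) => /(_ isT isT).
by rewrite -powRrM mulVf ?gt_eqF// powRr1// invr_ge0 ltW.
Qed.

Lemma channel_growth (alpha : R) (n m : nat) : alpha * n%:R < m%:R -> forall e : R, 0 < e ->
  exists S0 : R, forall S, S0 <= S -> channel alpha S ^+ n <= e * S ^+ m.
Proof.
move=> nm e /(powR_le_eventually nm)[S0 HS]; exists (Num.max 1 S0) => S.
rewrite ge_max => /andP[S1 SS].
have S0' : 0 < S by rewrite (lt_le_trans ltr01).
have := HS _ SS; rewrite powRrM (@powR_mulrn _ (S `^ alpha) n (powR_ge0 _ _)) (powR_mulrn m (ltW S0')).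
by rewrite /channel (max_idPr S1).
Qed.

End channel_profile.

(** * Geometry of the domain *)

Section cylinder.
Context {R : realType}.
Implicit Types (x : 'rV[R]_3) (alpha : R).

Lemma row3_0 (a b c : R) : row3 a b c 0 0 = a. Proof. by rewrite mxE. Qed.

Lemma row3_1 (a b c : R) : row3 a b c 0 1 = b. Proof. by rewrite mxE. Qed.

Lemma row3_2 (a b c : R) : row3 a b c 0 2 = c. Proof. by rewrite mxE. Qed.

Definition row3E := (row3_0, row3_1, row3_2).

Lemma ord3P (Q : 'I_3 -> Prop) : Q 0 -> Q 1 -> Q 2 -> forall i, Q i.
Proof.
move=> q0 q1 q2 [[|[|[|//]]] i3].
- by rewrite (_ : Ordinal i3 = 0)//; exact: val_inj.
- by rewrite (_ : Ordinal i3 = 1)//; exact: val_inj.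
- by rewrite (_ : Ordinal i3 = 2)//; exact: val_inj.
Qed.

Lemma row3_eta x : x = row3 (x 0 0) (x 0 1) (x 0 2).
Proof.
by apply/matrixP => i j; rewrite ord1; elim/ord3P: j; rewrite row3E.
Qed.

Lemma sum3 (V : nmodType) (F : 'I_3 -> V) : \sum_(i < 3) F i = F 0 + F 1 + F 2.
Proof.
rewrite !big_ord_recl big_ord0 addr0 addrA.
by congr (F _ + F _ + F _); exact: val_inj.
Qed.

Lemma divergenceE (v : 'rV[R]_3 -> 'rV[R]_3) x : divergence v x =
  partial 0 (component v 0) x + partial 1 (component v 1) x + partial 2 (component v 2) x.
Proof. exact: sum3. Qed.

Lemma laplacianE (f : 'rV[R]_3 -> R) x : laplacian f x =
  partial 0 (partial 0 f) x + partial 1 (partial 1 f) x + partial 2 (partial 2 f) x.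
Proof. exact: sum3. Qed.

Lemma advectionE (v : 'rV[R]_3 -> 'rV[R]_3) i x : advection v i x =
  component v 0 x * partial 0 (component v i) x + component v 1 x * partial 1 (component v i) x +
  component v 2 x * partial 2 (component v i) x.
Proof. exact: sum3. Qed.

Lemma row3_delta (a b c : R) :
  row3 a b c = a *: delta_mx 0 0 + b *: delta_mx 0 1 + c *: delta_mx 0 2.
Proof.
apply/matrixP => i j; rewrite ord1; elim/ord3P: j; rewrite row3E !mxE /= ?mulr1 ?mulr0 ?addr0 ?add0r//.
Qed.

Lemma cvg_row3 (T : Type) (F : set_system T) (FF : Filter F) (f g k : T -> R) (a b c : R) :
  f t @[t --> F] --> a -> g t @[t --> F] --> b -> k t @[t --> F] --> c ->
  row3 (f t) (g t) (k t) @[t --> F] --> row3 a b c.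
Proof.
move=> fa gb kc; rewrite row3_delta.
rewrite (_ : (fun t => row3 _ _ _) = (fun t => f t *: (delta_mx 0 0 : 'rV[R]_3) +
   g t *: (delta_mx 0 1 : 'rV[R]_3) + k t *: (delta_mx 0 2 : 'rV[R]_3))); last first.
  by apply/funext => t; rewrite row3_delta.
by apply: cvgD; [apply: cvgD|]; exact: cvgZr_tmp.
Qed.

Lemma coord_cont (i : 'I_3) : continuous (fun x : 'rV[R]_3 => x 0 i).
Proof. exact: coord_continuous. Qed.

Lemma rho_continuous : continuous (rho : 'rV[R]_3 -> R).
Proof.
move=> x.
have q : (y : 'rV[R]_3) 0 0 * y 0 0 + y 0 1 * y 0 1 @[y --> x] --> x 0 0 * x 0 0 + x 0 1 * x 0 1.
  have c0 := @coord_cont 0 x; have c1 := @coord_cont 1 x.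
  exact: (@cvgD R R^o _ _ _ _ _ _ _ (@cvgM R _ _ _ _ _ _ _ c0 c0) (@cvgM R _ _ _ _ _ _ _ c1 c1)).
exact: (cvg_comp _ _ q (@sqrt_continuous R _)).
Qed.

Lemma rho_ge0 x : 0 <= rho x. Proof. exact: sqrtr_ge0. Qed.

Definition open_channel alpha : set 'rV[R]_3 := [set x : 'rV[R]_3 | `|x 0 2| < channel alpha (rho x)].

Lemma open_channel_open alpha : 0 <= alpha -> open (open_channel alpha).
Proof.
move=> a0; apply: open_ltr_fun.
  move=> x; apply: (@continuous_comp _ _ _ (fun x : 'rV[R]_3 => x 0 2) Num.norm).
    exact: coord_cont.
  exact: norm_continuous.
move=> x; apply: (@continuous_comp _ _ _ (@rho R)); first exact: rho_continuous.
by have [cc _ _] := channel_profile a0; exact: cc.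
Qed.

Lemma open_channel_Omega alpha : open_channel alpha `<=` Omega alpha.
Proof. by move=> x /= /ltW. Qed.

Lemma open_channel_interior alpha : 0 <= alpha ->
  open_channel alpha `<=` interior (Omega alpha).
Proof.
move=> a0 x Wx; apply: (filterS (@open_channel_Omega alpha)).
by apply: open_nbhs_nbhs; split=> //; exact: open_channel_open.
Qed.

(** Stretching the vertical coordinate by a factor above 1 leaves the channel. *)
Lemma channel_wall_frontier alpha x : 0 <= alpha -> `|x 0 2| = channel alpha (rho x) ->
  frontier (Omega alpha) x.
Proof.
move=> a0 xh; split.
  by apply: subset_closure; rewrite /Omega /= xh lexx.
move=> ix; pose y t := row3 (x 0 0) (x 0 1) (x 0 2 * (1 + t)).
have y0 : y t @[t --> (0 : R)] --> x.
  rewrite [X in _ --> X]row3_eta; apply: cvg_row3; [exact: cvg_cst|exact: cvg_cst|].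
  rewrite -[X in _ --> X]mulr1; apply: cvgMl_tmp; rewrite -[X in _ --> X]addr0.
  by apply: cvgD; [exact: cvg_cst|exact: cvg_id].
have := y0 _ ix => /nbhs_ballP[e /= e0] /(_ (e / 2)).
have e20 : 0 < e / 2 by rewrite divr_gt0.
rewrite /ball /= sub0r normrN gtr0_norm// => /(_ _)/[!ltr_pdivrMr]// => H.
have : Omega alpha (y (e / 2)) by apply: H; rewrite // ltr_pMr// ltr1n.
rewrite /Omega /= /y row3E /rho !row3E -/(rho x) normrM xh -/(channel alpha (rho x)).
have [_ _ /(_ (rho x)) h1] := channel_profile a0.
rewrite gtr0_norm ?addr_gt0// leNgt => /negP; apply.
by rewrite ltr_pMr ?(lt_le_trans ltr01)// ltrDl.
Qed.

End cylinder.

(** * Restriction to the meridian half-plane *)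

Lemma within_continuous_comp (T U V : topologicalType) (A : set T) (B : set U)
    (f : T -> U) (g : U -> V) :
  continuous f -> (forall x, A x -> B (f x)) -> {within B, continuous g} ->
  {within A, continuous (g \o f)}.
Proof.
move=> cf AB /subspace_continuousP cg; apply/subspace_continuousP => x Ax.
move=> W /(cg _ (AB _ Ax)) H.
have := cf x _ H; rewrite /nbhs /= /within /= => H'.
apply: filterS H' => q Hq Aq; apply: Hq; exact: AB.
Qed.

Section meridian_jets.
Context {R : realType}.
Variables (alpha : R) (alpha0 : 0 <= alpha).
Local Notation h := (channel alpha).

Lemma is_derive_along (F : 'rV[R]_3 -> R) (X : R -> 'rV[R]_3) (d : 'rV[R]_3) (t : R) :
  (forall k : R, X (k + t) = k *: d + X t) -> derivable F (X t) d ->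
  is_derive t 1 (F \o X) ('D_d F (X t)).
Proof.
move=> Xd dF.
have E : (fun k : R => k^-1 *: ((F \o X) (k *: 1 + t) - (F \o X) t)) =
    (fun k : R => k^-1 *: ((F \o shift (X t)) (k *: d) - F (X t))).
  by apply/funext => k; rewrite /= -Xd [k *: 1]mulr1.
by split; rewrite /derivable /derive E.
Qed.

Lemma rho_meridian (r z : R) : 0 <= r -> rho (row3 r 0 z) = r.
Proof. by move=> r0; rewrite /rho !row3E expr0n addr0 sqrtr_sqr ger0_norm. Qed.

Lemma meridian_open (r z : R) : 0 < r -> `|z| < h r -> open_channel alpha (row3 r 0 z).
Proof. by move=> r0 zr; rewrite /open_channel /= row3E rho_meridian// ltW. Qed.

Lemma meridian_Omega (r z : R) : 0 <= r -> `|z| <= h r -> Omega alpha (row3 r 0 z).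
Proof. by move=> r0 zr; rewrite /Omega /= row3E rho_meridian. Qed.

Lemma shift_r (r z k : R) : row3 (k + r) 0 z = k *: delta_mx 0 0 + row3 r 0 z.
Proof. by rewrite !row3_delta scalerDl -!addrA. Qed.

Lemma shift_y (x y z k : R) : row3 x (k + y) z = k *: delta_mx 0 1 + row3 x y z.
Proof. by rewrite !row3_delta scalerDl -!addrA addrCA. Qed.

Lemma shift_z (x y z k : R) : row3 x y (k + z) = k *: delta_mx 0 2 + row3 x y z.
Proof. by rewrite !row3_delta scalerDl addrCA. Qed.

Variables (F : 'rV[R]_3 -> R) (sF : smooth (Omega alpha) F).

(** The half-plane x_2 = 0, x_1 = r > 0 meets every orbit of the rotations about the axis,
    so an axially symmetric field is determined by its values there. *)
Definition meridian_jet : jet :=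
  Jet (fun r z => F (row3 r 0 z))
      (fun r z => partials [:: 0] F (row3 r 0 z)) (fun r z => partials [:: 2] F (row3 r 0 z))
      (fun r z => partials [:: 0; 0] F (row3 r 0 z)) (fun r z => partials [:: 2; 2] F (row3 r 0 z)).

Lemma partials_derivable s (i : 'I_3) x : open_channel alpha x ->
  derivable (partials s F) x (delta_mx 0 i).
Proof. by move=> Wx; case: sF => _ H _; apply: H; exact: open_channel_interior. Qed.

Lemma partials_der_r s : der_r h (fun r z => partials s F (row3 r 0 z))
  (fun r z => partials (0 :: s) F (row3 r 0 z)).
Proof.
move=> r z r0 zr.
apply: (@is_derive_along (partials s F) (fun t => row3 t 0 z)); first by move=> k; exact: shift_r.
by apply: partials_derivable; exact: meridian_open.
Qed.

Lemma partials_der_z s : der_z h (fun r z => partials s F (row3 r 0 z))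
  (fun r z => partials (2 :: s) F (row3 r 0 z)).
Proof.
move=> r z r0 zr.
apply: (@is_derive_along (partials s F) (fun t => row3 r 0 t)); first by move=> k; exact: shift_z.
by apply: partials_derivable; exact: meridian_open.
Qed.

Lemma partials_continuous s (x : 'rV[R]_3) : interior (Omega alpha) x ->
  {for x, continuous (partials s F : 'rV[R]_3 -> R)}.
Proof.
move=> Wx; case: sF => _ _ /(_ s)[g [/subspace_continuousP cg gE]].
have ix : \forall y \near x, interior (Omega alpha) y.
  by apply: open_nbhs_nbhs; split=> //; exact: open_interior.
suff : partials s F y @[y --> x] --> partials s F x by [].
rewrite -(gE _ Wx).
have cx : g y @[y --> x] --> g x.
  by have := cg _ (interior_subset Wx); rewrite within_interior.
have FF : Filter (nbhs x) by exact: nbhs_filter.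
have e : \forall y \near x, g y = partials s F y := @filterS _ _ FF _ _ gE ix.
exact: cvg_trans (near_eq_cvg e) cx.
Qed.

Lemma within_meridian (g : 'rV[R]_3 -> R) (A : set (R * R)) :
  {within Omega alpha, continuous g} ->
  (forall p, A p -> 0 <= p.1 /\ `|p.2| <= h p.1) ->
  {within A, continuous (fun p => g (row3 p.1 0 p.2))}.
Proof.
move=> cg Ap.
apply: (@within_continuous_comp _ _ _ A _ (fun p => row3 p.1 0 p.2) _ _ _ cg).
  by move=> p; apply: cvg_row3; [exact: cvg_fst|exact: cvg_cst|exact: cvg_snd].
by move=> p /Ap[p1 p2]; exact: meridian_Omega.
Qed.

(** The continuous extension up to the boundary is bounded on the trace of the channel
    on 0 <= r <= S, a compact set. *)
Lemma partials_tame s : tame h (fun r z => partials s F (row3 r 0 z)).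
Proof.
split=> [r z r0 zr|S].
  have m : row3 q.1 0 q.2 @[q --> (r, z)] --> row3 r 0 z.
    by apply: cvg_row3; [exact: cvg_fst|exact: cvg_cst|exact: cvg_snd].
  apply: (cvg_comp _ _ m); apply: partials_continuous.
  exact: open_channel_interior alpha0 _ (meridian_open r0 zr).
have [ch mh h1] := channel_profile alpha0.
case: sF => _ _ /(_ s)[g [cg gE]].
pose A := [set p : R * R | [/\ 0 <= p.1, p.1 <= S & `|p.2| <= h p.1]].
have cA : compact A.
  apply: (@subclosed_compact _ A (`[0, S] `*` `[- h S, h S])).
  - have -> : A = [set p : R * R | 0 <= p.1] `&` [set p | p.1 <= S] `&`
       (~` [set p | h p.1 < `|p.2|]).
      apply/seteqP; split=> p /=; first by move=> [? ? ?]; do !split=> //; apply/negP; rewrite -leNgt.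
      by move=> [[? ?] /negP]; rewrite -leNgt.
    apply: closedI; [apply: closedI|].
    + by apply: (closed_comp (f := fst)) (@closed_ge R 0) => p _; exact: cvg_fst.
    + by apply: (closed_comp (f := fst)) (@closed_le R S) => p _; exact: cvg_fst.
    + apply: open_closedC; apply: open_ltr_fun; first exact: continuous_fst2.
      by apply: continuous_snd2; exact: norm_continuous.
  - by apply: compact_setX; exact: segment_compact.
  - move=> [r z] [/= r0 rS zr]; rewrite !in_itv /= r0 rS; split=> //.
    by rewrite -ler_norml (le_trans zr)// mh.
have cgA := within_meridian cg (A := A) (fun p (H : A p) => let: And3 a _ b := H in conj a b).
have [C [_ HC]] := compact_bounded (continuous_compact cgA cA).
exists (C + 1) => r z /andP[r0 rS] zr; rewrite -gE; last first.
  exact: open_channel_interior alpha0 _ (meridian_open r0 zr).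
by apply: (HC (C + 1)); [rewrite ltrDl|exists (r, z) => //; split=> /=; rewrite ltW].
Qed.

Lemma meridian_jet_on : jet_on h meridian_jet.
Proof.
split.
- exact: (partials_tame [::]).
- exact: (partials_tame [:: 0]).
- exact: (partials_tame [:: 2]).
- exact: (partials_tame [:: 0; 0]).
- exact: (partials_tame [:: 2; 2]).
- exact: (partials_der_r [::]).
- exact: (partials_der_z [::]).
- exact: (partials_der_r [:: 0]).
- exact: (partials_der_z [:: 2]).
Qed.

End meridian_jets.

Section noslip.
Context {R : realType}.
Variables (alpha : R) (alpha0 : 0 <= alpha).
Local Notation h := (channel alpha).
Variables (F : 'rV[R]_3 -> R) (sF : smooth (Omega alpha) F).
Hypothesis F0 : forall x, frontier (Omega alpha) x -> F x = 0.

Lemma meridian_wall0 (r z : R) : 0 <= r -> `|z| = h r -> F (row3 r 0 z) = 0.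
Proof.
by move=> r0 zr; apply: F0; apply: channel_wall_frontier => //; rewrite row3E rho_meridian.
Qed.

(** Mean value theorem between a point and the nearest wall. *)
Lemma meridian_wall_vanishing : wall_vanishing h (fun r z => F (row3 r 0 z)).
Proof.
move=> S; have [C HC] := (partials_tame alpha0 sF [:: 2]).2 S.
exists C => r z rS zr; have /andP[r0 _] := rS.
have cF (u w : R) : - h r <= u -> w <= h r ->
    {within `[u, w], continuous (fun t => F (row3 r 0 t))}.
  move=> hu hw; case: sF => cF _ _.
  apply: (@within_continuous_comp _ _ _ `[u, w]%classic _ (fun t => row3 r 0 t) _ _ _ cF).
    by move=> t; apply: cvg_row3; [exact: cvg_cst|exact: cvg_cst|exact: cvg_id].
  move=> t /=; rewrite in_itv /= => /andP[ut tw]; apply: meridian_Omega; first exact: ltW.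
  by rewrite ler_norml (le_trans hu) ?(le_trans tw).
have dF (t : R) : `|t| < h r ->
    is_derive t 1 (fun t => F (row3 r 0 t)) (partials [:: 2] F (row3 r 0 t)).
  by move=> tr; exact: (partials_der_z alpha0 sF [::]).
have bound (u w : R) : - h r <= u -> u < w -> w <= h r ->
    `|F (row3 r 0 w) - F (row3 r 0 u)| <= C * (w - u).
  move=> hu uw hw.
  have it t : t \in `]u, w[ -> `|t| < h r.
    by rewrite in_itv /= ltr_norml => /andP[ut tw]; rewrite (le_lt_trans hu) ?(lt_le_trans tw).
  have [t /it tr ->] := @MVT R _ _ u w uw (fun t H => dF t (it t H)) (cF u w hu hw).
  rewrite normrM (gtr0_norm (_ : 0 < w - u)) ?subr_gt0// ler_wpM2r ?subr_ge0 ?(ltW uw)//.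
  exact: HC.
have hr0 : 0 < h r := le_lt_trans (normr_ge0 z) zr.
have [e0 e1] : F (row3 r 0 (h r)) = 0 /\ F (row3 r 0 (- h r)) = 0.
  by split; apply: meridian_wall0; rewrite ?normrN ?gtr0_norm// ltW.
move: zr; rewrite ltr_norml => /andP[z1 z2].
have [z0|z0] := leP 0 z.
  by rewrite (ger0_norm z0); have := bound _ _ (ltW z1) z2 (lexx _); rewrite e0 sub0r normrN.
by rewrite (ltr0_norm z0); have := bound _ _ (lexx _) z1 (ltW z2); rewrite e1 subr0 !opprK [z + _]addrC.
Qed.

End noslip.

(** * Derivatives across the meridian half-plane *)

(** The hypotheses of this lemma and of the next two are the Cartesian equations at
    x_2 = 0 after the substitution of [azimuthal_partials]. *)
Lemma momentum_r_scalar (F : fieldType) (A B C a1 a3 P1 a11 a33 r : F) :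
  A * a1 + B * - (B / r) + C * a3 + P1 - (a11 + (a1 / r - A / r ^+ 2) + a33) = 0 ->
  A * a1 + C * a3 - B ^+ 2 / r + P1 = a11 + a33 + a1 / r - A / r ^+ 2.
Proof. by move=> e; apply/eqP; rewrite -subr_eq0 -e; apply/eqP; ring. Qed.

Lemma momentum_th_scalar (F : fieldType) (A B C b1 b3 b11 b33 r : F) :
  A * b1 + B * (A / r) + C * b3 + 0 - (b11 + (b1 / r - B / r ^+ 2) + b33) = 0 ->
  A * b1 + A * B / r + C * b3 = b11 + b33 + b1 / r - B / r ^+ 2.
Proof. by move=> e; apply/eqP; rewrite -subr_eq0 -e; apply/eqP; ring. Qed.

Lemma momentum_z_scalar (F : fieldType) (A B C c1 c3 P3 c11 c33 r : F) :
  A * c1 + B * 0 + C * c3 + P3 - (c11 + c1 / r + c33) = 0 ->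
  A * c1 + C * c3 + P3 = c11 + c33 + c1 / r.
Proof. by move=> e; apply/eqP; rewrite -subr_eq0 -e; apply/eqP; ring. Qed.

Lemma rotation_scalar (F : fieldType) (a b x y d : F) : d != 0 -> x ^+ 2 + y ^+ 2 = d ^+ 2 ->
  (a * (x / d) - b * (y / d)) ^+ 2 + (b * (x / d) + a * (y / d)) ^+ 2 = a ^+ 2 + b ^+ 2.
Proof.
move=> d0 e; transitivity ((a ^+ 2 + b ^+ 2) * ((x ^+ 2 + y ^+ 2) / d ^+ 2)); first by field.
by rewrite e divff ?mulr1// expf_neq0.
Qed.

Section off_meridian.
Context {R : realType}.
Implicit Types (f g : R -> R) (t a b : R).

Lemma der1D f g t a b : is_derive t 1 f a -> is_derive t 1 g b ->
  is_derive t 1 (fun s => f s + g s) (a + b).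
Proof. by move=> df dg; exact: is_deriveD. Qed.

Lemma der1M f g t a b : is_derive t 1 f a -> is_derive t 1 g b ->
  is_derive t 1 (fun s => f s * g s) (a * g t + f t * b).
Proof.
move=> df dg; have H := is_deriveM df dg.
by apply: is_derive_eq H _; rewrite /GRing.scale /=; ring.
Qed.

Lemma der1C (k : R) t : is_derive t 1 (fun=> k) (0 : R).
Proof. exact: is_derive_cst. Qed.

Lemma der1I t : is_derive t 1 (fun s : R => s) (1 : R).
Proof. exact: is_derive_id. Qed.

Lemma der1V f t a : f t != 0 -> is_derive t 1 f a ->
  is_derive t 1 (fun s => (f s)^-1) (- a / f t ^+ 2).
Proof.
move=> f0 df; have H := is_deriveV f0 df.
by apply: is_derive_eq H _; rewrite /GRing.scale /=; ring.
Qed.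

Lemma der1_comp f g t a b : is_derive (g t) 1 f a -> is_derive t 1 g b ->
  is_derive t 1 (fun s => f (g s)) (a * b).
Proof. by move=> df dg; exact: (is_derive1_comp df dg). Qed.

Lemma der1_quotient f t a : t != 0 -> is_derive t 1 f a ->
  is_derive t 1 (fun s => f s / s) (a / t - f t / t ^+ 2).
Proof.
move=> s0 du; have H := der1M du (der1V s0 (der1I t)).
by apply: is_derive_eq H _; field.
Qed.

Lemma radial_quotient (U U' U'' : R -> R) (r : R) : 0 < r ->
  (forall s : R, r <= s -> is_derive s 1 U (U' s)) ->
  (forall s : R, r <= s -> is_derive s 1 U' (U'' s)) ->
  (forall s : R, r <= s -> is_derive s 1 (fun t => U t / t) (U' s / s - U s / s ^+ 2)) /\
  (forall s : R, r <= s -> is_derive s 1 (fun t => U' t / t - U t / t ^+ 2)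
     (U'' s / s - 2 * (U' s / s ^+ 2) + 2 * (U s / s ^+ 3))).
Proof.
move=> r0 dU dU'; split=> s rs; have s0 : s != 0 by rewrite gt_eqF// (lt_le_trans r0).
  exact: der1_quotient (dU _ rs).
have -> : (fun t => U' t / t - U t / t ^+ 2) =
    (fun t => U' t / t + - ((U t / t) / t)).
  by apply/funext => t; rewrite expr2 invfM mulrA.
have H := der1D (der1_quotient s0 (dU' _ rs)) (is_deriveN (der1_quotient s0 (der1_quotient s0 (dU _ rs)))).
by apply: is_derive_eq H _; field.
Qed.

(** The radius along the line x_1 = r, x_2 = t. *)
Definition dist (r : R) t : R := Num.sqrt (r * r + t * t).

Lemma dist_ge (r : R) t : 0 < r -> r <= dist r t.
Proof.
move=> r0; rewrite -[leLHS]ger0_norm ?(ltW r0)// -sqrtr_sqr ler_sqrt.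
  by rewrite expr2 lerDl -expr2 sqr_ge0.
by rewrite addr_ge0// -expr2 sqr_ge0.
Qed.

Lemma dist0 (r : R) : 0 < r -> dist r 0 = r.
Proof. by move=> r0; rewrite /dist mul0r addr0 -expr2 sqrtr_sqr gtr0_norm. Qed.

Lemma der1_dist (r : R) t : 0 < r -> is_derive t 1 (dist r) (t / dist r t).
Proof.
move=> r0.
have p : 0 < r * r + t * t by rewrite ltr_pwDl ?mulr_gt0// -expr2 sqr_ge0.
have H := @der1_comp Num.sqrt (fun t => r * r + t * t) t _ _ (is_derive1_sqrt p) (der1D (der1C (r * r) t) (der1M (der1I t) (der1I t))).
apply: is_derive_eq H _; rewrite -/(dist r t).
have d0 : dist r t != 0 by rewrite gt_eqF// (lt_le_trans r0)// dist_ge.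
by move: d0; generalize (dist r t) => d d0; field.
Qed.

(** On the line x_1 = r, x_2 = t every component of an axially symmetric field has the
    form r A(rho) + t B(rho) with rho = sqrt (r^2 + t^2). *)
Lemma chord_derivative (A A' B B' : R -> R) (r : R) t : 0 < r ->
  (forall s : R, r <= s -> is_derive s 1 A (A' s)) ->
  (forall s : R, r <= s -> is_derive s 1 B (B' s)) ->
  is_derive t 1 (fun s => r * A (dist r s) + s * B (dist r s))
    (r * (A' (dist r t) * (t * (dist r t)^-1)) +
       (B (dist r t) + t * (B' (dist r t) * (t * (dist r t)^-1)))).
Proof.
move=> r0 dA dB.
have H := der1D (der1M (der1C r t) (@der1_comp _ (dist r) _ _ _ (dA _ (dist_ge t r0)) (der1_dist t r0)))
  (der1M (der1I t) (@der1_comp _ (dist r) _ _ _ (dB _ (dist_ge t r0)) (der1_dist t r0))).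
by apply: is_derive_eq H _; ring.
Qed.

Lemma chord_derivative2 (A' A'' B B' B'' : R -> R) (r : R) : 0 < r ->
  (forall s : R, r <= s -> is_derive s 1 A' (A'' s)) ->
  (forall s : R, r <= s -> is_derive s 1 B (B' s)) ->
  (forall s : R, r <= s -> is_derive s 1 B' (B'' s)) ->
  is_derive (0 : R) 1 (fun t => r * (A' (dist r t) * (t * (dist r t)^-1)) +
       (B (dist r t) + t * (B' (dist r t) * (t * (dist r t)^-1)))) (A' r).
Proof.
move=> r0 dA dB dB'.
have ge := dist_ge 0 r0; have dd := der1_dist 0 r0.
have n0 : dist r 0 != 0 by rewrite dist0// gt_eqF.
have dq := der1M (der1I 0) (der1V n0 dd).
have H := der1D (der1M (der1C r 0) (der1M (@der1_comp _ (dist r) _ _ _ (dA _ ge) dd) dq))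
  (der1D (@der1_comp _ (dist r) _ _ _ (dB _ ge) dd) (der1M (der1I 0) (der1M (@der1_comp _ (dist r) _ _ _ (dB' _ ge) dd) dq))).
apply: is_derive_eq H _; rewrite /= dist0//.
by move: r0 => /gt_eqF/negbT r0; field.
Qed.

End off_meridian.

Section azimuthal.
Context {R : realType}.
Variables (alpha : R) (alpha0 : 0 <= alpha).
Local Notation h := (channel alpha).

Lemma rho_chord (r t z : R) : rho (row3 r t z) = dist r t.
Proof. by rewrite /rho !row3E. Qed.

Lemma chord_open (r t z : R) : 0 < r -> `|z| < h r -> open_channel alpha (row3 r t z).
Proof.
move=> r0 zr; rewrite /open_channel /= row3E rho_chord (lt_le_trans zr)//.
by have [_ mh _] := channel_profile alpha0; apply: mh; exact: dist_ge.
Qed.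

(** The source of the curvature terms v^r/r, v^theta/r, ... of the equations in
    cylindrical coordinates. *)
Lemma azimuthal_partials (F : 'rV[R]_3 -> R) (A A' A'' B B' B'' : R -> R) (r z : R) :
  smooth (Omega alpha) F -> 0 < r -> `|z| < h r ->
  (forall s : R, r <= s -> is_derive s 1 A (A' s)) ->
  (forall s : R, r <= s -> is_derive s 1 A' (A'' s)) ->
  (forall s : R, r <= s -> is_derive s 1 B (B' s)) ->
  (forall s : R, r <= s -> is_derive s 1 B' (B'' s)) ->
  (forall t, F (row3 r t z) = r * A (dist r t) + t * B (dist r t)) ->
  partial 1 F (row3 r 0 z) = B r /\ partial 1 (partial 1 F) (row3 r 0 z) = A' r.
Proof.
move=> sF r0 zr dA dA' dB dB' FE.
have line s (t : R) : is_derive t 1 (fun t => partials s F (row3 r t z))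
    (partials (1 :: s) F (row3 r t z)).
  apply: (@is_derive_along _ (partials s F) (fun t => row3 r t z)).
    by move=> k; exact: shift_y.
  by apply: (partials_derivable alpha0 sF); exact: chord_open.
have E1 t : partial 1 F (row3 r t z) = r * (A' (dist r t) * (t * (dist r t)^-1)) +
       (B (dist r t) + t * (B' (dist r t) * (t * (dist r t)^-1))).
  have H := chord_derivative t r0 dA dB.
  have L := line [::] t.
  rewrite -(@derive_val _ _ _ _ _ _ _ H) -[LHS](@derive_val _ _ _ _ _ _ _ L).
  by congr ('D_1 _ t); apply/funext => u; exact: FE.
split; first by rewrite E1 (dist0 r0); ring.
have H := chord_derivative2 r0 dA' dB dB'.
have L := line [:: 1] 0.
rewrite -(@derive_val _ _ _ _ _ _ _ H) -[LHS](@derive_val _ _ _ _ _ _ _ L).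
by congr ('D_1 _ (0 : R)); apply/funext => u; exact: E1.
Qed.

End azimuthal.

(** * Comparison of planar and spatial integrals *)

Section polar.
Context {R : realType}.
Local Notation mu := (@lebesgue_measure R).

Lemma dist_continuous (x : R) : 0 < x -> continuous (dist x).
Proof. by move=> x0 y; apply: is_derive_continuous (der1_dist y x0). Qed.

Lemma dist_lt (x y z : R) : 0 < x -> 0 <= y -> y < z -> dist x y < dist x z.
Proof.
move=> x0 y0 yz; have z0 := le_lt_trans y0 yz.
have p (t : R) : 0 < x * x + t * t by rewrite ltr_pwDl ?mulr_gt0// -expr2 sqr_ge0.
by rewrite /dist ltr_sqrt// ltrD2l -!expr2 ltr_pXn2r// nnegrE// ltW.
Qed.

Lemma dist_sqrt (x m : R) : 0 <= m -> x * x <= m * m -> dist x (Num.sqrt (m * m - x * x)) = m.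
Proof.
move=> m0 xm; rewrite /dist -[X in _ + X]expr2 sqr_sqrtr ?subr_ge0// addrC subrK.
by rewrite -expr2 sqrtr_sqr ger0_norm.
Qed.

(** Along the line x_1 = x the radius grows more slowly than y, d(dist x y) =
    (y / dist x y) dy <= dy, so dropping the Jacobian gives an inequality. *)
Lemma radial_substitution (k : R -> R) (x m S C : R) : 0 < x -> x <= m -> m < S ->
  (forall r, m < r -> {for r, continuous k}) ->
  (forall r, m < r < S + 1 -> 0 <= k r <= C) ->
  (\int[mu]_(r in `]m, S[) (k r)%:E <=
  \int[mu]_(y in `]Num.sqrt (m * m - x * x), Num.sqrt (S * S - x * x)[) (k (dist x y))%:E)%E.
Proof.
move=> x0 xm mS ck kC.
have m0 : 0 < m := lt_le_trans x0 xm.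
have S0 : 0 < S := lt_trans m0 mS.
have SS : m < S < S + 1 by rewrite mS ltrDl ltr01.
have xxmm : x * x <= m * m by rewrite -!expr2 ler_pXn2r ?nnegrE ?(ltW x0) ?(ltW m0).
have mmSS : m * m < S * S by rewrite -!expr2 ltr_pXn2r ?nnegrE ?(ltW S0) ?(ltW m0).
have xxSS := le_lt_trans xxmm mmSS.
set Y1 := Num.sqrt (m * m - x * x); set Y2 := Num.sqrt (S * S - x * x).
have Y10 : 0 <= Y1 := sqrtr_ge0 _.
have Y12 : Y1 < Y2 by rewrite /Y1 /Y2 ltr_sqrt ?subr_gt0// ltrD2r.
have dY1 : dist x Y1 = m by apply: dist_sqrt => //; exact: ltW.
have dY2 : dist x Y2 = S by apply: dist_sqrt; exact: ltW.
have din (y : R) : Y1 < y <= Y2 -> m < dist x y <= S.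
  move=> /andP[y1 y2]; rewrite -[X in X < _]dY1 dist_lt//= -dY2.
  move: y2; rewrite le_eqVlt => /predU1P[->//|y2].
  by rewrite ltW// dist_lt// (le_trans Y10)// ltW.
have din' (y : R) : Y1 < y <= Y2 -> m < dist x y < S + 1.
  by move=> /din/andP[-> dS] /=; rewrite (le_lt_trans dS)// ltrDl ltr01.
have ck' (r : R) : m < r < S + 1 -> {for r, continuous k} by move=> /andP[/ck].
have kC' (r : R) : m < r < S + 1 -> `|k r| <= C by move=> /kC/andP[k0 kC']; rewrite ger0_norm.
have C0 : 0 <= C by have /kC/andP[k0 kC''] := SS; exact: le_trans kC''.
have ckd (y : R) : Y1 < y <= Y2 -> {for y, continuous (fun y => k (dist x y))}.
  move=> /din' yd; apply: (@continuous_comp _ _ _ (dist x) k); first exact: dist_continuous.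
  exact: ck'.
have q1 (y : R) : Y1 < y -> 0 <= y / dist x y <= 1.
  move=> y1; have y0 : 0 < y := le_lt_trans Y10 y1.
  have d0 : 0 < dist x y := lt_le_trans x0 (dist_ge y x0).
  rewrite divr_ge0 ?(ltW y0) ?(ltW d0)//= ler_pdivrMr// mul1r.
  rewrite -[leLHS](gtr0_norm y0) -sqrtr_sqr /dist ler_sqrt ?addr_ge0 -?expr2 ?sqr_ge0//.
  by rewrite lerDr sqr_ge0.
have cq (y : R) : {for y, continuous (fun y : R => y / dist x y)}.
  have d0 : dist x y != 0 by rewrite gt_eqF// (lt_le_trans x0)// dist_ge.
  exact: is_derive_continuous (der1M (der1I y) (der1V d0 (der1_dist y x0))).
pose Phi s := \int[mu]_(t in `]m, s[) k t.
have i0 : mu.-integrable `]m, S[ (EFin \o k).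
  apply: (@itv_integrable _ _ _ _ C) => r /andP[r1 r2]; [apply: ck'|apply: kC'];
  by rewrite r1 (lt_trans r2)// ltrDl ltr01.
have E12 : \int[mu]_(y in `]Y1, Y2[) (k (dist x y) * (y / dist x y)) = Phi S.
  rewrite -dY2; apply: (@itv_FTC_left _ _ (fun y => Phi (dist x y)) _ _ C) => //.
  - move=> y /din' yd.
    exact: (@der1_comp _ Phi (dist x) _ _ _ (itv_FTC1 yd ck' kC') (der1_dist y x0)).
  - by move=> y yy; apply: (@cvgM R _ _ _ (fun y => k (dist x y))); [exact: ckd|exact: cq].
  - move=> y yy; rewrite normrM -[leRHS]mulr1 ler_pM// ?kC' ?din'//.
    by have /andP[/q1/andP[q0 q1'] _] := yy; rewrite ger0_norm.
  - apply: (@cvg0_squeeze _ _ _ _ _ (fun y => C * (dist x y - m))).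
      near=> y.
      have yy : Y1 < y <= Y2.
        by apply/andP; split; near: y; [exact: nbhs_right_gt|exact: nbhs_right_le].
      have /andP[d1 d2] := din _ yy.
      have := @itv_Rintegral_lipschitz R k m S m (dist x y) C (lexx _) (ltW d1) d2.
      rewrite [X in _ - X](_ : _ = 0) ?subr0; last first.
        by rewrite set_itvoo0 ?lexx// Rintegral_set0.
      by apply=> t /andP[t1 t2]; [apply: ck'|apply: kC']; rewrite t1 (lt_trans t2)// ltrDl ltr01.
    have : C * (dist x y - m) @[y --> Y1] --> C * (dist x Y1 - m).
      apply: cvgMl_tmp; apply: cvgB; [exact: dist_continuous|exact: cvg_cst].
    by rewrite dY1 subrr mulr0; exact: cvg_at_right_filter.
have yy' (y : R) : Y1 < y < Y2 -> Y1 < y <= Y2 by move=> /andP[-> /ltW].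
have i1 : mu.-integrable `]Y1, Y2[ (EFin \o (fun y => k (dist x y) * (y / dist x y))).
  apply: (@itv_integrable _ _ _ _ C) => y /yy' yy.
    by apply: (@cvgM R _ _ _ (fun y => k (dist x y))); [exact: ckd|exact: cq].
  rewrite normrM -[leRHS]mulr1 ler_pM// ?kC' ?din'//.
  by have /andP[/q1/andP[q0 q1'] _] := yy; rewrite ger0_norm.
have i2 : mu.-integrable `]Y1, Y2[ (EFin \o (fun y => k (dist x y))).
  by apply: (@itv_integrable _ _ _ _ C) => y /yy' yy; [exact: ckd|apply: kC'; exact: din'].
have le12 : \int[mu]_(y in `]Y1, Y2[) (k (dist x y) * (y / dist x y)) <=
    \int[mu]_(y in `]Y1, Y2[) k (dist x y).
  apply: le_Rintegral => // y; rewrite /= in_itv /= => /yy' yy.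
  have /kC/andP[k0 _] := din' _ yy; have /andP[/q1/andP[_ q] _] := yy.
  by rewrite -[leRHS]mulr1 ler_wpM2l.
rewrite -(fineK (integrable_fin_num _ i2))// -(fineK (integrable_fin_num _ i0))// lee_fin.
move: le12; rewrite E12; exact.
Unshelve. all: by end_near. Qed.

Local Notation plane := (measurableTypeR R * measurableTypeR R)%type.

Lemma open_restrict_measurable (A : set (R * R)) (f : R * R -> R) : open A ->
  (forall p, A p -> {for p, continuous f}) ->
  @measurable_fun _ _ plane (\bar R) setT ((EFin \o f) \_ A).
Proof.
move=> oA cf; apply/(measurable_restrictT _ (open_measurable_plane oA)).
by apply/measurable_EFinP; exact: continuous_plane_measurable.
Qed.

Lemma restrict_ge0 (T : Type) (A : set T) (f : T -> R) : (forall x, A x -> 0 <= f x) ->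
  forall x, (0 <= ((EFin \o f) \_ A) x)%E.
Proof. by move=> f0 x; rewrite patchE; case: ifPn => // /set_mem/f0; rewrite lee_fin. Qed.

Lemma dist2_continuous : continuous (fun p : R * R => dist p.1 p.2).
Proof.
move=> p.
have q : q.1 * q.1 + q.2 * q.2 @[q --> p] --> p.1 * p.1 + p.2 * p.2.
  exact: (@cvgD R R^o _ _ _ _ _ _ _ (@cvgM R _ _ _ _ _ _ _ cvg_fst cvg_fst)
    (@cvgM R _ _ _ _ _ _ _ cvg_snd cvg_snd)).
exact: (cvg_comp _ _ q (@sqrt_continuous R _)).
Qed.

Definition shell (r0 S : R) : set (R * R) :=
  [set p : R * R | [/\ 0 < p.1, 0 < p.2 & r0 < dist p.1 p.2 < S]].

Lemma shell_open (r0 S : R) : open (shell r0 S).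
Proof.
rewrite /shell.
have c1 : continuous (fun p : R * R => p.1) by move=> p; exact: cvg_fst.
have c2 : continuous (fun p : R * R => p.2) by move=> p; exact: cvg_snd.
have -> : [set p : R * R | [/\ 0 < p.1, 0 < p.2 & r0 < dist p.1 p.2 < S]] =
  [set p : R * R | 0 < p.1] `&` [set p | 0 < p.2] `&` ([set p | r0 < dist p.1 p.2] `&`
    [set p | dist p.1 p.2 < S]).
  apply/seteqP; split=> p; first by move=> [? ? /andP[? ?]]; do !split.
  by move=> [[? ?] [? ?]]; split=> //; apply/andP.
have cd := dist2_continuous.
do 2 ?apply: openI; apply: open_ltr_fun => //; exact: cst_continuous.
Qed.

Lemma shell_section (x r0 S : R) : 0 < x -> 0 <= r0 -> Num.max x r0 < S ->
  let m := Num.max x r0 in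
  `]Num.sqrt (m * m - x * x), Num.sqrt (S * S - x * x)[%classic =
  [set y : R | 0 < y /\ r0 < dist x y < S].
Proof.
move=> x0 r00 mS m.
have xm : x <= m by rewrite le_max lexx.
have rm : r0 <= m by rewrite le_max lexx orbT.
have m0 : 0 < m := lt_le_trans x0 xm.
have S0 : 0 < S := lt_trans m0 mS.
have xxmm : x * x <= m * m by rewrite -!expr2 ler_pXn2r ?nnegrE ?(ltW x0) ?(ltW m0).
have mmSS : m * m < S * S by rewrite -!expr2 ltr_pXn2r ?nnegrE ?(ltW S0) ?(ltW m0).
set Y1 := Num.sqrt (m * m - x * x); set Y2 := Num.sqrt (S * S - x * x).
have Y10 : 0 <= Y1 := sqrtr_ge0 _.
have Y20 : 0 <= Y2 := sqrtr_ge0 _.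
have dY1 : dist x Y1 = m by apply: dist_sqrt => //; exact: ltW.
have dY2 : dist x Y2 = S by apply: dist_sqrt; [exact: ltW|rewrite (le_trans xxmm)// ltW].
have mono (u w : R) : 0 <= u -> u <= w -> dist x u <= dist x w.
  by move=> u0; rewrite le_eqVlt => /predU1P[->//|uw]; rewrite ltW// dist_lt.
apply/seteqP; split=> y /=; rewrite in_itv /=.
  move=> /andP[y1 y2]; have y0 := le_lt_trans Y10 y1; split=> //.
  by rewrite (le_lt_trans rm) -?[X in X < _]dY1 -?[X in _ < X]dY2 ?dist_lt// ltW.
move=> [y0 /andP[d1 d2]]; apply/andP; split; rewrite ltNge; apply/negP => yy.
  have : dist x y <= m by rewrite -dY1 mono// ltW.
  rewrite /m le_max leNgt [_ <= r0]leNgt d1 orbF => /negP; apply.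
  by rewrite -[X in X < _](dist0 x0) dist_lt.
by have := mono _ _ Y20 yy; rewrite dY2 leNgt d2.
Qed.

(** Polar coordinates as an inequality over a quadrant: [radial_substitution] is integrated
    over 0 < x < r, and this range of x restores the weight r. *)
Lemma polar_plane (k : R -> R) (r0 S C : R) : 0 <= r0 -> r0 < S ->
  (forall r, r0 < r -> {for r, continuous k}) ->
  (forall r, r0 < r < S + 1 -> 0 <= k r <= C) ->
  (\int[mu]_(r in `]r0, S[) (r * k r)%:E <=
   \int[mu]_x \int[mu]_y ((EFin \o (fun p : R * R => k (dist p.1 p.2))) \_ (shell r0 S)) (x, y))%E.
Proof.
move=> r00 r0S ck kC.
pose B := [set p : R * R | [/\ 0 < p.1, p.1 < p.2 & r0 < p.2 < S]].
have inS r : r0 < r < S -> r0 < r < S + 1.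
  by move=> /andP[-> rS]; rewrite (lt_trans rS)// ltrDl ltr01.
have oB : open B.
  have c1 : continuous (fun p : R * R => p.1) by move=> p; exact: cvg_fst.
  have c2 : continuous (fun p : R * R => p.2) by move=> p; exact: cvg_snd.
  have -> : B = [set p : R * R | 0 < p.1] `&` [set p | p.1 < p.2] `&` ([set p | r0 < p.2] `&`
      [set p | p.2 < S]).
    apply/seteqP; split=> p; first by move=> [? ? /andP[? ?]]; do !split.
    by move=> [[? ?] [? ?]]; split=> //; apply/andP.
  do 2 ?apply: openI; apply: open_ltr_fun => //; exact: cst_continuous.
pose w : plane -> \bar R := (EFin \o (fun p : R * R => k p.2)) \_ B.
have mw : measurable_fun setT w.
  apply: open_restrict_measurable oB _ => p [_ _ /andP[rp _]].
  by apply: (cvg_comp _ _ cvg_snd); exact: ck.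
have w0 p : (0 <= w p)%E.
  by apply: restrict_ge0 => q [_ _ /inS/kC/andP[]].
pose f : plane -> \bar R := (EFin \o (fun p : R * R => k (dist p.1 p.2))) \_ (shell r0 S).
have mf : measurable_fun setT f.
  apply: open_restrict_measurable; first exact: shell_open.
  move=> p [_ _ /andP[rp _]].
  by apply: (cvg_comp _ _ (@dist2_continuous p)); exact: ck.
have f0 p : (0 <= f p)%E.
  by apply: restrict_ge0 => q [_ _ /inS/kC/andP[]].
have -> : (\int[mu]_(r in `]r0, S[) (r * k r)%:E = \int[mu]_r \int[mu]_x w (x, r))%E.
  rewrite integral_mkcond; apply: eq_integral => r _; rewrite patchE.
  case: ifPn => [/set_mem /=|].
    rewrite in_itv /= => rS; have /andP[r1 _] := rS.
    transitivity (\int[mu]_(x in `]0%R, r[) (k r)%:E)%E.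
      by rewrite integral_cst//= lebesgue_measure_itv /= lte_fin (le_lt_trans r00)// sube0 -EFinM mulrC.
    rewrite integral_mkcond; apply: eq_integral => x _; rewrite /w !patchE.
    by congr (if _ then _ else _); apply/idP/idP => /set_mem H; apply: mem_set;
      move: H; rewrite /B /= in_itv /= ?rS; [move=> /andP[-> ->]|move=> [-> ->]].
  move=> rS; rewrite integral0_eq// => x _; rewrite /w patchE ifF//; apply: negbTE.
  apply: contra rS => /set_mem[_ _ rS]; apply: mem_set; by rewrite /= in_itv.
rewrite -(fubini_tonelli w mw w0); apply: ge0_le_integral => //.
- by move=> x _; exact: integral_ge0.
- exact: (measurable_fun_fubini_tonelli_F w mw w0).
- exact: (measurable_fun_fubini_tonelli_F f mf f0).
move=> x _; have [x0|x0] := leP x 0.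
  rewrite integral0_eq ?integral_ge0// => r _; rewrite /w patchE ifF//; apply: negbTE.
  by apply/negP => /set_mem[/= /(le_lt_trans x0)]; rewrite ltxx.
have [Sm|mS] := leP S (Num.max x r0).
  rewrite integral0_eq ?integral_ge0// => r _; rewrite /w patchE ifF//; apply: negbTE.
  apply/negP => /set_mem[/= _ xr /andP[rr rS]]; move: Sm; rewrite leNgt => /negP; apply.
  by rewrite gt_max (lt_trans xr)// (lt_trans rr).
set m := Num.max x r0 in mS.
have xm : x <= m by rewrite le_max lexx.
have rm : r0 <= m by rewrite le_max lexx orbT.
apply: (@le_trans _ _ (\int[mu]_(r in `]m, S[) (k r)%:E)%E).
  rewrite le_eqVlt; apply/orP; left; apply/eqP.
  rewrite [RHS]integral_mkcond; apply: eq_integral => r _; rewrite /w !patchE.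
  congr (if _ then _ else _); apply/idP/idP => /set_mem H; apply: mem_set; move: H;
    rewrite /B /= in_itv /= /m gt_max ?x0; first by move=> [_ -> /andP[-> ->]].
  by move=> /andP[/andP[-> ->] ->].
apply: le_trans (@radial_substitution k x m S C x0 xm mS _ _) _.
- by move=> r mr; apply: ck; exact: le_lt_trans mr.
- by move=> r /andP[mr rS]; apply: kC; rewrite rS (le_lt_trans rm).
rewrite le_eqVlt; apply/orP; left; apply/eqP.
rewrite integral_mkcond (shell_section x0 r00 mS); apply: eq_integral => y _.
rewrite /f !patchE; congr (if _ then _ else _).
by apply/idP/idP => /set_mem H; apply: mem_set; [split=> //; case: H|case: H].
Qed.

Lemma plane_sigma_finite : sigma_finite [set: plane] (mu \x mu)%E.
Proof.
exists (fun n : nat => `]- n%:R, n%:R[%classic `*` `]- n%:R, n%:R[%classic).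
  apply/seteqP; split=> // -[x y] _.
  have b0 : 0 <= `|x| + `|y| by rewrite addr_ge0.
  have bn := archi_boundP b0; set n := Num.bound _ in bn.
  exists n => //; split; rewrite /= in_itv /= -ltr_norml (le_lt_trans _ bn)// ?lerDl ?lerDr//.
move=> n; have m : measurable (`]- n%:R, n%:R[%classic `*` `]- n%:R, n%:R[%classic : set plane).
  exact: measurableX.
by split=> //; exact: box_finite m (@subset_refl _ _).
Qed.

(** Planar Lebesgue measure with its sigma-finite structure, in the form required to
    integrate over the third coordinate last. *)
Definition plane_measure : {sigma_finite_measure set plane -> \bar R} :=
  HB.pack_for {sigma_finite_measure set plane -> \bar R} (mu \x mu)%E
    (Measure_isSigmaFinite.Build _ _ _ (mu \x mu)%E plane_sigma_finite).

Lemma space_tonelli (f : plane * measurableTypeR R -> \bar R) : measurable_fun setT f -> (forall t, (0 <= f t)%E) ->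
  (\int[(mu \x mu) \x mu]_t f t = \int[mu]_z \int[mu \x mu]_p f (p, z))%E.
Proof. by move=> mf f0; exact: (@fubini_tonelli2 _ _ _ _ _ plane_measure mu f mf f0). Qed.

Local Notation space := (measurableTypeR R * measurableTypeR R * measurableTypeR R)%type.

Lemma open_restrict_measurable3 (A : set (R * R * R)) (f : R * R * R -> R) : open A ->
  (forall p, A p -> {for p, continuous f}) ->
  @measurable_fun _ _ space (\bar R) setT ((EFin \o f) \_ A).
Proof.
move=> oA cf; apply/(measurable_restrictT _ (open_measurable_space oA)).
by apply/measurable_EFinP; exact: continuous_space_measurable.
Qed.

Definition sector h (S : R) : set (R * R * R) :=
  [set t | [/\ 0 < t.1.1, 0 < t.1.2, dist t.1.1 t.1.2 < S & `|t.2| < h (dist t.1.1 t.1.2)]].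

Lemma dist3_continuous : continuous (fun t : R * R * R => dist t.1.1 t.1.2).
Proof.
move=> t; apply: (@continuous_comp _ _ _ (fun t : R * R * R => t.1)
  (fun p : R * R => dist p.1 p.2)); [exact: cvg_fst|exact: dist2_continuous].
Qed.

Lemma sector_open h S : profile h -> open (sector h S).
Proof.
move=> [ch _ _].
have c1 : continuous (fun t : R * R * R => t.1.1).
  move=> t; apply: (@continuous_comp _ _ _ (fun t : R * R * R => t.1) (fun p : R * R => p.1)).
    exact: cvg_fst.
  exact: cvg_fst.
have c2 : continuous (fun t : R * R * R => t.1.2).
  move=> t; apply: (@continuous_comp _ _ _ (fun t : R * R * R => t.1) (fun p : R * R => p.2)).
    exact: cvg_fst.
  exact: cvg_snd.
have c3 : continuous (fun t : R * R * R => `|t.2|).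
  move=> t; apply: (@continuous_comp _ _ _ (fun t : R * R * R => t.2) (fun s : R => `|s|)).
    exact: cvg_snd.
  exact: norm_continuous.
have -> : sector h S = [set t : R * R * R | 0 < t.1.1] `&` [set t | 0 < t.1.2] `&`
    ([set t | dist t.1.1 t.1.2 < S] `&` [set t | `|t.2| < h (dist t.1.1 t.1.2)]).
  apply/seteqP; split=> t; first by move=> [? ? ? ?]; do !split.
  by move=> [[? ?] [? ?]]; split.
do 2 ?apply: openI; apply: open_ltr_fun => //.
- exact: cst_continuous.
- exact: cst_continuous.
- exact: dist3_continuous.
- exact: cst_continuous.
- by move=> t; apply: (cvg_comp _ _ (@dist3_continuous t)); exact: ch.
Qed.

Lemma tame_sector_continuous h S k t : tame h k -> sector h S t ->
  {for t, continuous (fun t : R * R * R => k (dist t.1.1 t.1.2) t.2)}.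
Proof.
move=> [ck _] [t1 t2 tS th].
have d0 : 0 < dist t.1.1 t.1.2 := lt_le_trans t1 (dist_ge _ t1).
have pr : (dist u.1.1 u.1.2, u.2) @[u --> t] --> (dist t.1.1 t.1.2, t.2).
  exact: (cvg_pair (@dist3_continuous t) (@cvg_snd _ _ _ _ _)).
exact: (cvg_comp _ _ pr (ck _ _ d0 th)).
Qed.

Lemma le_of_eqs (x y x' y' : \bar R) : x = x' -> y = y' -> (x' <= y')%E -> (x <= y)%E.
Proof. by move=> -> ->. Qed.

Lemma polar_space h S k : profile h -> 0 < S -> tame h k ->
  (forall r z : R, 0 < r -> `|z| < h r -> 0 <= k r z) ->
  ((chan_int h S (fun r z => r * k r z))%:E <=
   \int[(mu \x mu) \x mu]_(t in sector h S) (k (dist t.1.1 t.1.2) t.2)%:E)%E.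
Proof.
move=> ph S0 tk k0.
pose f : space -> \bar R := (EFin \o (fun t : R * R * R => k (dist t.1.1 t.1.2) t.2)) \_ (sector h S).
pose D := dom h S (h S).
pose g : plane -> \bar R := (EFin \o (fun p : R * R => p.1 * k p.1 p.2)) \_ D.
have d0 (x y : R) : 0 < x -> 0 < dist x y by move=> x0; exact: lt_le_trans x0 (dist_ge _ x0).
have trk : tame h (fun r z => r * k r z).
  by refine (@tameM _ h (fun r _ => r) k _ tk); exact: tame_r.
have mf : measurable_fun setT f.
  apply: open_restrict_measurable3; first exact: sector_open.
  by move=> t; exact: tame_sector_continuous.
have f0 t : (0 <= f t)%E.
  by apply: restrict_ge0 => u [u1 u2 _ uh]; apply: k0 => //; exact: d0.
have mg : measurable_fun setT g.
  apply: open_restrict_measurable; first exact: dom_open.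
  by move=> [r z] [/= /andP[r0 rS] zr _]; exact: trk.1.
have g0 p : (0 <= g p)%E.
  by apply: restrict_ge0 => -[r z] [/= /andP[r0 rS] zr _]; rewrite mulr_ge0 ?(ltW r0)// k0.
have -> : ((chan_int h S (fun r z => (r * k r z)%R))%:E = \int[mu \x mu]_p g p)%E.
  rewrite -integral_mkcond /chan_int /int2 /Rintegral fineK//.
  by apply: integrable_fin_num; [exact: dom_measurable|exact: (@tame_dom_integrable R h S (h S) (fun r z => r * k r z) ph trk)].
have Eg : (\int[mu \x mu]_p g p = \int[mu]_z fubini_G mu g z)%E := fubini_tonelli2 g mg g0.
have Ef := space_tonelli mf f0.
have Es : (\int[(mu \x mu) \x mu]_(t in sector h S) (k (dist t.1.1 t.1.2) t.2)%:E =
    \int[(mu \x mu) \x mu]_t f t)%E by rewrite integral_mkcond.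
apply: (le_of_eqs Eg (etrans Es Ef)).
apply: ge0_le_integral => //.
- by move=> z _; exact: integral_ge0.
- exact: (measurable_fun_fubini_tonelli_G g mg g0).
- exact: (@measurable_fun_fubini_tonelli_G _ _ _ _ _ plane_measure f mf f0).
move=> z _; rewrite /fubini_G.
have [zS|Sz] := ltP `|z| (h S); last first.
  rewrite integral0_eq ?integral_ge0// => r _; rewrite /g patchE ifF//; apply: negbTE.
  apply/negP => /set_mem[/= /andP[_ rS] zr _].
  by case: ph => _ mh _; move: (lt_le_trans zr (mh _ _ (ltW rS))); rewrite ltNge Sz.
have zS' : z < h S := le_lt_trans (ler_norm z) zS.
have [r0 [/andP[r00 r0S] secE _ ab]] := dom_ysection ph S0 zS zS'.
have sec (r : R) : (r0 < r < S) = [&& 0 < r, r < S & `|z| < h r].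
  apply/idP/idP => [rS|/and3P[a1 a2 a3]].
    have : ysection (dom h S (h S)) z r by rewrite secE /= in_itv.
    by rewrite /ysection /= inE => -[/= /andP[-> ->] -> _].
  have : ysection (dom h S (h S)) z r by rewrite /ysection /= inE; split=> //=; rewrite a1.
  by rewrite secE /= in_itv.
have -> : (\int[mu]_r g (r, z) = \int[mu]_(r in `]r0, S[) (r * k r z)%:E)%E.
  rewrite [RHS]integral_mkcond; apply: eq_integral => r _; rewrite /g !patchE.
  congr (if _ then _ else _); apply/idP/idP => /set_mem H; apply: mem_set; move: H.
    by move=> [/= /andP[rp rS] zr _]; rewrite in_itv /= sec rp rS.
  by rewrite /= in_itv /= sec => /and3P[rp rS zr]; split=> //=; rewrite rp.
have [C kC] := tk.2 (S + 1).
apply: le_trans (@polar_plane (k ^~ z) r0 S C r00 r0S _ _) _.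
- by move=> r rr; apply: (tame_continuous_r tk); [exact: le_lt_trans rr|exact: ab].
- move=> r /andP[rr rS]; have rp : 0 < r := le_lt_trans r00 rr.
  by rewrite k0 ?ab//= (le_trans (ler_norm _))// kC ?rp ?ab.
pose fz : plane -> \bar R := (EFin \o (fun p : R * R => k (dist p.1 p.2) z)) \_ (shell r0 S).
have fzE p : fz p = f (p, z).
  rewrite /fz /f !patchE; congr (if _ then _ else _).
  apply/idP/idP => /set_mem H; apply: mem_set; move: H.
    by move=> [p1 p2]; rewrite sec => /and3P[_ dS dh]; split.
  by move=> [/= p1 p2 dS dh]; split=> //; rewrite sec d0// dS.
have mfz : measurable_fun setT fz.
  apply: open_restrict_measurable; first exact: shell_open.
  move=> p [p1 p2 /andP[rp _]].
  exact: (cvg_comp _ _ (@dist2_continuous p) (tame_continuous_r tk (d0 _ _ p1) (ab _ rp))).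
have fz0 p : (0 <= fz p)%E by rewrite fzE.
rewrite -(fubini_tonelli1 fz mfz fz0) le_eqVlt; apply/orP; left; apply/eqP.
by apply: eq_integral => p _; exact: fzE.
Qed.

End polar.

(** * Reduction of the theorem to the half-plane *)

Section reduction.
Context {R : realType}.
Variables (alpha : R) (alpha0 : 0 <= alpha).
Local Notation h := (channel alpha).
Variables (v : 'rV[R]_3 -> 'rV[R]_3) (P : 'rV[R]_3 -> R) (v_r v_theta v_3 p : R -> R -> R).
Hypothesis axi : axisymmetric (Omega alpha) v P v_r v_theta v_3 p.
Hypothesis sv : forall i : 'I_3, smooth (Omega alpha) (component v i).
Hypothesis sP : smooth (Omega alpha) P.

Local Notation a := (meridian_jet (component v 0)).
Local Notation b := (meridian_jet (component v 1)).
Local Notation c := (meridian_jet (component v 2)).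
Local Notation q := (meridian_jet P).

Local Notation av r z := (component v 0 (row3 r 0 z)).
Local Notation bv r z := (component v 1 (row3 r 0 z)).
Local Notation cv r z := (component v 2 (row3 r 0 z)).
Local Notation qv r z := (P (row3 r 0 z)).

Lemma axi_meridian (r z : R) : 0 < r -> `|z| <= h r ->
  [/\ v_r r z = av r z, v_theta r z = bv r z & v_3 r z = cv r z].
Proof.
move=> r0 zr; case: axi => axv _.
have rr := rho_meridian z (ltW r0).
have /= := axv _ (meridian_Omega (ltW r0) zr); rewrite rr => /(_ r0).
rewrite !row3E => vE; rewrite /= /component vE !mxE /= rr.
by rewrite ?mxE /= divff ?gt_eqF//; split; ring.
Qed.

Lemma axi_components x : Omega alpha x -> 0 < rho x ->
  [/\ component v 0 x = av (rho x) (x 0 2) * (x 0 0 / rho x) -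
        bv (rho x) (x 0 2) * (x 0 1 / rho x),
      component v 1 x = bv (rho x) (x 0 2) * (x 0 0 / rho x) +
        av (rho x) (x 0 2) * (x 0 1 / rho x) &
      component v 2 x = cv (rho x) (x 0 2)].
Proof.
move=> Ox r0; have := axi_meridian r0 Ox.
move: (av _ _) (bv _ _) (cv _ _) => A B C [eA eB eC].
case: axi => /(_ x Ox r0) vE _.
rewrite /component vE !mxE /= eA eB eC; clear.
by split; rewrite ?mulr0 ?mulr1 ?addr0 ?add0r// ?mulNr ?mulrN// addrC.
Qed.

Lemma axi_pressure x : Omega alpha x -> 0 < rho x -> P x = qv (rho x) (x 0 2).
Proof.
move=> Ox r0; case: axi => _ ap; rewrite ap// /= ap ?row3E ?rho_meridian ?(ltW r0)//.
exact: meridian_Omega (ltW r0) Ox.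
Qed.

Lemma axi_azimuthal (r z : R) : 0 < r -> `|z| < h r ->
  let X := row3 r 0 z in
  [/\ partial 1 (component v 0) X = - (bv r z / r) /\
       partial 1 (partial 1 (component v 0)) X = partial 0 (component v 0) X / r - av r z / r ^+ 2,
      partial 1 (component v 1) X = av r z / r /\
       partial 1 (partial 1 (component v 1)) X = partial 0 (component v 1) X / r - bv r z / r ^+ 2,
      partial 1 (component v 2) X = 0 /\
       partial 1 (partial 1 (component v 2)) X = partial 0 (component v 2) X / r &
      partial 1 P X = 0].
Proof.
move=> r0 zr X.
have [_ mh _] := channel_profile alpha0.
have zs (s : R) : r <= s -> 0 < s /\ `|z| < h s.
  by move=> rs; split; [exact: lt_le_trans rs|rewrite (lt_le_trans zr)// mh].
have d1 (F : 'rV[R]_3 -> R) : smooth (Omega alpha) F -> forall s : R, r <= s ->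
    is_derive s 1 (fun s => F (row3 s 0 z)) (partial 0 F (row3 s 0 z)).
  by move=> sF s /zs[s0 zs']; exact: (partials_der_r alpha0 sF [::] s0 zs').
have d2 (F : 'rV[R]_3 -> R) : smooth (Omega alpha) F -> forall s : R, r <= s ->
    is_derive s 1 (fun s => partial 0 F (row3 s 0 z)) (partial 0 (partial 0 F) (row3 s 0 z)).
  by move=> sF s /zs[s0 zs']; exact: (partials_der_r alpha0 sF [:: 0] s0 zs').
have [a1 a2] := radial_quotient r0 (d1 _ (sv 0)) (d2 _ (sv 0)).
have [b1 b2] := radial_quotient r0 (d1 _ (sv 1)) (d2 _ (sv 1)).
have chord (t : R) : [/\ Omega alpha (row3 r t z), rho (row3 r t z) = dist r t, 0 < dist r t &
    dist r t != 0].
  have d0 : 0 < dist r t := lt_le_trans r0 (dist_ge t r0).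
  by split; [exact/open_channel_Omega/chord_open|exact: rho_chord|exact: d0|rewrite gt_eqF].
split.
- apply: (@azimuthal_partials _ _ alpha0 _ _ _ _ (fun s => - (bv s z / s)) _ _ _ _ (sv 0) r0 zr a1 a2).
  + by move=> s rs; apply: is_deriveN; exact: b1.
  + by move=> s rs; apply: is_deriveN; exact: b2.
  + move=> t; have [Ot rt d0 dn] := chord t; have := axi_components Ot.
    rewrite rt => /(_ d0)[-> _ _]; rewrite !row3E.
    by move: (av _ _) (bv _ _) => A B; field.
- apply: (@azimuthal_partials _ _ alpha0 _ _ _ _ _ _ _ _ _ (sv 1) r0 zr b1 b2 a1 a2).
  move=> t; have [Ot rt d0 dn] := chord t; have := axi_components Ot.
  rewrite rt => /(_ d0)[_ -> _]; rewrite !row3E.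
  by move: (av _ _) (bv _ _) => A B; field.
- apply: (@azimuthal_partials _ _ alpha0 _ (fun s => cv s z / r)
    (fun s => partial 0 (component v 2) (row3 s 0 z) / r)
    (fun s => partial 0 (partial 0 (component v 2)) (row3 s 0 z) / r)
    (fun=> 0) (fun=> 0) (fun=> 0) r z (sv 2) r0 zr).
  + by move=> s rs; apply: is_derive_eq (der1M (d1 _ (sv 2) s rs) (der1C r^-1 s)) _; ring.
  + by move=> s rs; apply: is_derive_eq (der1M (d2 _ (sv 2) s rs) (der1C r^-1 s)) _; ring.
  + move=> t; have [Ot rt d0 dn] := chord t; have := axi_components Ot.
    rewrite rt => /(_ d0)[_ _ ->]; rewrite !row3E.
    by move: (cv _ _) => A; field; rewrite gt_eqF.
- apply: (proj1 (@azimuthal_partials _ _ alpha0 _ (fun s => qv s z / r)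
    (fun s => partial 0 P (row3 s 0 z) / r)
    (fun s => partial 0 (partial 0 P) (row3 s 0 z) / r)
    (fun=> 0) (fun=> 0) (fun=> 0) r z sP r0 zr _ _ _ _ _)).
  + by move=> s rs; apply: is_derive_eq (der1M (d1 _ sP s rs) (der1C r^-1 s)) _; ring.
  + by move=> s rs; apply: is_derive_eq (der1M (d2 _ sP s rs) (der1C r^-1 s)) _; ring.
  + move=> t; have [Ot rt d0 dn] := chord t; have := axi_pressure Ot.
    rewrite rt => /(_ d0) ->; rewrite !row3E.
    by move: (qv _ _) => A; field; rewrite gt_eqF.
Qed.

Hypothesis ns : stationary_navier_stokes (Omega alpha) v P.

Lemma axi_equations (r z : R) : 0 < r -> `|z| < h r ->
  let X := row3 r 0 z in
  let A := av r z in let B := bv r z in let C := cv r z in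
  [/\ partial 0 (component v 0) X + A / r + partial 2 (component v 2) X = 0,
      A * partial 0 (component v 0) X + C * partial 2 (component v 0) X - B ^+ 2 / r + partial 0 P X =
      partial 0 (partial 0 (component v 0)) X + partial 2 (partial 2 (component v 0)) X +
        partial 0 (component v 0) X / r - A / r ^+ 2,
      A * partial 0 (component v 1) X + A * B / r + C * partial 2 (component v 1) X =
      partial 0 (partial 0 (component v 1)) X + partial 2 (partial 2 (component v 1)) X +
        partial 0 (component v 1) X / r - B / r ^+ 2 &
      A * partial 0 (component v 2) X + C * partial 2 (component v 2) X + partial 2 P X =
      partial 0 (partial 0 (component v 2)) X + partial 2 (partial 2 (component v 2)) X +
        partial 0 (component v 2) X / r].
Proof.
move=> r0 zr X A B C.
have [[a1 a2] [b1 b2] [c1 c2] p1] := axi_azimuthal r0 zr.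
have [mom div] := ns (open_channel_interior alpha0 (meridian_open r0 zr)).
move: div (mom 0) (mom 1) (mom 2).
rewrite divergenceE !advectionE !laplacianE a1 b1 c1 p1 a2 b2 c2 -/X -/A -/B -/C.
move=> e1 e2 e3 e4; split; first exact: e1.
- exact: momentum_r_scalar e2.
- exact: momentum_th_scalar e3.
- exact: momentum_z_scalar e4.
Qed.

(** Vertical derivatives commute with rotations about the axis. *)
Lemma axi_dz x : open_channel alpha x -> 0 < rho x ->
  let X := row3 (rho x) 0 (x 0 2) in
  partial 2 (component v 0) x ^+ 2 + partial 2 (component v 1) x ^+ 2 +
    partial 2 (component v 2) x ^+ 2 =
  partial 2 (component v 0) X ^+ 2 + partial 2 (component v 1) X ^+ 2 +
    partial 2 (component v 2) X ^+ 2.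
Proof.
move=> Wx r0 X.
have zr : `|x 0 2| < h (rho x) := Wx.
have vert (F : 'rV[R]_3 -> R) (x1 x2 : R) : smooth (Omega alpha) F ->
    open_channel alpha (row3 x1 x2 (x 0 2)) ->
    is_derive (x 0 2) 1 (fun t => F (row3 x1 x2 t)) (partial 2 F (row3 x1 x2 (x 0 2))).
  move=> sF Wy; apply: (@is_derive_along _ F (fun t => row3 x1 x2 t)).
    by move=> k; exact: shift_z.
  exact: (@partials_derivable _ _ alpha0 _ sF [::] 2 _ Wy).
have near_z : \forall t \near x 0 2, `|t| < h (rho x).
  by apply: (@cvgr_lt _ _ (nbhs (x 0 2))) zr; exact: norm_continuous.
have rx t : rho (row3 (x 0 0) (x 0 1) t) = rho x by rewrite /rho !row3E.
have av' := vert _ _ 0 (sv 0) (meridian_open r0 zr).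
have bv' := vert _ _ 0 (sv 1) (meridian_open r0 zr).
have cv' := vert _ _ 0 (sv 2) (meridian_open r0 zr).
have Wx' : open_channel alpha (row3 (x 0 0) (x 0 1) (x 0 2)) by rewrite -row3_eta.
have off i := vert _ _ _ (sv i) Wx'.
have rep t : `|t| < h (rho x) -> let: y := row3 (x 0 0) (x 0 1) t in
   [/\ component v 0 y = av (rho x) t * (x 0 0 / rho x) + - (bv (rho x) t * (x 0 1 / rho x)),
      component v 1 y = bv (rho x) t * (x 0 0 / rho x) + av (rho x) t * (x 0 1 / rho x) &
      component v 2 y = cv (rho x) t].
  move=> tr; have Ot : Omega alpha (row3 (x 0 0) (x 0 1) t).
    by rewrite /Omega /= row3E rx; exact: ltW.
  by have := axi_components Ot; rewrite rx !row3E; apply.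
have uniq (f g : R -> R) (k l : R) : (\forall t \near x 0 2, f t = g t) ->
    is_derive (x 0 2) 1 f k -> is_derive (x 0 2) 1 g l -> k = l.
  move=> fg df dg; have df' := near_is_derive fg dg.
  by rewrite -(@derive_val _ _ _ _ _ _ _ df) -[RHS](@derive_val _ _ _ _ _ _ _ df').
pose k0 := x 0 0 / rho x; pose k1 := x 0 1 / rho x.
have e0 := uniq _ _ _ _ _ (off 0) (der1D (der1M av' (der1C k0 _)) (is_deriveN (der1M bv' (der1C k1 _)))).
have e1 := uniq _ _ _ _ _ (off 1) (der1D (der1M bv' (der1C k0 _)) (der1M av' (der1C k1 _))).
have e2 := uniq _ _ _ _ _ (off 2) cv'.
rewrite [in LHS](row3_eta x) e0 ?e1 ?e2; try by apply: filterS near_z => t /rep[].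
rewrite !mulr0 !addr0 -/X; congr (_ + _).
by apply: rotation_scalar; [rewrite gt_eqF|rewrite sqr_sqrtr// addr_ge0 ?sqr_ge0].
Qed.

Lemma cvg_sumr (I T : Type) (r : seq I) (F : set_system T) (FF : Filter F) (f : I -> T -> R)
    (l : I -> R) : (forall i, f i t @[t --> F] --> l i) ->
  \sum_(i <- r) f i t @[t --> F] --> \sum_(i <- r) l i.
Proof.
move=> fl; elim: r => [|i r IH].
  rewrite big_nil (_ : (fun t => _) = (fun=> 0)); first exact: cvg_cst.
  by apply/funext => t; rewrite big_nil.
rewrite big_cons (_ : (fun t => _) = (fun t => f i t + \sum_(j <- r) f j t)).
  by apply: cvgD; [exact: fl|exact: IH].
by apply/funext => t; rewrite big_cons.
Qed.

Lemma grad_sqr_continuous (x : 'rV[R]_3) : interior (Omega alpha) x ->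
  {for x, continuous (grad_sqr v : 'rV[R]_3 -> R)}.
Proof.
move=> ix; have FF : Filter (nbhs x) := nbhs_filter x.
apply: (@cvg_sumr _ _ _ _ FF) => i; apply: (@cvg_sumr _ _ _ _ FF) => j.
have c1 := @partials_continuous _ _ _ (sv i) [:: j] _ ix.
exact: (@cvgM R _ _ _ _ _ _ _ c1 c1).
Qed.

Lemma grad_sqr_ge_dz x : partial 2 (component v 0) x ^+ 2 + partial 2 (component v 1) x ^+ 2 +
    partial 2 (component v 2) x ^+ 2 <= grad_sqr v x.
Proof.
have row i : partial 2 (component v i) x ^+ 2 <= \sum_(j < 3) partial j (component v i) x ^+ 2.
  by rewrite (bigD1 2)//= lerDl sumr_ge0// => j _; rewrite sqr_ge0.
apply: (@le_trans _ _ (\sum_(i < 3) partial 2 (component v i) x ^+ 2)).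
  by rewrite le_eqVlt; apply/orP; left; apply/eqP; apply: esym; exact: sum3.
by apply: ler_sum => i _; exact: row.
Qed.

Lemma row3_continuous : continuous (fun t : R * R * R => row3 t.1.1 t.1.2 t.2).
Proof.
move=> t; apply: cvg_row3; last exact: cvg_snd.
- apply: (@continuous_comp _ _ _ (fun t : R * R * R => t.1) (fun p : R * R => p.1)).
    exact: cvg_fst.
  exact: cvg_fst.
- apply: (@continuous_comp _ _ _ (fun t : R * R * R => t.1) (fun p : R * R => p.2)).
    exact: cvg_fst.
  exact: cvg_snd.
Qed.

Hypothesis dv : (dirichlet_integral (Omega alpha) v < +oo)%E.

Definition dz_sqr (r z : R) : R := partial 2 (component v 0) (row3 r 0 z) ^+ 2 +
  partial 2 (component v 1) (row3 r 0 z) ^+ 2 + partial 2 (component v 2) (row3 r 0 z) ^+ 2.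

Lemma dz_sqr_tame : tame h dz_sqr.
Proof.
have t i := partials_tame alpha0 (sv i) [:: 2].
apply: tameD; first apply: tameD.
- exact: (tameX 2 (t 0)).
- exact: (tameX 2 (t 1)).
- exact: (tameX 2 (t 2)).
Qed.

(** Only the vertical derivatives over one quadrant are kept of the Dirichlet integral. *)
Lemma dirichlet_bound (S : R) : 0 < S ->
  ((chan_int h S (fun r z => r * dz_sqr r z))%:E <= dirichlet_integral (Omega alpha) v)%E.
Proof.
move=> S0; have ph := channel_profile alpha0.
have oI : open [set t : R * R * R | interior (Omega alpha) (row3 t.1.1 t.1.2 t.2)].
  apply: (@open_comp _ _ (fun t : R * R * R => row3 t.1.1 t.1.2 t.2)).
    by move=> t _; exact: row3_continuous.
  exact: open_interior.
have sec t : sector h S t -> [/\ open_channel alpha (row3 t.1.1 t.1.2 t.2),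
    rho (row3 t.1.1 t.1.2 t.2) = dist t.1.1 t.1.2 & 0 < dist t.1.1 t.1.2].
  move=> [t1 _ _ th]; split; first by rewrite /open_channel /= row3E rho_chord.
    exact: rho_chord.
  exact: lt_le_trans t1 (dist_ge _ t1).
have SI' : sector h S `<=` [set t : R * R * R | interior (Omega alpha) (row3 t.1.1 t.1.2 t.2)].
  by move=> t /sec[W _ _]; exact: open_channel_interior.
have mG : measurable_fun ([set t : R * R * R | interior (Omega alpha) (row3 t.1.1 t.1.2 t.2)] :
    set (measurableTypeR R * measurableTypeR R * measurableTypeR R))
    (fun t => (grad_sqr v (row3 t.1.1 t.1.2 t.2))%:E).
  apply/measurable_EFinP; apply: continuous_space_measurable => // t it.
  exact: (cvg_comp _ _ (@row3_continuous t) (grad_sqr_continuous it)).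
have mS : measurable (sector h S : set (measurableTypeR R * measurableTypeR R * measurableTypeR R)).
  by apply: open_measurable_space; exact: sector_open.
have G0 x : 0 <= grad_sqr v x by rewrite sumr_ge0// => i _; rewrite sumr_ge0// => j _; rewrite sqr_ge0.
have k0 (r z : R) : 0 <= dz_sqr r z by rewrite !addr_ge0 ?sqr_ge0.
apply: le_trans (polar_space ph S0 dz_sqr_tame (fun r z _ _ => k0 r z)) _.
apply: le_trans (ge0_subset_integral _ mS _ mG _ SI').
- apply: ge0_le_integral => //.
  + by move=> t _; rewrite lee_fin k0.
  + apply/measurable_EFinP; apply: continuous_space_measurable; first exact: sector_open.
    by move=> t; exact: tame_sector_continuous dz_sqr_tame.
  + exact: (measurable_funS (open_measurable_space oI) SI' mG).
  + move=> t /sec[W rt d0]; rewrite lee_fin -rt.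
    rewrite -{2}[t.2](row3_2 t.1.1 t.1.2) /dz_sqr -axi_dz ?rt//.
    exact: grad_sqr_ge_dz.
- exact: open_measurable_space.
- by move=> t _; rewrite lee_fin G0.
Qed.

Hypothesis vbd : [bounded v x | x in Omega alpha].
Hypothesis v0 : forall x, frontier (Omega alpha) x -> v x = 0.

Lemma entry_le_norm (y : 'rV[R]_3) (i : 'I_3) : `|y 0 i| <= `|y|.
Proof. by rewrite [leRHS]mx_normrE; apply: (@le_bigmax _ _ _ _ (fun ij => `|y ij.1 ij.2|) (0, i)). Qed.

Lemma component0 (i : 'I_3) x : frontier (Omega alpha) x -> component v i x = 0.
Proof. by move=> /v0 vx; rewrite /component vx mxE. Qed.

Lemma axi_flow : exists M D : R, flow h M D a b c q.
Proof.
have [M [_ HM]] := vbd.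
have speed (i : 'I_3) (r z : R) : 0 < r -> `|z| < h r -> `|component v i (row3 r 0 z)| <= M + 1.
  move=> r0 zr; apply: le_trans (entry_le_norm _ _) _.
  by apply: (HM (M + 1)); [rewrite ltrDl|exact: (meridian_Omega (ltW r0) (ltW zr))].
have ph := channel_profile alpha0.
exists (M + 1), (fine (dirichlet_integral (Omega alpha) v)).
apply: Flow.
- exact: ph.
- exact: (meridian_jet_on alpha0 (sv 0)).
- exact: (meridian_jet_on alpha0 (sv 1)).
- exact: (meridian_jet_on alpha0 (sv 2)).
- exact: (meridian_jet_on alpha0 sP).
- exact: (meridian_wall_vanishing alpha0 (sv 0) (@component0 0)).
- exact: (meridian_wall_vanishing alpha0 (sv 1) (@component0 1)).
- exact: (meridian_wall_vanishing alpha0 (sv 2) (@component0 2)).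
- exact: speed 0.
- exact: speed 1.
- by move=> r z r0 zr; have [e1 e2 e3 e4] := axi_equations r0 zr; exact: e1.
- by move=> r z r0 zr; have [e1 e2 e3 e4] := axi_equations r0 zr; exact: e2.
- by move=> r z r0 zr; have [e1 e2 e3 e4] := axi_equations r0 zr; exact: e3.
- by move=> r z r0 zr; have [e1 e2 e3 e4] := axi_equations r0 zr; exact: e4.
move=> S; have t i := partials_tame alpha0 (sv i) [:: 2].
have tr (f : R -> R -> R) : tame h f -> tame h (fun r z => r * (f r z * f r z)).
  by move=> tf; tame_tac.
have tk : tame h (fun r z => r * dz_sqr r z) by have td := dz_sqr_tame; tame_tac.
have -> : chan_int h S (fun r z => r * (d_z a r z * d_z a r z)) +
    chan_int h S (fun r z => r * (d_z b r z * d_z b r z)) +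
    chan_int h S (fun r z => r * (d_z c r z * d_z c r z)) = chan_int h S (fun r z => r * dz_sqr r z).
  rewrite -(chan_intD S ph (tr _ (t 0)) (tr _ (t 1))).
  rewrite -(chan_intD S ph (tameD (tr _ (t 0)) (tr _ (t 1))) (tr _ (t 2))).
  congr (chan_int h S _); apply/funext => r; apply/funext => z.
  by rewrite /dz_sqr !mulrDr !expr2.
have pos (T r z : R) : 0 < r < T -> `|z| < h r -> 0 <= r * dz_sqr r z.
  by move=> /andP[r0 _] _; rewrite mulr_ge0 ?(ltW r0)// !addr_ge0 ?sqr_ge0.
have T0 : 0 < Num.max 1 S by rewrite lt_max ltr01.
have ST : S <= Num.max 1 S by rewrite le_max lexx orbT.
apply: le_trans (chan_int_subset ph tk ST (pos _)) _.
have dB := dirichlet_bound T0.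
have D0 : (0 <= dirichlet_integral (Omega alpha) v)%E.
  by apply: le_trans dB; rewrite lee_fin; exact: chan_int_ge0 (pos _).
have Dfin : dirichlet_integral (Omega alpha) v \is a fin_num by rewrite ge0_fin_numE.
by move: dB; rewrite -[X in (_ <= X)%E -> _](fineK Dfin) lee_fin.
Qed.

Lemma no_swirl : alpha < 3 / 4 ->
  forall x, Omega alpha x -> 0 < rho x -> v_theta (rho x) (x 0 2) = 0.
Proof.
move=> a34 x Ox r0; have [_ -> _] := axi_meridian r0 Ox.
have [M [D fl]] := axi_flow.
move: (Ox); rewrite /Omega /= le_eqVlt => /predU1P[xh|xh].
  apply: component0; apply: channel_wall_frontier => //.
  by rewrite row3E rho_meridian// ltW.
apply: (flow_swirl_free fl _ r0 xh) => e e0.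
by apply: channel_growth => //; move: a34; lra.
Qed.

(** Inside the channel and off the axis this is [flow_still]; the walls are covered by the
    no-slip condition and the axis by continuity. *)
Lemma no_flow : alpha < 1 / 2 -> forall x, Omega alpha x -> v x = 0.
Proof.
move=> a12; have [M [D fl]] := axi_flow.
have still (r z : R) : 0 < r -> `|z| < h r -> forall i, component v i (row3 r 0 z) = 0.
  move=> r0 zr; have gr (e : R) : 0 < e -> exists S0 : R, forall S, S0 <= S -> h S * h S <= e * S.
    by move=> e0; apply: (@channel_growth _ alpha 2 1 _ e e0); move: a12; lra.
  by have [e1 e2 e3] := flow_still fl gr r0 zr; apply: ord3P.
move=> x Ox; apply/matrixP => k i; rewrite ord1 mxE.
move: (Ox); rewrite /Omega /= le_eqVlt => /predU1P[xh|xh].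
  exact: component0 (channel_wall_frontier alpha0 xh).
have [r0|] := ltP 0 (rho x).
  have s := still _ _ r0 xh.
  have [e1 e2 e3] := axi_components Ox r0.
  by elim/ord3P: i; rewrite -/(component v _ x) ?e1 ?e2 ?e3 !s ?mul0r ?subr0 ?addr0.
rewrite le_eqVlt ltNge rho_ge0 orbF => /eqP rx0.
have x0 : x = row3 0 0 (x 0 2).
  have := rx0; rewrite /rho => /eqP; rewrite sqrtr_eq0 => s0.
  have : x 0 0 ^+ 2 + x 0 1 ^+ 2 == 0 by rewrite eq_le s0 addr_ge0 ?sqr_ge0.
  rewrite paddr_eq0 ?sqr_ge0// !sqrf_eq0 => /andP[/eqP e0 /eqP e1].
  by rewrite {1}(row3_eta x) e0 e1.
have cx := @partials_continuous _ _ _ (sv i) [::] x (open_channel_interior alpha0 xh).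
have m : row3 r 0 (x 0 2) @[r --> (0 : R)^'+] --> x.
  rewrite [X in _ --> X]x0; apply: cvg_row3; [|exact: cvg_cst|exact: cvg_cst].
  by apply: cvg_at_right_filter; exact: cvg_id.
have lim0 : component v i (row3 r 0 (x 0 2)) @[r --> (0 : R)^'+] --> (0 : R).
  apply: (@cvg0_squeeze _ _ _ _ _ (fun=> 0)); last exact: cvg_cst.
  near=> r; have r0 : 0 < r by near: r; exact: nbhs_right_gt.
  rewrite still ?normr0// (lt_le_trans xh)//.
  by have [_ mh _] := channel_profile alpha0; rewrite mh// rx0 ltW.
have lim1 : component v i (row3 r 0 (x 0 2)) @[r --> (0 : R)^'+] --> component v i x.
  exact: (cvg_comp _ _ m cx).
by have := cvg_unique _ lim1 lim0; apply.
Unshelve. all: by end_near. Qed.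

End reduction.

Theorem theorem4p21 (R : realType) (alpha : R)
    (v : 'rV[R]_3 -> 'rV[R]_3) (P : 'rV[R]_3 -> R)
    (v_r v_theta v_3 p : R -> R -> R) :
  0 <= alpha ->
  axisymmetric (Omega alpha) v P v_r v_theta v_3 p ->
  (forall i : 'I_3, smooth (Omega alpha) (component v i)) ->
  smooth (Omega alpha) P ->
  [bounded v x | x in Omega alpha] ->
  stationary_navier_stokes (Omega alpha) v P ->
  (forall x, frontier (Omega alpha) x -> v x = 0) ->
  (dirichlet_integral (Omega alpha) v < +oo)%E ->
  (alpha < 1 / 2 -> forall x, Omega alpha x -> v x = 0) /\
  (alpha < 3 / 4 ->
     forall x, Omega alpha x -> 0 < rho x -> v_theta (rho x) (x 0 2) = 0).
Proof.
move=> a0 axi sv sP vb ns v0 dv; split=> a1.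
  exact: (no_flow a0 axi sv sP ns dv vb v0 a1).
exact: (no_swirl a0 axi sv sP ns dv vb v0 a1).
Qed.
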